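(* Let $\mathfrak{A}$ be a $\mathbb{Z}_2$-graded $C^*$-algebra. Then the following are equivalent: (i) for any $\mathbb{Z}_2$-graded $C^*$-algebra $\mathfrak{B}$, $\mathfrak{B}\,\hat{\otimes}_{\max}\,\mathfrak{A}=\mathfrak{B}\,\hat{\otimes}_{\min}\,\mathfrak{A}$ (that is, the norms $\|\cdot\|_{\max}$ and $\|\cdot\|_{\min}$ coincide on $\mathfrak{B}\,\hat{\otimes}\,\mathfrak{A}$); (ii) for any $\mathbb{Z}_2$-graded von Neumann algebra $\mathcal{R}$, $\mathcal{R}\,\hat{\otimes}_{\mathrm{nor}}\,\mathfrak{A}=\mathcal{R}\,\hat{\otimes}_{\min}\,\mathfrak{A}$ (that is, the norms $\|\cdot\|_{\mathrm{nor}}$ and $\|\cdot\|_{\min}$ coincide on $\mathcal{R}\,\hat{\otimes}\,\mathfrak{A}$).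
   Context: All algebras are unital. A $\mathbb{Z}_2$-graded $C^*$-algebra is a pair $(\mathfrak{A},\theta)$ with $\mathfrak{A}$ a $C^*$-algebra and $\theta$ a $*$-automorphism with $\theta^2=\mathrm{id}$. Elements with $\theta(a)=a$ are even, with grade $\partial(a)=1$, and elements with $\theta(a)=-a$ are odd, with grade $\partial(a)=-1$; both are called homogeneous, and every element is uniquely the sum of an even and an odd one. A state $\omega$ is even if $\omega\circ\theta=\omega$; $\mathcal{S}_+(\mathfrak{A})$ is the set of even states. A $\mathbb{Z}_2$-graded von Neumann algebra is a von Neumann algebra $\mathcal{R}\subseteq\mathcal{B}(\mathcal{H})$ with grading the restriction to $\mathcal{R}$ of $\gamma=\mathrm{ad}_\Gamma:\ r\mapsto\Gamma r\Gamma$, for a self-adjoint unitary $\Gamma$ on $\mathcal{H}$ with $\Gamma\mathcal{R}\Gamma=\mathcal{R}$. $\mathcal{R}_*$ is the predual of $\mathcal{R}$ (normal functionals). Fermi tensor product: for $\mathbb{Z}_2$-graded $C^*$-algebras $\mathfrak{A}_1,\mathfrak{A}_2$, $\mathfrak{A}_1\hat{\otimes}\mathfrak{A}_2$ is the algebraic tensor product $\mathfrak{A}_1\odot\mathfrak{A}_2$ as a vector space, with the $*$-algebra structure determined on homogeneous elements by $$(a_1\otimes a_2)(b_1\otimes b_2)=\epsilon(\partial(a_2),\partial(b_1))\,a_1b_1\otimes a_2b_2,\qquad (a_1\otimes a_2)^*=\epsilon(\partial(a_1),\partial(a_2))\,a_1^*\otimes a_2^*,$$ where $\epsilon(i,j)=-1$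 if $i=j=-1$ and $\epsilon(i,j)=1$ otherwise. For states $\omega_1,\omega_2$ on $\mathfrak{A}_1,\mathfrak{A}_2$, the product functional is $(\omega_1\times\omega_2)(\sum_j a_{1,j}\otimes a_{2,j})=\sum_j\omega_1(a_{1,j})\omega_2(a_{2,j})$; it is positive when at least one of the two states is even. Let $\pi_{\omega_1\times\omega_2}$ be its GNS representation. Norms: for $x\in\mathfrak{A}_1\hat{\otimes}\mathfrak{A}_2$, $\|x\|_{\min}:=\sup\{\|\pi_{\omega_1\times\omega_2}(x)\|:\ \omega_1\in\mathcal{S}_+(\mathfrak{A}_1),\ \omega_2\in\mathcal{S}_+(\mathfrak{A}_2)\}$ and $\|x\|_{\max}:=\sup\{\|\pi(x)\|:\ \pi \text{ a } *\text{-representation of } \mathfrak{A}_1\hat{\otimes}\mathfrak{A}_2 \text{ on a Hilbert space}\}$; the completions are $\mathfrak{A}_1\hat{\otimes}_{\min}\mathfrak{A}_2$ and $\mathfrak{A}_1\hat{\otimes}_{\max}\mathfrak{A}_2$. Normal norm: for a $\mathbb{Z}_2$-graded von Neumann algebra $\mathcal{R}$ and a $\mathbb{Z}_2$-graded $C^*$-algebra $\mathfrak{B}$, let $\mathrm{nor}$ be the set of states $\varphi$ on the $*$-algebra $\mathcal{R}\hat{\otimes}\mathfrak{B}$ such that $T_\varphi(\mathfrak{B})\subseteq\mathcal{R}_*$, where $T_\varphi(b)(r):=\varphi(r\otimes b)$ for $r\in\mathcal{R}$, $b\in\mathfrak{B}$. Then $\|x\|_{\mathrm{nor}}:=\sup\{\varphi(xx^*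 )^{1/2}:\ \varphi\in\mathrm{nor}\}$ for $x\in\mathcal{R}\hat{\otimes}\mathfrak{B}$, and the completion is the normal tensor product $\mathcal{R}\hat{\otimes}_{\mathrm{nor}}\mathfrak{B}$. *)

(* Defs.v *)
From HB Require Import structures.
From mathcomp Require Import all_boot all_order all_algebra.
From mathcomp Require Import complex ring lra.
From mathcomp Require Import all_classical all_reals all_analysis.

Set Implicit Arguments.
Unset Strict Implicit.
Unset Printing Implicit Defensive.

Import Order.TTheory GRing.Theory Num.Theory Num.Def numFieldNormedType.Exports.

Local Open Scope classical_set_scope.
Local Open Scope ring_scope.

HB.mixin Record isStarAlgebra (R : realType) A of GRing.Algebra R[i] A := {
  star : A -> A;
  starK : involutive star;
  starD : {morph star : x y / x + y};
  starZ : forall (c : R[i]) (x : A), star (c *: x) = c^* *: star x;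
  starM : forall x y : A, star (x * y) = star y * star x
}.
#[short(type="starAlgType")]
HB.structure Definition StarAlgebra (R : realType) :=
  {A of GRing.Algebra R[i] A & isStarAlgebra R A}.

HB.mixin Record isGraded (R : realType) A of StarAlgebra R A := {
  grading : A -> A;
  gradingK : involutive grading;
  gradingL : linear grading;
  gradingM : GRing.monoid_morphism grading;
  gradingS : forall x : A, grading (star x) = star (grading x)
}.
#[short(type="gradedStarAlgType")]
HB.structure Definition GradedStarAlgebra (R : realType) :=
  {A of StarAlgebra R A & isGraded R A}.

(* The norm is a mixin field and not the norm of a completeNormedModType: a
   structure that is both a ring and a normed module would need a join of
   GRing.PzSemiRing and Num.SemiNormedZmodule below Num.NumDomain, and there
   is none. *)
HB.mixin Record isCStarAlgebra (R : realType) A of StarAlgebra R A := {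
  cnorm : A -> R;
  cnorm0_eq0 : forall x : A, cnorm x = 0 -> x = 0;
  cnormD : forall x y : A, cnorm (x + y) <= cnorm x + cnorm y;
  cnormZ : forall (c : R[i]) (x : A), cnorm (c *: x) = complex.Re `|c| * cnorm x;
  cnormM : forall x y : A, cnorm (x * y) <= cnorm x * cnorm y;
  cnorm_star : forall x : A, cnorm (star x * x) = cnorm x ^+ 2;
  cnorm_complete : forall u : nat -> A,
    (forall e : R, 0 < e ->
       exists N, forall m n, (N <= m)%N -> (N <= n)%N -> cnorm (u m - u n) < e) ->
    exists l : A, forall e : R, 0 < e ->
      exists N, forall n, (N <= n)%N -> cnorm (u n - l) < e
}.
#[short(type="cstarAlgType")]
HB.structure Definition CStarAlgebra (R : realType) :=
  {A of StarAlgebra R A & isCStarAlgebra R A}.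

#[short(type="gradedCstarAlgType")]
HB.structure Definition GradedCStarAlgebra (R : realType) :=
  {A of GradedStarAlgebra R A & CStarAlgebra R A}.

(* Hilbert spaces are taken nonzero, so that 'B H' below satisfies the axiom
   1 != 0 of GRing.Algebra. *)
HB.mixin Record isHilbert (R : realType) H of CompleteNormedModule R[i] H := {
  inner : {dot H for (@conjC R[i])};
  innerE : forall x : H, inner x x = `|x| ^+ 2;
  hilbert_neq0 : exists x : H, x != 0
}.
#[short(type="hilbertType")]
HB.structure Definition Hilbert (R : realType) :=
  {H of CompleteNormedModule R[i] H & isHilbert R H}.

Arguments star {R s} x.
Arguments grading {R s} x.

Section HilbertTheory.
Variables (R : realType) (H : hilbertType R).
Implicit Types (u v w x y z : H) (c : R[i]).
Local Notation "<< x , y >>" := (@inner R H x y).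
Local Notation Re := (@complex.Re R).
Local Notation Im := (@complex.Im R).

Lemma innerC x y : << x, y >> = << y, x >>^*.
Proof. by rewrite hermC expr0 mul1r. Qed.

Lemma innerDl x y z : << x + y, z >> = << x, z >> + << y, z >>.
Proof. exact: linearDl. Qed.
Lemma innerDr x y z : << x, y + z >> = << x, y >> + << x, z >>.
Proof. exact: linearD. Qed.
Lemma innerZl c x z : << c *: x, z >> = c * << x, z >>.
Proof. exact: linearZl_LR. Qed.
Lemma innerZr c x z : << x, c *: z >> = c^* * << x, z >>.
Proof. exact: linearZ_LR. Qed.
Lemma innerBl x y z : << x - y, z >> = << x, z >> - << y, z >>.
Proof. exact: linearBl. Qed.
Lemma innerBr x y z : << x, y - z >> = << x, y >> - << x, z >>.
Proof. exact: linearB. Qed.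

Lemma conjCE c : c^* = conjc c.
Proof. by []. Qed.

Definition hnorm v : R := Re `|v|.

Lemma normE v : `|v| = (hnorm v)%:C%C.
Proof. by rewrite /hnorm RRe_real // normr_real. Qed.

Lemma hnorm_ge0 v : 0 <= hnorm v.
Proof. by rewrite -lecR -normE normr_ge0. Qed.

Lemma inner_hnorm v : << v, v >> = (hnorm v ^+ 2)%:C%C.
Proof. by rewrite innerE normE -rmorphXn. Qed.

Definition rinner u v : R := Re << u, v >>.

Lemma rinnerC u v : rinner u v = rinner v u.
Proof. by rewrite /rinner innerC conjCE; case: (<< _ , _ >>). Qed.
Lemma rinnerDl x y z : rinner (x + y) z = rinner x z + rinner y z.
Proof. by rewrite /rinner innerDl raddfD. Qed.
Lemma rinnerBl x y z : rinner (x - y) z = rinner x z - rinner y z.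
Proof. by rewrite /rinner innerBl raddfB. Qed.
Lemma ReZ (t : R) c : Re (t%:C%C * c) = t * Re c.
Proof. by case: c => a b /=; rewrite mul0r subr0. Qed.
Lemma rinnerZl (t : R) x z : rinner (t%:C%C *: x) z = t * rinner x z.
Proof. by rewrite /rinner innerZl ReZ. Qed.
Lemma rinnerDr x y z : rinner x (y + z) = rinner x y + rinner x z.
Proof. by rewrite rinnerC rinnerDl !(rinnerC x). Qed.
Lemma rinnerBr x y z : rinner x (y - z) = rinner x y - rinner x z.
Proof. by rewrite rinnerC rinnerBl !(rinnerC x). Qed.
Lemma rinnerZr (t : R) x z : rinner x (t%:C%C *: z) = t * rinner x z.
Proof. by rewrite rinnerC rinnerZl rinnerC. Qed.
Lemma rinner_hnorm v : rinner v v = hnorm v ^+ 2.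
Proof. by rewrite /rinner inner_hnorm. Qed.

Definition rinnerE :=
  (rinnerBl, rinnerBr, rinnerDl, rinnerDr, rinnerZl, rinnerZr).

Lemma rinner_le u v : rinner u v <= hnorm u * hnorm v.
Proof.
have := hnorm_ge0 u; have := hnorm_ge0 v.
set a := hnorm v; set b := hnorm u => a0 b0.
have h : 0 <= rinner (a%:C%C *: u - b%:C%C *: v) (a%:C%C *: u - b%:C%C *: v).
  by rewrite rinner_hnorm sqr_ge0.
have Ruu : rinner u u = b ^+ 2 by rewrite rinner_hnorm.
have Rvv : rinner v v = a ^+ 2 by rewrite rinner_hnorm.
rewrite !rinnerE Ruu Rvv (rinnerC v u) in h.
have [b_eq0|b_neq0] := eqVneq b 0.
  have -> : u = 0 by apply/eqP; rewrite -normr_eq0 normE -/b b_eq0.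
  by rewrite /rinner linear0l b_eq0 mul0r.
have [a_eq0|a_neq0] := eqVneq a 0.
  have -> : v = 0 by apply/eqP; rewrite -normr_eq0 normE -/a a_eq0.
  by rewrite /rinner linear0 a_eq0 mulr0.
have ab0 : 0 < a * b by rewrite mulr_gt0 // lt_def ?a_neq0 ?b_neq0.
rewrite -(ler_pM2l ab0); nra.
Qed.

Lemma hnormZ (t : R) v : hnorm (t%:C%C *: v) = `|t| * hnorm v.
Proof.
apply/eqP; rewrite -(@eqrXn2 _ 2) //; last 2 first.
- exact: hnorm_ge0.
- by rewrite mulr_ge0 // hnorm_ge0.
by rewrite -rinner_hnorm !rinnerE exprMn real_normK ?num_real // rinner_hnorm expr2 mulrA.
Qed.

Lemma hnormN v : hnorm (- v) = hnorm v.
Proof. by rewrite /hnorm normrN. Qed.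

Lemma rinner_norm_le u v : `|rinner u v| <= hnorm u * hnorm v.
Proof.
rewrite ler_norml rinner_le andbT lerNl.
have := rinner_le (- u) v; rewrite hnormN; apply: le_trans.
by rewrite /rinner linearNl raddfN.
Qed.

Lemma normci : `|'i%C : R[i]| = 1.
Proof. by rewrite normc_def /= expr0n expr1n add0r sqrtr1. Qed.

Lemma normi_hnorm v : hnorm ('i%C *: v) = hnorm v.
Proof.
apply/eqP; rewrite -(@eqrXn2 _ 2) //; try exact: hnorm_ge0.
by rewrite -!rinner_hnorm /rinner innerZl innerZr mulrA -normCK normci expr1n mul1r.
Qed.

Lemma rinneri u v : rinner ('i%C *: u) v = - Im << u, v >>.
Proof. by rewrite /rinner innerZl mulrC ReiNIm. Qed.

Lemma complex_norm_le c : `|c| <= (`|Re c| + `|Im c|)%:C%C.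
Proof.
rewrite {1}[c]complexE (le_trans (ler_normD _ _)) // normrM.
by rewrite normci mul1r raddfD /= !normc_def /= !expr0n /= !addr0 !sqrtr_sqr.
Qed.

Lemma inner_norm_le u v : `|<< u, v >>| <= (2 * (hnorm u * hnorm v))%:C%C.
Proof.
rewrite (le_trans (complex_norm_le _)) // lecR.
have h1 := rinner_norm_le u v.
have h2 := rinner_norm_le ('i%C *: u) v.
by rewrite rinneri normrN normi_hnorm in h2; rewrite /rinner in h1; lra.
Qed.

Section Riesz.
Variables (f : {scalar H}) (K : R).
Hypothesis fK : forall v, `|f v| <= (K * hnorm v)%:C%C.

Let J v : R := hnorm v ^+ 2 - 2 * Re (f v).

Let Jge v : - K ^+ 2 <= J v.
Proof.
have h : Re (f v) <= K * hnorm v.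
  rewrite -lecR (le_trans _ (fK v)) // (le_trans _ (normc_ge_Re _)) //.
  by rewrite lecR ler_norm.
have := sqr_ge0 (hnorm v - K); rewrite /J; nra.
Qed.

Let fZ (t : R) v : Re (f (t%:C%C *: v)) = t * Re (f v).
Proof. by rewrite linearZ_LR /=; exact: ReZ. Qed.

Let Jmid u v : hnorm (u - v) ^+ 2 =
  2 * J u + 2 * J v - 4 * J ((2^-1)%:C%C *: (u + v)).
Proof.
rewrite /J fZ -!rinner_hnorm !rinnerE (rinnerC v u) linearD raddfD /=.
by field.
Qed.

Let Jline u w (t : R) :
  J (u + t%:C%C *: w) = J u + 2 * t * (rinner u w - Re (f w)) + t ^+ 2 * hnorm w ^+ 2.
Proof.
rewrite /J -!rinner_hnorm !rinnerE (rinnerC w u) linearD raddfD /= fZ.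
by ring.
Qed.

Let d := inf (range J).

Let hasinfJ : has_inf (range J).
Proof.
split; first by exists (J 0), 0.
by exists (- K ^+ 2) => _ [v _ <-]; exact: Jge.
Qed.

Let Jd v : d <= J v.
Proof. by apply: ge_inf; [exact: hasinfJ.2 | exists v]. Qed.

Let F : set_system H := [set A | exists2 e : R, 0 < e & forall v, J v < d + e -> A v].

Local Instance F_filter : ProperFilter F.
Proof.
split.
  move=> [e e0 /=] h; have [_ [v _ <-]] := inf_adherent e0 hasinfJ.
  exact: h.
split.
- by exists 1.
- move=> A B [e e0 hA] [e' e'0 hB]; exists (Num.min e e').
    by rewrite lt_min e0.
  move=> v Jv; split; [apply: hA | apply: hB]; apply: lt_le_trans Jv _.
    by rewrite lerD2l ge_min lexx.
  by rewrite lerD2l ge_min lexx orbT.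
- by move=> A B AB [e e0 hA]; exists e => // v /hA /AB.
Qed.

Let F_cauchy : cauchy F.
Proof.
apply/cauchy_ballP => e e0.
have eR : e = (Re e)%:C%C by rewrite RRe_real // gtr0_real.
have e0' : 0 < Re e by rewrite -ltcR -eR.
have d0 : 0 < Re e ^+ 2 / 4 by rewrite divr_gt0 // exprn_gt0.
exists ([set v | J v < d + Re e ^+ 2 / 4], [set v | J v < d + Re e ^+ 2 / 4]).
  by split; exists (Re e ^+ 2 / 4).
move=> [u v] /= [hu hv]; rewrite -ball_normE /= normE eR ltcR.
rewrite -(@ltr_pXn2r _ 2) ?nnegrE ?hnorm_ge0 ?(ltW e0') //.
have := Jd ((2^-1)%:C%C *: (u + v)); rewrite Jmid; lra.
Qed.

Lemma riesz : exists z, forall v, f v = << v, z >>.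
Proof.
have /cvg_ex [z Fz] : cvg F by apply: cauchy_cvg; exact: F_cauchy.
suff hre w : rinner w z = Re (f w).
  exists z => v; apply/eqP; rewrite eq_complex -!/(rinner _ _) hre eqxx /=.
  have := hre ('i%C *: v); rewrite rinneri linearZ /= mulrC ReiNIm.
  by move/oppr_inj => ->.
have key (t e : R) : 0 < e ->
   - e - 2 * `|t| * (e * hnorm w) <=
     2 * t * (rinner z w - Re (f w)) + t ^+ 2 * hnorm w ^+ 2.
  move=> e0.
  have ec0 : 0 < e%:C%C by rewrite ltcR.
  have FA : F [set v | J v < d + e] by exists e.
  have FB : F (ball z e%:C%C) by apply: Fz; exact: nbhsx_ballx.
  have [v [/= hv]] := filter_ex (filterI FA FB).
  rewrite -ball_normE /= normE ltcR => zv.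
  have := Jd (v + t%:C%C *: w); rewrite Jline => hl.
  have -> : rinner z w = rinner v w + rinner (z - v) w by rewrite rinnerBl; ring.
  have h1 := rinner_norm_le (z - v) w.
  have h2 : hnorm (z - v) * hnorm w <= e * hnorm w.
    by rewrite ler_wpM2r ?hnorm_ge0 // ltW.
  have h3 : `|t * rinner (z - v) w| <= `|t| * (e * hnorm w).
    by rewrite normrM ler_wpM2l // (le_trans h1).
  move: h3; rewrite ler_norml => /andP[h3 _].
  by nra.
have key0 (t : R) : 0 <= 2 * t * (rinner z w - Re (f w)) + t ^+ 2 * hnorm w ^+ 2.
  apply/ler_addgt0Pl => e e0.
  set D := 1 + 2 * `|t| * hnorm w.
  have D0 : 0 < D by rewrite ltr_wpDr // mulr_ge0 ?hnorm_ge0 // mulr_ge0.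
  have e'0 : 0 < e / D by rewrite divr_gt0.
  have := key t _ e'0.
  have -> : - (e / D) - 2 * `|t| * (e / D * hnorm w) = - (e / D * D).
    by rewrite /D; ring.
  by rewrite divfK ?gt_eqF //; lra.
rewrite rinnerC; apply/eqP; rewrite -subr_eq0; apply/eqP.
set g := rinner z w - Re (f w).
set q := hnorm w ^+ 2 in key0 *.
have q0 : 0 <= q by exact: sqr_ge0.
have q1 : 0 < q + 1 by lra.
have := key0 (- g / (q + 1)); rewrite -/g.
have -> : 2 * (- g / (q + 1)) * g + (- g / (q + 1)) ^+ 2 * q =
   - (g ^+ 2 * ((q + 2) / (q + 1) ^+ 2)).
  by field; rewrite gt_eqF.
rewrite oppr_ge0 pmulr_lle0; last by rewrite divr_gt0 ?exprn_gt0 //; lra.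
by move=> h; apply/eqP; rewrite -sqrf_eq0 eq_le h sqr_ge0.
Qed.

End Riesz.
End HilbertTheory.

(* Bounded operators are the continuous linear ones; the existence of adjoints
   is proved from completeness (riesz). *)
Record bop (R : realType) (H : hilbertType R) := Bop {
  bop_fun :> {linear H -> H};
  bop_continuous : continuous (bop_fun : H -> H)
}.
Arguments Bop {R H} bop_fun bop_continuous.

Notation "''B' H" := (bop H) (at level 8, H at level 2, format "''B'  H").

HB.instance Definition _ (R : realType) (H : hilbertType R) :=
  gen_eqMixin 'B H.
HB.instance Definition _ (R : realType) (H : hilbertType R) :=
  gen_choiceMixin 'B H.

Section BoundedOperators.
Variables (R : realType) (H : hilbertType R).
Implicit Types (S T U : 'B H) (u v x y : H) (c : R[i]).

Lemma bop_ext S T : (forall v, S v = T v) -> S = T.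
Proof.
case: S T => [S cS] [T cT] /= ST.
have E : S = T.
  case: S T ST {cS cT} => [f [[[f0 fD]] [fZ]]] [g [[[g0 gD]] [gZ]]] /= /funext fg.
  case: _ / fg in g0 gD gZ *.
  by rewrite (Prop_irrelevance f0 g0) (Prop_irrelevance fD gD) (Prop_irrelevance fZ gZ).
by case: _ / E cT => cT; congr Bop; exact: Prop_irrelevance.
Qed.

Lemma bop_bounded T : exists2 K : R, 0 <= K & forall v, hnorm (T v) <= K * hnorm v.
Proof.
have /linear_bounded_continuous/linear_boundedP/pinfty_ex_gt0 [K K0 hK] :=
  @bop_continuous _ _ T.
have KR : K = (complex.Re K)%:C%C by rewrite RRe_real // gtr0_real.
exists (complex.Re K); first by rewrite -lecR -KR ltW.
by move=> v; rewrite -lecR rmorphM /= -KR -!normE.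
Qed.

Lemma bounded_continuous (f : {linear H -> H}) (K : R) :
  (forall v, hnorm (f v) <= K * hnorm v) -> continuous f.
Proof.
move=> fK; apply: bounded_linear_continuous; apply/linear_boundedP.
exists K%:C%C; split; first by apply/complex_realP; exists K.
move=> r Kr v; rewrite (le_trans (y := K%:C%C * `|v|)) //.
  by rewrite !normE -rmorphM lecR.
by rewrite ler_wpM2r // ltW.
Qed.

Section Operations.
Variables (S T : 'B H) (c : R[i]).

Let add_cont : continuous (S \+ T : H -> H).
Proof. by move=> x; apply: cvgD; exact: bop_continuous. Qed.
Definition bop_add : 'B H := Bop (S \+ T) add_cont.

Let opp_cont : continuous (\- S : H -> H).
Proof. by move=> x; apply: cvgN; exact: bop_continuous. Qed.
Definition bop_opp : 'B H := Bop (\- S) opp_cont.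

Let scale_cont : continuous (c \*: S : H -> H).
Proof. by move=> x; apply: cvgZr; exact: bop_continuous. Qed.
Definition bop_scale : 'B H := Bop (c \*: S) scale_cont.

Let mul_cont : continuous (S \o T : H -> H).
Proof. by move=> x; apply: continuous_comp; exact: bop_continuous. Qed.
Definition bop_mul : 'B H := Bop (S \o T) mul_cont.

End Operations.

Let zero_cont : continuous (\0 : H -> H).
Proof. exact: cst_continuous. Qed.
Definition bop_zero : 'B H := Bop (\0 : {linear H -> H}) zero_cont.

Let one_cont : continuous (idfun : H -> H).
Proof. by move=> x; exact: cvg_id. Qed.
Definition bop_one : 'B H := Bop (idfun : {linear H -> H}) one_cont.

Fact bop_addA : associative bop_add.
Proof. by move=> *; apply: bop_ext => v /=; rewrite addrA. Qed.
Fact bop_addC : commutative bop_add.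
Proof. by move=> *; apply: bop_ext => v /=; rewrite addrC. Qed.
Fact bop_add0 : left_id bop_zero bop_add.
Proof. by move=> *; apply: bop_ext => v /=; rewrite add0r. Qed.
Fact bop_addN : left_inverse bop_zero bop_opp bop_add.
Proof. by move=> *; apply: bop_ext => v /=; rewrite addNr. Qed.

HB.instance Definition _ :=
  GRing.isZmodule.Build 'B H bop_addA bop_addC bop_add0 bop_addN.

Fact bop_mulA : associative bop_mul.
Proof. by move=> *; apply: bop_ext. Qed.
Fact bop_mul1 : left_id bop_one bop_mul.
Proof. by move=> *; apply: bop_ext. Qed.
Fact bop_mulr1 : right_id bop_one bop_mul.
Proof. by move=> *; apply: bop_ext. Qed.
Fact bop_mulDl : left_distributive bop_mul (fun S T => S + T).
Proof. by move=> *; apply: bop_ext. Qed.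
Fact bop_mulDr : right_distributive bop_mul (fun S T => S + T).
Proof. by move=> *; apply: bop_ext => v /=; rewrite linearD. Qed.
Fact bop_one_neq0 : bop_one != 0.
Proof.
have [x /eqP x0] := @hilbert_neq0 _ H; apply/eqP => E; apply: x0.
by have := congr1 (fun T : 'B H => T x) E.
Qed.

HB.instance Definition _ := GRing.Zmodule_isNzRing.Build 'B H
  bop_mulA bop_mul1 bop_mulr1 bop_mulDl bop_mulDr bop_one_neq0.

Fact bop_scaleA c d T : bop_scale (bop_scale T d) c = bop_scale T (c * d).
Proof. by apply: bop_ext => v /=; rewrite scalerA. Qed.
Fact bop_scale1 : left_id 1 (fun c T => bop_scale T c).
Proof. by move=> T; apply: bop_ext => v /=; rewrite scale1r. Qed.
Fact bop_scaleDr : right_distributive (fun c T => bop_scale T c) +%R.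
Proof. by move=> c S T; apply: bop_ext => v /=; rewrite scalerDr. Qed.
Fact bop_scaleDl T : {morph (bop_scale T) : a b / a + b}.
Proof. by move=> a b; apply: bop_ext => v /=; rewrite scalerDl. Qed.

HB.instance Definition _ := GRing.Zmodule_isLmodule.Build R[i] 'B H
  bop_scaleA bop_scale1 bop_scaleDr bop_scaleDl.

Fact bop_scaleAl c S T : c *: (S * T) = (c *: S) * T.
Proof. exact: bop_ext. Qed.
HB.instance Definition _ := GRing.Lmodule_isLalgebra.Build R[i] 'B H bop_scaleAl.
Fact bop_scaleAr c S T : c *: (S * T) = S * (c *: T).
Proof. by apply: bop_ext => v /=; rewrite linearZ. Qed.
HB.instance Definition _ := GRing.Lalgebra_isAlgebra.Build R[i] 'B H bop_scaleAr.

Lemma inner_inj x y : (forall v, inner v x = inner v y) -> x = y.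
Proof.
move=> xy; apply/eqP; rewrite -subr_eq0 -normr_eq0 -sqrf_eq0 -innerE.
by rewrite innerBr xy subrr.
Qed.

Lemma adjoint_exists T :
  exists S : 'B H, forall x y, inner (T x) y = inner x (S y).
Proof.
have [K K0 TK] := bop_bounded T.
have exz y : exists z, forall v, inner (T v) y = inner v z.
  have fL : linear_for *%R (fun v => inner (T v) y).
    by move=> c u v; rewrite linearP innerDl innerZl.
  pose f : {scalar H} := HB.pack (fun v => inner (T v) y)
    (GRing.isLinear.Build R[i] H R[i] *%R _ fL).
  apply: (@riesz R H f (2 * K * hnorm y)) => v.
  rewrite (le_trans (inner_norm_le _ _)) // lecR.
  by have := ler_wpM2r (hnorm_ge0 y) (TK v); nra.
pose S y := projT1 (cid (exz y)).
have SE x y : inner (T x) y = inner x (S y) by rewrite /S; case: cid.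
have SL : linear S.
  by move=> c u v; apply: inner_inj => w;
     rewrite innerDr innerZr -!SE innerDr innerZr.
pose S' : {linear H -> H} := HB.pack S (GRing.isLinear.Build R[i] H H *:%R S SL).
have S'K v : hnorm (S' v) <= K * hnorm v.
  have [->|n0] := eqVneq (hnorm (S' v)) 0; first by rewrite mulr_ge0 ?hnorm_ge0.
  have n0' : 0 < hnorm (S' v) by rewrite lt_def n0 hnorm_ge0.
  rewrite -(ler_pM2l n0') -expr2 -rinner_hnorm /rinner -SE.
  rewrite (le_trans (rinner_le _ _)) // mulrCA mulrA ler_wpM2r ?hnorm_ge0 //.
by exists (Bop S' (bounded_continuous S'K)).
Qed.

Definition adjoint T : 'B H := projT1 (cid (adjoint_exists T)).

Lemma adjointE T x y : inner (T x) y = inner x (adjoint T y).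
Proof. by rewrite /adjoint; case: cid. Qed.

Lemma adjointP S T :
  (forall x y, inner (T x) y = inner x (S y)) -> adjoint T = S.
Proof.
by move=> TS; apply: bop_ext => y; apply: inner_inj => x; rewrite -adjointE.
Qed.

Fact adjointK : involutive adjoint.
Proof.
move=> T; apply: adjointP => x y.
by rewrite innerC -adjointE -innerC.
Qed.
Fact adjointD : {morph adjoint : S T / S + T}.
Proof.
move=> S T; apply: adjointP => x y.
by rewrite innerDl innerDr -!adjointE.
Qed.
Fact adjointZ c T : adjoint (c *: T) = c^* *: adjoint T.
Proof.
by apply: adjointP => x y; rewrite innerZl innerZr conjCK -adjointE.
Qed.
Fact adjointM S T : adjoint (S * T) = adjoint T * adjoint S.
Proof. by apply: adjointP => x y; rewrite /= !adjointE. Qed.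

HB.instance Definition _ := isStarAlgebra.Build R 'B H
  adjointK adjointD adjointZ adjointM.

Definition opnorm T : R := sup [set hnorm (T v) | v in [set v | hnorm v <= 1]].

End BoundedOperators.

Section TensorProduct.
Variables (K : fieldType) (U V : lmodType K).

Definition formal_sum := seq (U * V).
HB.instance Definition _ := Choice.on formal_sum.

Implicit Types (s t : formal_sum) (u : U) (v : V) (c : K).

Definition bilin (W : lmodType K) (f : U -> V -> W) : Prop :=
  bilinear_for (@GRing.scale K W) (@GRing.scale K W) f.

(* The quotient below is the algebraic tensor product: two formal sums of
   elementary tensors are equal iff no bilinear map distinguishes them. *)
Definition tensor_eqv : rel formal_sum := fun s t =>
  `[< forall (W : lmodType K) (f : U -> V -> W), bilin f ->
      \sum_(p <- s) f p.1 p.2 = \sum_(p <- t) f p.1 p.2 >].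

Fact tensor_eqv_refl : reflexive tensor_eqv.
Proof. by move=> s; apply/asboolP. Qed.
Fact tensor_eqv_sym : symmetric tensor_eqv.
Proof. by move=> s t; apply/asboolP/asboolP => st W f /st. Qed.
Fact tensor_eqv_trans : transitive tensor_eqv.
Proof.
by move=> s t r /asboolP ts /asboolP sr; apply/asboolP => W f bf; rewrite ts ?sr.
Qed.

Canonical tensor_equiv :=
  EquivRel tensor_eqv tensor_eqv_refl tensor_eqv_sym tensor_eqv_trans.

Definition tensor := {eq_quot tensor_equiv}%qT.
HB.instance Definition _ := Choice.on tensor.

Definition tensor_of s : tensor := (\pi_tensor s)%qT.
Definition tens u v : tensor := tensor_of [:: (u, v)].
Definition tensor_lift (W : lmodType K) (f : U -> V -> W) (x : tensor) : W :=
  \sum_(p <- repr x) f p.1 p.2.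

Lemma tensor_ofK (x : tensor) : tensor_of (repr x) = x.
Proof. exact: reprK. Qed.

Lemma tensor_of_eq s t : (forall (W : lmodType K) (f : U -> V -> W), bilin f ->
   \sum_(p <- s) f p.1 p.2 = \sum_(p <- t) f p.1 p.2) -> tensor_of s = tensor_of t.
Proof. by move=> st; apply/eqmodP/asboolP. Qed.

Lemma tensor_lift_of (W : lmodType K) (f : U -> V -> W) s : bilin f ->
  tensor_lift f (tensor_of s) = \sum_(p <- s) f p.1 p.2.
Proof.
move=> bf; have /eqmodP/asboolP : (tensor_of (repr (tensor_of s)) = tensor_of s :> tensor)%qT.
  exact: tensor_ofK.
exact.
Qed.

Definition tensor_add (x y : tensor) := tensor_of (repr x ++ repr y).
Definition tensor_scale c (x : tensor) :=
  tensor_of [seq (c *: p.1, p.2) | p <- repr x].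

Lemma tensor_ext (x y : tensor) : (forall (W : lmodType K) (f : U -> V -> W),
  bilin f -> tensor_lift f x = tensor_lift f y) -> x = y.
Proof. by move=> xy; rewrite -[x]tensor_ofK -[y]tensor_ofK; exact: tensor_of_eq. Qed.

Section Bilin.
Variables (W : lmodType K) (f : U -> V -> W).
Hypothesis bf : bilin f.

Lemma bilinDl u u' v : f (u + u') v = f u v + f u' v.
Proof. by have := bf.1 v 1 u u'; rewrite /= !scale1r. Qed.
Lemma bilinDr u v v' : f u (v + v') = f u v + f u v'.
Proof. by have := bf.2 u 1 v v'; rewrite /= !scale1r. Qed.
Lemma bilin0l v : f 0 v = 0.
Proof. by apply: (addrI (f 0 v)); rewrite -bilinDl !addr0. Qed.
Lemma bilin0r u : f u 0 = 0.
Proof. by apply: (addrI (f u 0)); rewrite -bilinDr !addr0. Qed.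
Lemma bilinZl c u v : f (c *: u) v = c *: f u v.
Proof. by have := bf.1 v c u 0; rewrite /= !addr0 bilin0l addr0. Qed.
Lemma bilinZr c u v : f u (c *: v) = c *: f u v.
Proof. by have := bf.2 u c v 0; rewrite /= !addr0 bilin0r addr0. Qed.

Lemma tensor_lift_add x y :
  tensor_lift f (tensor_add x y) = tensor_lift f x + tensor_lift f y.
Proof. by rewrite tensor_lift_of // big_cat. Qed.

Lemma tensor_lift_scale c x :
  tensor_lift f (tensor_scale c x) = c *: tensor_lift f x.
Proof.
rewrite tensor_lift_of // big_map scaler_sumr; apply: eq_bigr => p _ /=.
exact: bilinZl.
Qed.

Lemma tensor_lift_zero : tensor_lift f (tensor_of [::]) = 0.
Proof. by rewrite tensor_lift_of // big_nil. Qed.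

Lemma tensor_lift_tens u v : tensor_lift f (tens u v) = f u v.
Proof. by rewrite tensor_lift_of // big_seq1. Qed.

End Bilin.

Definition tensor_liftE := (tensor_lift_add, tensor_lift_scale, tensor_lift_zero).

Fact tensor_addA : associative tensor_add.
Proof. by move=> x y z; apply: tensor_ext => W f bf; rewrite !tensor_liftE // addrA. Qed.
Fact tensor_addC : commutative tensor_add.
Proof. by move=> x y; apply: tensor_ext => W f bf; rewrite !tensor_liftE // addrC. Qed.
Fact tensor_add0 : left_id (tensor_of [::]) tensor_add.
Proof. by move=> x; apply: tensor_ext => W f bf; rewrite !tensor_liftE // add0r. Qed.
Fact tensor_addN : left_inverse (tensor_of [::]) (tensor_scale (- 1)) tensor_add.
Proof.
by move=> x; apply: tensor_ext => W f bf; rewrite !tensor_liftE // scaleN1r addNr.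
Qed.

HB.instance Definition _ :=
  GRing.isZmodule.Build tensor tensor_addA tensor_addC tensor_add0 tensor_addN.

Fact tensor_scaleA c d x : tensor_scale c (tensor_scale d x) = tensor_scale (c * d) x.
Proof. by apply: tensor_ext => W f bf; rewrite !tensor_liftE // scalerA. Qed.
Fact tensor_scale1 : left_id 1 tensor_scale.
Proof. by move=> x; apply: tensor_ext => W f bf; rewrite !tensor_liftE // scale1r. Qed.
Fact tensor_scaleDr : right_distributive tensor_scale +%R.
Proof. by move=> c x y; apply: tensor_ext => W f bf; rewrite !tensor_liftE // scalerDr. Qed.
Fact tensor_scaleDl x : {morph tensor_scale^~ x : a b / a + b}.
Proof. by move=> a b; apply: tensor_ext => W f bf; rewrite !tensor_liftE // scalerDl. Qed.

HB.instance Definition _ := GRing.Zmodule_isLmodule.Build K tensor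
  tensor_scaleA tensor_scale1 tensor_scaleDr tensor_scaleDl.

Lemma tensor_lift_linear (W : lmodType K) (f : U -> V -> W) :
  bilin f -> linear (tensor_lift f).
Proof. by move=> bf c x y; rewrite tensor_lift_add // tensor_lift_scale. Qed.

Lemma tens_bilin : bilin tens.
Proof.
split=> [v c u u'|u c v v'] /=; apply: tensor_ext => W f bf;
  rewrite tensor_lift_linear // !tensor_lift_tens //.
- by rewrite bilinDl // bilinZl.
- by rewrite bilinDr // bilinZr.
Qed.

Lemma tensor_sum (x : tensor) : x = \sum_(p <- repr x) tens p.1 p.2.
Proof.
rewrite -[LHS]tensor_ofK; elim: (repr x) => [|p s IHs]; first by rewrite big_nil.
rewrite big_cons -IHs; apply: tensor_ext => W f bf.
by rewrite tensor_lift_add // !tensor_lift_of // big_cons big_seq1.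
Qed.

Lemma tensor_ind (P : tensor -> Prop) :
  (forall u v, P (tens u v)) -> (forall x y, P x -> P y -> P (x + y)) ->
  forall x, P x.
Proof.
move=> Pt PD x; rewrite [x]tensor_sum.
elim: (repr x) => [|p s IHs]; last by rewrite big_cons; exact: PD.
by rewrite big_nil -(bilin0l tens_bilin 0).
Qed.

End TensorProduct.

Arguments tens {K U V} u v.

Section DualSeparation.
Variables (K : fieldType) (V : lmodType K) (v : V).
Hypothesis v0 : v != 0.

Let P (W : set V) := (forall c x y, W x -> W y -> W (c *: x + y)) /\ ~ W v.

Lemma dual_separation : exists f : {scalar V}, f v = 1.
Proof.
have [|A [[Alin Av] Amax]] := @Zorn_bigcup V P.
  move=> F FP Ftot; split; last by move=> [W /FP[]].
  move=> c x y [X FX Xx] [Y FY Yy]; have [XY|YX] := Ftot _ _ FX FY.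
    by exists Y => //; apply: (FP _ FY).1 => //; exact: XY.
  by exists X => //; apply: (FP _ FX).1 => //; exact: YX.
have A0 : A 0.
  apply: contrapT => nA0.
  have E : A = set0.
    rewrite -subset0 => x Ax; apply: nA0; have := Alin (- 1) x x Ax Ax.
    by rewrite scaleN1r addNr.
  apply: (Amax [set 0]).
    by rewrite E; split=> // /(_ 0 erefl).
  split; last by move=> /eqP; rewrite (negbTE v0).
  by move=> c x y -> ->; rewrite scaler0 addr0.
have AZ c x : A x -> A (c *: x) by move=> Ax; have := Alin c x 0 Ax A0; rewrite addr0.
have ex x : exists c, A (x - c *: v).
  have [Ax|nAx] := pselect (A x); first by exists 0; rewrite scale0r subr0.
  pose B := [set a + k *: x | a in A & k in setT].
  have AB : A `<` B.
    split=> [a Aa|BA]; first by exists a => //; exists 0 => //; rewrite scale0r addr0.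
    by apply: nAx; apply: BA; exists 0 => //; exists 1 => //; rewrite scale1r add0r.
  have nPB := Amax _ AB.
  have Bv : B v.
    apply: contrapT => nBv; apply: nPB; split=> //.
    move=> c _ _ [a Aa [k _ <-]] [b Ab [l _ <-]].
    exists (c *: a + b); first exact: Alin.
    by exists (c * k + l) => //; rewrite scalerDr scalerDl scalerA addrACA.
  case: Bv => a Aa [k _ akx].
  have k0 : k != 0.
    by apply/eqP => k0; apply: Av; rewrite -akx k0 scale0r addr0.
  exists k^-1.
  rewrite -akx scalerDr scalerA mulVf // scale1r opprD addrCA subrr addr0 -scalerN.
  by rewrite -[- a]scaleN1r; exact: (AZ _ _ (AZ _ _ Aa)).
have uniq x c d : A (x - c *: v) -> A (x - d *: v) -> c = d.
  move=> Ac Ad; apply/eqP; rewrite -subr_eq0; apply/negPn/negP => cd.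
  apply: Av; have := Alin (- 1) _ _ Ac Ad.
  rewrite scaleN1r opprB addrA subrK -scalerBl => /(AZ (c - d)^-1).
  by rewrite scalerA mulVf // scale1r.
pose f x := projT1 (cid (ex x)).
have fP x : A (x - f x *: v) by rewrite /f; case: cid.
have fL : linear_for *%R f.
  move=> c x y; apply: uniq (fP _) _.
  rewrite scalerDl -scalerA opprD addrACA -scalerBr.
  exact: Alin.
exists (HB.pack f (GRing.isLinear.Build K V K *%R f fL) : {scalar V}).
by apply: uniq (fP _) _; rewrite scale1r subrr.
Qed.

End DualSeparation.

Section Homogeneous.
Variables (R : realType) (D : gradedStarAlgType R).
Implicit Types (a b : D) (c : R[i]) (i j : bool).

(* i = false for the even part and i = true for the odd part *)
Definition hpart i a : D := 2^-1 *: (a + (-1) ^+ i *: grading a).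
Definition homogeneous i a : Prop := grading a = (-1) ^+ i *: a.

Lemma gradingD a b : grading (a + b) = grading a + grading b.
Proof. by have := gradingL 1 a b; rewrite !scale1r. Qed.
Lemma grading0 : grading (0 : D) = 0.
Proof. by apply: (addrI (grading 0)); rewrite -gradingD !addr0. Qed.
Lemma gradingZ c a : grading (c *: a) = c *: grading a.
Proof. by have := gradingL c a 0; rewrite grading0 !addr0. Qed.

Lemma star0 : star (0 : D) = 0.
Proof. by apply: (addrI (star 0)); rewrite -starD !addr0. Qed.
Lemma star1 : star (1 : D) = 1.
Proof. by rewrite -[LHS]mulr1 -[X in _ * X]starK -starM mulr1 starK. Qed.


Lemma hpartD i a b : hpart i (a + b) = hpart i a + hpart i b.
Proof.
by rewrite /hpart gradingD -scalerDr; congr (_ *: _); rewrite scalerDr addrACA.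
Qed.
Lemma hpartZ i c a : hpart i (c *: a) = c *: hpart i a.
Proof. by rewrite /hpart gradingZ !scalerDr !scalerA; congr (_ + _); congr (_ *: _); ring. Qed.

Lemma half2 a : 2^-1 *: (a + a) = a.
Proof. by rewrite -[a + a]mulr2n -(scaler_nat 2 a) scalerA mulVf ?scale1r // pnatr_eq0. Qed.

Lemma hpart_sum a : a = hpart false a + hpart true a.
Proof.
rewrite /hpart expr0 expr1 scale1r scaleN1r -scalerDr addrACA subrr addr0.
by rewrite half2.
Qed.

Lemma hpart_homogeneous i a : homogeneous i (hpart i a).
Proof.
rewrite /homogeneous /hpart gradingZ gradingD gradingZ gradingK.
rewrite [RHS]scalerA mulrC -scalerA; congr (_ *: _).
by rewrite scalerDr scalerA -expr2 sqrr_sign scale1r addrC.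
Qed.

Lemma homogeneous_hpart i j a :
  homogeneous i a -> hpart j a = if i == j then a else 0.
Proof.
rewrite /homogeneous /hpart => ->; rewrite scalerA.
by case: i; case: j; rewrite /= ?expr0 ?expr1 ?mulr1 ?mul1r ?mulrNN ?mulr1 ?scale1r ?scaleN1r ?half2 ?subrr ?scaler0.
Qed.

Lemma homogeneousM i j a b : homogeneous i a -> homogeneous j b ->
  homogeneous (i (+) j) (a * b).
Proof.
rewrite /homogeneous => ha hb; rewrite gradingM.2 ha hb signr_addb.
by rewrite -scalerAl -scalerAr scalerA.
Qed.

Lemma homogeneous_star i a : homogeneous i a -> homogeneous i (star a).
Proof.
by rewrite /homogeneous gradingS => ->; rewrite starZ rmorph_sign.
Qed.

Lemma homogeneous1 : homogeneous false (1 : D).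
Proof. by rewrite /homogeneous gradingM.1 expr0 scale1r. Qed.

End Homogeneous.

(* V with the conjugate scalar action: antilinear maps into V are the linear
   maps into conj_module V. *)
Definition conj_module (R : realType) (V : lmodType R[i]) : Type := V.

Section ConjugateModule.
Variables (R : realType) (V : lmodType R[i]).

HB.instance Definition _ := GRing.Zmodule.on (conj_module V).

Definition conj_scale (c : R[i]) (v : conj_module V) : conj_module V :=
  c^* *: (v : V).

Fact conj_scaleA c d v : conj_scale c (conj_scale d v) = conj_scale (c * d) v.
Proof. by rewrite /conj_scale scalerA rmorphM. Qed.
Fact conj_scale1 : left_id 1 conj_scale.
Proof. by move=> v; rewrite /conj_scale rmorph1 scale1r. Qed.
Fact conj_scaleDr : right_distributive conj_scale +%R.
Proof. by move=> c u v; rewrite /conj_scale scalerDr. Qed.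
Fact conj_scaleDl v : {morph conj_scale^~ v : a b / a + b}.
Proof. by move=> a b; rewrite /conj_scale rmorphD scalerDl. Qed.

HB.instance Definition _ := GRing.Zmodule_isLmodule.Build R[i] (conj_module V)
  conj_scaleA conj_scale1 conj_scaleDr conj_scaleDl.

End ConjugateModule.

Definition fermi_tensor (R : realType) (D1 D2 : gradedStarAlgType R) : Type :=
  tensor D1 D2.

Section FermiTensor.
Variables (R : realType) (D1 D2 : gradedStarAlgType R).
Local Notation T := (fermi_tensor D1 D2).
Implicit Types (x y z : T).

HB.instance Definition _ := GRing.Lmodule.on T.

(* The sign rules for homogeneous elements, extended by decomposing elements
   into even and odd parts; see tensM_homogeneous and star_tens_homogeneous. *)
Definition fermi_mul_tens (a1 : D1) (a2 : D2) (b1 : D1) (b2 : D2) : T :=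
  \sum_(i : bool) \sum_(j : bool)
    (-1) ^+ (i && j) *: tens (a1 * hpart j b1) (hpart i a2 * b2).
Definition fermi_mul x y : T :=
  tensor_lift (fun a1 a2 => tensor_lift (fermi_mul_tens a1 a2) y) x.

Definition fermi_star_tens (a1 : D1) (a2 : D2) : T :=
  \sum_(i : bool) \sum_(j : bool)
    (-1) ^+ (i && j) *: tens (star (hpart i a1)) (star (hpart j a2)).
Definition fermi_star x : T := tensor_lift fermi_star_tens x.

Let tb := tens_bilin D1 D2.

Lemma scale_sumP (I : finType) (V : lmodType R[i]) c (F G : I -> V) :
  c *: (\sum_i F i) + \sum_i G i = \sum_i (c *: F i + G i).
Proof. by rewrite scaler_sumr big_split. Qed.

Lemma fermi_mul_tens_bilin_r a1 a2 : bilin (fermi_mul_tens a1 a2).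
Proof.
split=> [b2 c b1 b1'|b1 c b2 b2'] /=; rewrite /fermi_mul_tens scale_sumP;
  apply: eq_bigr => i _; rewrite scale_sumP; apply: eq_bigr => j _;
  rewrite scalerA mulrC -scalerA -scalerDr; congr (_ *: _).
- by rewrite hpartD hpartZ mulrDr -(scalerAr c) (bilinDl tb) (bilinZl tb).
- by rewrite mulrDr -(scalerAr c) (bilinDr tb) (bilinZr tb).
Qed.

Lemma fermi_mul_tens_bilin_l b1 b2 :
  bilin (fun a1 a2 => fermi_mul_tens a1 a2 b1 b2).
Proof.
split=> [a2 c a1 a1'|a1 c a2 a2'] /=; rewrite /fermi_mul_tens scale_sumP;
  apply: eq_bigr => i _; rewrite scale_sumP; apply: eq_bigr => j _;
  rewrite scalerA mulrC -scalerA -scalerDr; congr (_ *: _).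
- by rewrite mulrDl -(scalerAl c) (bilinDl tb) (bilinZl tb).
- by rewrite hpartD hpartZ mulrDl -(scalerAl c) (bilinDr tb) (bilinZr tb).
Qed.

Lemma fermi_mul_bilin y :
  bilin (fun a1 a2 => tensor_lift (fermi_mul_tens a1 a2) y).
Proof.
split=> [a2 c a1 a1'|a1 c a2 a2'] /=; rewrite /tensor_lift scaler_sumr -big_split;
  apply: eq_bigr => p _ /=.
- exact: (fermi_mul_tens_bilin_l p.1 p.2).1.
- exact: (fermi_mul_tens_bilin_l p.1 p.2).2.
Qed.

Lemma fermi_mulPl c x y z :
  fermi_mul (c *: x + y) z = c *: fermi_mul x z + fermi_mul y z.
Proof. exact: (tensor_lift_linear (fermi_mul_bilin z)). Qed.

Lemma fermi_mulPr c x y z :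
  fermi_mul z (c *: x + y) = c *: fermi_mul z x + fermi_mul z y.
Proof.
rewrite /fermi_mul {1 3 5}/tensor_lift scaler_sumr -big_split /=.
apply: eq_bigr => p _; exact: (tensor_lift_linear (fermi_mul_tens_bilin_r _ _)).
Qed.

Lemma fermi_star_tens_bilin :
  bilin (fermi_star_tens : D1 -> D2 -> conj_module T).
Proof.
split=> [a2 c a1 a1'|a1 c a2 a2'].
- change (fermi_star_tens (c *: a1 + a1') a2 =
    c^* *: fermi_star_tens a1 a2 + fermi_star_tens a1' a2).
  rewrite /fermi_star_tens scale_sumP; apply: eq_bigr => i _.
  rewrite scale_sumP; apply: eq_bigr => j _.
  rewrite hpartD hpartZ starD (starZ c) (bilinDl tb) (bilinZl tb) scalerDr.
  by rewrite !scalerA mulrC.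
- change (fermi_star_tens a1 (c *: a2 + a2') =
    c^* *: fermi_star_tens a1 a2 + fermi_star_tens a1 a2').
  rewrite /fermi_star_tens scale_sumP; apply: eq_bigr => i _.
  rewrite scale_sumP; apply: eq_bigr => j _.
  rewrite hpartD hpartZ starD (starZ c) (bilinDr tb) (bilinZr tb) scalerDr.
  by rewrite !scalerA mulrC.
Qed.

Fact fermi_starZD c x y :
  fermi_star (c *: x + y) = c^* *: fermi_star x + fermi_star y.
Proof. exact: (tensor_lift_linear fermi_star_tens_bilin c x y). Qed.

Lemma fermi_star_of_tens a1 a2 : fermi_star (tens a1 a2) = fermi_star_tens a1 a2.
Proof. exact: (tensor_lift_tens fermi_star_tens_bilin a1 a2). Qed.

Fact fermi_starD : {morph fermi_star : x y / x + y}.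
Proof. by move=> x y; rewrite -[x]scale1r fermi_starZD rmorph1 !scale1r. Qed.
Fact fermi_star0 : fermi_star 0 = 0.
Proof. by apply: (addrI (fermi_star 0)); rewrite -fermi_starD !addr0. Qed.
Fact fermi_starZ c x : fermi_star (c *: x) = c^* *: fermi_star x.
Proof. by rewrite -[c *: x]addr0 fermi_starZD fermi_star0 addr0. Qed.

Fact fermi_mulDl : left_distributive fermi_mul +%R.
Proof. by move=> x y z; rewrite -[x]scale1r fermi_mulPl !scale1r. Qed.
Fact fermi_mulDr : right_distributive fermi_mul +%R.
Proof. by move=> z x y; rewrite -[x]scale1r fermi_mulPr !scale1r. Qed.
Fact fermi_mul0l z : fermi_mul 0 z = 0.
Proof. by apply: (addrI (fermi_mul 0 z)); rewrite -fermi_mulDl !addr0. Qed.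
Fact fermi_mul0r z : fermi_mul z 0 = 0.
Proof. by apply: (addrI (fermi_mul z 0)); rewrite -fermi_mulDr !addr0. Qed.
Fact fermi_mulZl c x z : fermi_mul (c *: x) z = c *: fermi_mul x z.
Proof. by rewrite -[c *: x]addr0 fermi_mulPl fermi_mul0l addr0. Qed.
Fact fermi_mulZr c x z : fermi_mul z (c *: x) = c *: fermi_mul z x.
Proof. by rewrite -[c *: x]addr0 fermi_mulPr fermi_mul0r addr0. Qed.

Lemma fermi_mul_homogeneous i j a1 a2 b1 b2 :
  homogeneous i a2 -> homogeneous j b1 ->
  fermi_mul (tens a1 a2) (tens b1 b2) =
  (-1) ^+ (i && j) *: tens (a1 * b1) (a2 * b2).
Proof.
move=> h2 h1; rewrite /fermi_mul tensor_lift_tens; last exact: fermi_mul_bilin.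
rewrite tensor_lift_tens; last exact: fermi_mul_tens_bilin_r.
rewrite /fermi_mul_tens !big_bool !(homogeneous_hpart _ h2) !(homogeneous_hpart _ h1).
by case: i j {h1 h2} => [] [] /=;
  rewrite ?mul0r ?mulr0 ?(bilin0l tb) ?(bilin0r tb) ?scaler0 ?addr0 ?add0r.
Qed.

Lemma fermi_star_homogeneous i j a1 a2 :
  homogeneous i a1 -> homogeneous j a2 ->
  fermi_star (tens a1 a2) = (-1) ^+ (i && j) *: tens (star a1) (star a2).
Proof.
move=> h1 h2; rewrite fermi_star_of_tens.
rewrite /fermi_star_tens !big_bool !(homogeneous_hpart _ h1) !(homogeneous_hpart _ h2).
by case: i j {h1 h2} => [] [] /=;
  rewrite ?star0 ?(bilin0l tb) ?(bilin0r tb) ?scaler0 ?addr0 ?add0r.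
Qed.

Lemma fermi_ind (P : T -> Prop) :
  (forall i j a1 a2, homogeneous i a1 -> homogeneous j a2 -> P (tens a1 a2)) ->
  (forall x y, P x -> P y -> P (x + y)) -> forall x, P x.
Proof.
move=> Pt PD; apply: tensor_ind => // a1 a2.
rewrite (hpart_sum a1) (hpart_sum a2) (bilinDl tb) !(bilinDr tb).
by apply: (PD); apply: (PD); apply: Pt; apply: hpart_homogeneous.
Qed.

Fact fermi_mulA : associative fermi_mul.
Proof.
move=> x y z; elim/fermi_ind: x => [i1 i2 a1 a2 ha1 ha2|x x' Hx Hx']; last first.
  by rewrite !fermi_mulDl Hx Hx'.
elim/fermi_ind: y => [j1 j2 b1 b2 hb1 hb2|y y' Hy Hy']; last first.
  by rewrite !(fermi_mulDl, fermi_mulDr) Hy Hy'.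
elim/fermi_ind: z => [k1 k2 c1 c2 hc1 hc2|z z' Hz Hz']; last first.
  by rewrite !fermi_mulDr Hz Hz'.
rewrite (fermi_mul_homogeneous _ _ hb2 hc1) (fermi_mul_homogeneous _ _ ha2 hb1).
rewrite fermi_mulZr fermi_mulZl.
rewrite (fermi_mul_homogeneous _ _ ha2 (homogeneousM hb1 hc1)).
rewrite (fermi_mul_homogeneous _ _ (homogeneousM ha2 hb2) hc1).
rewrite !scalerA !mulrA -!signr_addb; congr (_ ^+ _ *: _).
by case: i2 j1 j2 k1 {ha2 hb1 hb2 hc1} => [] [] [] [].
Qed.

Fact fermi_mul1 : left_id (tens 1 1) fermi_mul.
Proof.
move=> x; elim/fermi_ind: x => [i j a1 a2 h1 h2|x y Hx Hy]; last first.
  by rewrite fermi_mulDr Hx Hy.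
rewrite (fermi_mul_homogeneous _ _ (homogeneous1 D2) h1) /= expr0 scale1r.
by rewrite !mul1r.
Qed.

Fact fermi_mulr1 : right_id (tens 1 1) fermi_mul.
Proof.
move=> x; elim/fermi_ind: x => [i j a1 a2 h1 h2|x y Hx Hy]; last first.
  by rewrite fermi_mulDl Hx Hy.
rewrite (fermi_mul_homogeneous _ _ h2 (homogeneous1 D1)) andbF expr0 scale1r.
by rewrite !mulr1.
Qed.

Fact fermi_1neq0 : tens 1 1 != 0 :> T.
Proof.
have [f f1] := dual_separation (oner_neq0 D1).
have [g g1] := dual_separation (oner_neq0 D2).
have bfg : bilin (fun a b => f a * g b : R[i]^o).
  split=> [b c a a'|a c b b'] /=; rewrite linearP /=.
  - by rewrite mulrDl -mulrA.
  - by rewrite mulrDr mulrCA.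
apply/eqP => /(congr1 (tensor_lift (fun a b => f a * g b : R[i]^o))).
rewrite tensor_lift_tens // f1 g1 mulr1 => E.
by have /eqP := etrans E (tensor_lift_zero bfg); rewrite oner_eq0.
Qed.

HB.instance Definition _ := GRing.Zmodule_isNzRing.Build T
  fermi_mulA fermi_mul1 fermi_mulr1 fermi_mulDl fermi_mulDr fermi_1neq0.

Fact fermi_scaleAl c x y : c *: (x * y) = (c *: x) * y.
Proof. exact: (esym (fermi_mulZl c x y)). Qed.
HB.instance Definition _ := GRing.Lmodule_isLalgebra.Build R[i] T fermi_scaleAl.
Fact fermi_scaleAr c x y : c *: (x * y) = x * (c *: y).
Proof. exact: (esym (fermi_mulZr c y x)). Qed.
HB.instance Definition _ := GRing.Lalgebra_isAlgebra.Build R[i] T fermi_scaleAr.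

Fact fermi_starK : involutive fermi_star.
Proof.
move=> x; elim/fermi_ind: x => [i j a1 a2 h1 h2|x y Hx Hy]; last first.
  by rewrite !fermi_starD Hx Hy.
rewrite (fermi_star_homogeneous h1 h2) fermi_starZ.
rewrite (fermi_star_homogeneous (homogeneous_star h1) (homogeneous_star h2)).
by rewrite rmorph_sign scalerA -signr_addb addbb scale1r !starK.
Qed.

Fact fermi_starM x y : fermi_star (x * y) = fermi_star y * fermi_star x.
Proof.
change (fermi_star (fermi_mul x y) = fermi_mul (fermi_star y) (fermi_star x)).
elim/fermi_ind: x => [i1 i2 a1 a2 ha1 ha2|x x' Hx Hx']; last first.
  by rewrite fermi_mulDl !fermi_starD Hx Hx' fermi_mulDr.
elim/fermi_ind: y => [j1 j2 b1 b2 hb1 hb2|y y' Hy Hy']; last first.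
  by rewrite fermi_mulDr !fermi_starD Hy Hy' fermi_mulDl.
rewrite (fermi_mul_homogeneous _ _ ha2 hb1) fermi_starZ rmorph_sign.
rewrite (fermi_star_homogeneous (homogeneousM ha1 hb1) (homogeneousM ha2 hb2)).
rewrite (fermi_star_homogeneous ha1 ha2) (fermi_star_homogeneous hb1 hb2).
rewrite fermi_mulZl fermi_mulZr.
rewrite (fermi_mul_homogeneous _ _ (homogeneous_star hb2) (homogeneous_star ha1)).
rewrite !starM !scalerA -!signr_addb; congr (_ ^+ _ *: _).
by case: i1 i2 j1 j2 {ha1 ha2 hb1 hb2} => [] [] [] [].
Qed.

HB.instance Definition _ := isStarAlgebra.Build R T
  fermi_starK fermi_starD fermi_starZ fermi_starM.

Lemma tensM_homogeneous i j a1 a2 b1 b2 :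
  homogeneous i a2 -> homogeneous j b1 ->
  (tens a1 a2 : T) * (tens b1 b2 : T) =
  (-1) ^+ (i && j) *: (tens (a1 * b1) (a2 * b2) : T).
Proof. exact: fermi_mul_homogeneous. Qed.

Lemma star_tens_homogeneous i j a1 a2 :
  homogeneous i a1 -> homogeneous j a2 ->
  star (tens a1 a2 : T) = (-1) ^+ (i && j) *: (tens (star a1) (star a2) : T).
Proof. exact: fermi_star_homogeneous. Qed.

End FermiTensor.

Section StatesAndRepresentations.
Variables (R : realType) (D : starAlgType R).

Definition is_state (w : {scalar D}) : Prop :=
  (forall x : D, 0 <= w (star x * x)) /\ w 1 = 1.

Definition star_preserving (H : hilbertType R) (pi : D -> 'B H) : Prop :=
  forall x, pi (star x) = star (pi x).

(* GNS triples of w are unique up to unitary equivalence, so the operator norm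
   of pi x depends only on w and x. *)
Definition is_GNS (w : D -> R[i]) (H : hilbertType R)
    (pi : {lrmorphism D -> 'B H}) (xi : H) : Prop :=
  [/\ star_preserving pi,
      forall x, w x = inner (pi x xi) xi
    & dense (range (fun x => pi x xi))].

End StatesAndRepresentations.

Definition is_even (R : realType) (D : gradedStarAlgType R) (w : D -> R[i]) : Prop :=
  forall x, w (grading x) = w x.

Section MinMaxNorms.
Variables (R : realType) (D1 D2 : gradedStarAlgType R).
Implicit Types x : fermi_tensor D1 D2.

Definition prod_functional (w1 : D1 -> R[i]) (w2 : D2 -> R[i]) x : R[i] :=
  tensor_lift (fun a1 a2 => w1 a1 * w2 a2 : R[i]^o) x.

Lemma prod_functional_tens (w1 : {scalar D1}) (w2 : {scalar D2}) a1 a2 :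
  prod_functional w1 w2 (tens a1 a2) = w1 a1 * w2 a2.
Proof.
apply: (@tensor_lift_tens _ _ _ R[i]^o (fun a1 a2 => w1 a1 * w2 a2)).
split=> [b c a a'|a c b b'] /=; rewrite linearP /=.
- by rewrite mulrDl -mulrA.
- by rewrite mulrDr mulrCA.
Qed.

(* The real suprema below are over nonempty sets when D1 and D2 are
   C*-algebras; they are bounded, since every state and every representation
   is contractive on D1 and on D2. *)
Definition min_norm x : R := sup [set r |
  exists (w1 : {scalar D1}) (w2 : {scalar D2}) (H : hilbertType R)
    (pi : {lrmorphism fermi_tensor D1 D2 -> 'B H}) (xi : H),
  [/\ is_state w1 /\ is_even w1, is_state w2 /\ is_even w2,
      is_GNS (prod_functional w1 w2) pi xi
    & r = opnorm (pi x)]].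

Definition max_norm x : R := sup [set r |
  exists (H : hilbertType R) (pi : {lrmorphism fermi_tensor D1 D2 -> 'B H}),
    star_preserving pi /\ r = opnorm (pi x)].

End MinMaxNorms.

Section VonNeumann.
Variables (R : realType) (H : hilbertType R).
Implicit Types (S T : 'B H) (X : set 'B H).

Definition commutant X : set 'B H := [set T | forall S, X S -> T * S = S * T].

Record gradedVonNeumann := GradedVonNeumann {
  vn_set : set 'B H;
  vn_star : forall T, vn_set T -> vn_set (star T);
  vn_bicommutant : commutant (commutant vn_set) = vn_set;
  vn_Gamma : 'B H;
  vn_Gamma_selfadjoint : star vn_Gamma = vn_Gamma;
  vn_Gamma_unitary : vn_Gamma * vn_Gamma = 1;
  vn_Gamma_invariant : [set vn_Gamma * T * vn_Gamma | T in vn_set] = vn_set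
}.

Variable M : gradedVonNeumann.

Definition vn_pred : {pred 'B H} := fun T => `[< vn_set M T >].

Record vn_sort := VnElement { vn_val :> 'B H; vn_valP : vn_val \in vn_pred }.
HB.instance Definition _ := [isSub for vn_val].
HB.instance Definition _ := [Choice of vn_sort by <:].


Fact vn_subalg : GRing.subalg_closed vn_pred.
Proof.
have E T : (T \in vn_pred) = `[< commutant (commutant (vn_set M)) T >].
  by rewrite vn_bicommutant.
split=> [|c S T|S T]; rewrite !E.
- by apply/asboolP => S _; rewrite mul1r mulr1.
- move=> /asboolP hS /asboolP hT; apply/asboolP => U hU.
  by rewrite mulrDl mulrDr hT // -scalerAl -scalerAr hS.
- move=> /asboolP hS /asboolP hT; apply/asboolP => U hU.
  by rewrite -mulrA hT // mulrA hS // mulrA.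
Qed.

HB.instance Definition _ := GRing.isSubalgClosed.Build R[i] 'B H vn_pred vn_subalg.
HB.instance Definition _ := [SubChoice_isSubAlgebra of vn_sort by <:].

Fact vn_star_subproof (r : vn_sort) : star (r : 'B H) \in vn_pred.
Proof. by case: r => T /= /asboolP hT; apply/asboolP/vn_star. Qed.
Definition vn_star_elt (r : vn_sort) : vn_sort := VnElement (vn_star_subproof r).

Fact vn_starK : involutive vn_star_elt.
Proof. by move=> r; apply: val_inj; exact: starK. Qed.
Fact vn_starD : {morph vn_star_elt : r s / r + s}.
Proof. by move=> r s; apply: val_inj; exact: starD. Qed.
Fact vn_starZ (c : R[i]) r : vn_star_elt (c *: r) = c^* *: vn_star_elt r.
Proof. by apply: val_inj; exact: starZ. Qed.
Fact vn_starM r s : vn_star_elt (r * s) = vn_star_elt s * vn_star_elt r.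
Proof. by apply: val_inj; exact: starM. Qed.
HB.instance Definition _ := isStarAlgebra.Build R vn_sort
  vn_starK vn_starD vn_starZ vn_starM.

Let G := vn_Gamma M.

Fact vn_grading_subproof (r : vn_sort) : G * r * G \in vn_pred.
Proof.
case: r => T /= /asboolP hT; apply/asboolP; rewrite -(vn_Gamma_invariant M).
by exists T.
Qed.
Definition vn_grading (r : vn_sort) : vn_sort := VnElement (vn_grading_subproof r).

Let GG T : G * (G * T) = T.
Proof. by rewrite mulrA vn_Gamma_unitary mul1r. Qed.

Fact vn_gradingK : involutive vn_grading.
Proof.
by move=> r; apply: val_inj; rewrite /= -!mulrA GG vn_Gamma_unitary mulr1.
Qed.
Fact vn_gradingL : linear vn_grading.
Proof.
by move=> c r s; apply: val_inj; rewrite /= mulrDr mulrDl -scalerAr -scalerAl.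
Qed.
Fact vn_gradingM : GRing.monoid_morphism vn_grading.
Proof.
split; first by apply: val_inj; rewrite /= mulr1 vn_Gamma_unitary.
by move=> r s; apply: val_inj; rewrite /= -!mulrA GG.
Qed.
Fact vn_gradingS r : vn_grading (star r) = star (vn_grading r).
Proof.
by apply: val_inj; rewrite /= [RHS]starM starM vn_Gamma_selfadjoint mulrA.
Qed.
HB.instance Definition _ := isGraded.Build R vn_sort
  vn_gradingK vn_gradingL vn_gradingM vn_gradingS.

Definition square_summable (xi : nat -> H) : Prop :=
  cvgn (series (fun n => hnorm (xi n) ^+ 2)).

Definition ultraweak_functional (xi eta : nat -> H) (r : vn_sort) : R[i]^o :=
  limn (series (fun n => inner (vn_val r (xi n)) (eta n) : R[i]^o)).

(* convergence in the ultraweak (sigma-weak) topology, which is the initial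
   topology of the functionals ultraweak_functional xi eta *)
Definition ultraweak_cvg (F : set_system vn_sort) (r : vn_sort) : Prop :=
  forall xi eta : nat -> H, square_summable xi -> square_summable eta ->
    ultraweak_functional xi eta @ F --> ultraweak_functional xi eta r.

Definition predual : set (vn_sort -> R[i]) := [set psi |
  linear_for *%R psi /\
  forall (F : set_system vn_sort) (r : vn_sort), ProperFilter F ->
    ultraweak_cvg F r -> (psi : vn_sort -> R[i]^o) @ F --> (psi r : R[i]^o)].

Variable B : gradedStarAlgType R.

Definition nor_norm (x : fermi_tensor vn_sort B) : R := sup [set r |
  exists2 phi : {scalar fermi_tensor vn_sort B},
    is_state phi /\ (forall b : B, predual (fun s => phi (tens s b)))
  & r = Num.sqrt (complex.Re (phi (x * star x)))].

End VonNeumann.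

(* Main.v *)
From HB Require Import structures.
From mathcomp Require Import all_boot all_order all_algebra.
From mathcomp Require Import complex ring lra.
From mathcomp Require Import all_classical all_reals all_analysis.
Require Import Defs.

(* (i) => (ii).  A von Neumann algebra is a C*-algebra, so it suffices that
   min <= nor <= max.  Normal states have bounded GNS representations, whence
   nor <= max.  For min <= nor, slicing with an even state w of A reduces an
   estimate for all products v x w, v an even state, to the products in which
   v is the vector functional of a homogeneous vector, and these are normal.
   (ii) => (i).  After doubling a representation pi of B (x) A, the grading is
   implemented by a unitary G.  Then M = pi(B)'' is a graded von Neumann
   algebra, and r (x) a |-> r pi(1 (x) a) is a representation of M (x) A whose
   vector states are normal.  So the norm of pi(x) is at most the normal norm,
   hence by (ii) the minimal norm, of the image of x in M (x) A.  The map from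
   B (x) A to M (x) A is contractive for the minimal norms, since r z is in the
   closure of pi(B) z for every r in M and every vector z. *)

Set Implicit Arguments.
Unset Strict Implicit.
Unset Printing Implicit Defensive.

Import Order.TTheory GRing.Theory Num.Theory Num.Def numFieldNormedType.Exports.

Local Open Scope classical_set_scope.
Local Open Scope ring_scope.

(** * Semi-inner products *)

(** The sign rules shape both directions. The sign from the star and the sign from the product
    cancel in a product functional once its factors vanish on odd elements; this is why vector
    functionals are used only at homogeneous vectors, where they are even. To pass from these to an
    arbitrary even state v, slice c^2 [star y * y] - [star (x * y) * (x * y)] along w. The result is
    a single element S of the von Neumann algebra, v sees only its even part, and the quadratic form
    of that part at a vector splits over the two homogeneous halves of the vector. Since v need not
    be normal, operator positivity reaches it by writing S + e as [star h * h] with h inside the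
    algebra. In the converse the obstacle is odd a: pi(1 (x) a) does not commute with the odd part
    of the image of B, so the bicommutant says nothing about it directly. The unitary G repairs
    this. All boundedness comes from an algebraic identity K^2 - [star a * a] = [star h * h] in each
    factor. It persists in the tensor product before any norm exists there, makes GNS operators
    bounded, and keeps the suprema finite; [sup] of an unbounded set would be 0. *)

Section ComplexModulus.
Variable R : realType.
Implicit Types c d l : R[i].
Local Notation Re := (@complex.Re R).
Local Notation Im := (@complex.Im R).

(** The norm of R[i] takes values in R[i]; a modulus with values in R keeps every estimate within
    reach of [lra] and [nra]. *)
Definition cmod c : R := Re `|c|.

Lemma normcE c : `|c| = (cmod c)%:C%C.
Proof. by rewrite /cmod RRe_real // normr_real. Qed.

Lemma cmod_ge0 c : 0 <= cmod c.
Proof. by rewrite -lecR -normcE normr_ge0. Qed.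

Lemma cmodM c d : cmod (c * d) = cmod c * cmod d.
Proof. by apply/(@complexI R); rewrite rmorphM /= -!normcE normrM. Qed.

Lemma cmodD c d : cmod (c + d) <= cmod c + cmod d.
Proof. by rewrite -lecR rmorphD /= -!normcE ler_normD. Qed.

Lemma cmodN c : cmod (- c) = cmod c.
Proof. by rewrite /cmod normrN. Qed.

Lemma cmodB c d : cmod (c - d) = cmod (d - c).
Proof. by rewrite -cmodN opprB. Qed.

Lemma cmodJ c : cmod c^* = cmod c.
Proof. by rewrite /cmod norm_conjC. Qed.

Lemma cmodR (t : R) : cmod t%:C%C = `|t|.
Proof.
by apply/(@complexI R); rewrite -normcE normc_def /= expr0n /= addr0 sqrtr_sqr.
Qed.

Lemma cmod0 : cmod 0 = 0.
Proof. by rewrite /cmod normr0. Qed.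

Lemma cmod0_eq0 c : cmod c = 0 -> c = 0.
Proof. by move=> c0; apply/eqP; rewrite -normr_eq0 normcE c0. Qed.

Lemma Re_le_cmod c : Re c <= cmod c.
Proof. by rewrite (le_trans (ler_norm _)) // -lecR -normcE normc_ge_Re. Qed.

Lemma normRe_le_cmod c : `|Re c| <= cmod c.
Proof. by rewrite -lecR -normcE normc_ge_Re. Qed.

Lemma normIm_le_cmod c : `|Im c| <= cmod c.
Proof.
by have := normRe_le_cmod ('i%C * c); rewrite mulrC ReiNIm normrN cmodM /cmod normci mulr1.
Qed.

Lemma cmod_le_ReIm c : cmod c <= `|Re c| + `|Im c|.
Proof. by rewrite -lecR -normcE complex_norm_le. Qed.

Lemma conjM_cmod c : c * c^* = (cmod c ^+ 2)%:C%C.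
Proof. by rewrite -normCK normcE rmorphXn. Qed.

Lemma cge0P c : 0 <= c <-> 0 <= Re c /\ Im c = 0.
Proof. by rewrite lecE /=; split=> [/andP[/eqP -> ->]|[-> ->]] //; rewrite eqxx. Qed.

Lemma cge0_Re c : 0 <= c -> c = (Re c)%:C%C.
Proof. by move=> c0; rewrite RRe_real // ger0_real. Qed.

Lemma cge0_ReE c : 0 <= c -> 0 <= Re c.
Proof. by move/cge0P => []. Qed.

Lemma ReD c d : Re (c + d) = Re c + Re d. Proof. by rewrite raddfD. Qed.
Lemma ReB c d : Re (c - d) = Re c - Re d. Proof. by rewrite raddfB. Qed.

Lemma ReJ c : Re c^* = Re c. Proof. by case: c. Qed.

Definition clim (u : nat -> R[i]) l : Prop :=
  forall e : R, 0 < e -> exists N, forall n, (N <= n)%N -> cmod (u n - l) < e.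

Lemma climD u v l m : clim u l -> clim v m -> clim (fun n => u n + v n) (l + m).
Proof.
move=> ul vm e e0; have e20 : 0 < e / 2 by rewrite divr_gt0.
have [N hN] := ul _ e20; have [M hM] := vm _ e20.
exists (maxn N M) => n; rewrite geq_max => /andP[/hN h1 /hM h2].
by rewrite opprD addrACA (le_lt_trans (cmodD _ _)) // [e]splitr ltrD.
Qed.

Lemma climZ c u l : clim u l -> clim (fun n => c * u n) (c * l).
Proof.
move=> ul e e0; have c0 := cmod_ge0 c.
have e20 : 0 < e / (cmod c + 1) by rewrite divr_gt0 // ltr_wpDl.
have [N hN] := ul _ e20; exists N => n /hN h.
rewrite -mulrBr cmodM; rewrite ltr_pdivlMr ?ltr_wpDl // in h.
have := cmod_ge0 (u n - l); nra.
Qed.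

Lemma climJ u l : clim u l -> clim (fun n => (u n)^*) l^*.
Proof.
by move=> ul e /ul[N hN]; exists N => n /hN; rewrite -rmorphB cmodJ.
Qed.

Lemma clim_unique u l m : clim u l -> clim u m -> l = m.
Proof.
move=> ul um; apply/eqP; rewrite -subr_eq0; apply/eqP/cmod0_eq0/eqP.
rewrite eq_le cmod_ge0 andbT; apply/ler_addgt0Pr => e e0; rewrite add0r.
have e20 : 0 < e / 2 by rewrite divr_gt0.
have [N hN] := ul _ e20; have [M hM] := um _ e20.
have := hN _ (leq_maxl N M); have := hM _ (leq_maxr N M).
set n := maxn N M => h1 h2.
have -> : l - m = (u n - m) - (u n - l) by ring.
rewrite (le_trans (cmodD _ _)) // cmodN; lra.
Qed.

Lemma clim_ge0 u l : (forall n, 0 <= u n) -> clim u l -> 0 <= l.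
Proof.
move=> u0 ul; apply/cge0P; split.
  rewrite leNgt; apply/negP => l0.
  have [N /(_ N (leqnn N))] := ul (- Re l) ltac:(by rewrite oppr_gt0).
  apply/negP; rewrite -leNgt (le_trans _ (Re_le_cmod _)) // ReB.
  by rewrite lerDr; apply: cge0_ReE.
apply/eqP; rewrite -normr_eq0 eq_le normr_ge0 andbT.
apply/ler_addgt0Pr => e e0; rewrite add0r; have [N /(_ N (leqnn N)) h] := ul _ e0.
rewrite (le_trans _ (ltW h)) // (le_trans _ (normIm_le_cmod _)) //.
have [_ un] := (cge0P _).1 (u0 N).
by rewrite raddfB /= un sub0r normrN.
Qed.

Lemma rcauchy_cvg (u : nat -> R) :
  (forall e : R, 0 < e -> exists N, forall m n, (N <= m)%N -> (N <= n)%N -> `|u m - u n| < e) ->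
  exists l : R, forall e : R, 0 < e -> exists N, forall n, (N <= n)%N -> `|u n - l| < e.
Proof.
move=> uc; have : cvg (u @ \oo).
  apply: R_complete; apply/cauchyP => e e0; have [N hN] := uc _ e0.
  exists (u N); exists N => // n /= Nn; rewrite /ball /=.
  exact: hN.
move=> /cvgrPdist_lt h; exists (lim (u @ \oo)) => e /h [N _ hN].
by exists N => n /hN; rewrite distrC.
Qed.

Lemma ccauchy_cvg (u : nat -> R[i]) :
  (forall e : R, 0 < e -> exists N, forall m n, (N <= m)%N -> (N <= n)%N -> cmod (u m - u n) < e) ->
  exists l, clim u l.
Proof.
move=> uc.
have [|a ha] := @rcauchy_cvg (fun n => Re (u n)).
  move=> e /uc[N hN]; exists N => m n hm hn.
  by rewrite -ReB (le_lt_trans (normRe_le_cmod _)) // hN.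
have [|b hb] := @rcauchy_cvg (fun n => Im (u n)).
  move=> e /uc[N hN]; exists N => m n hm hn.
  by rewrite -raddfB (le_lt_trans (normIm_le_cmod _)) // hN.
exists (Complex a b) => e e0; have e20 : 0 < e / 2 by rewrite divr_gt0.
have [N hN] := ha _ e20; have [M hM] := hb _ e20.
exists (maxn N M) => n; rewrite geq_max => /andP[/hN h1 /hM h2].
rewrite (le_lt_trans (cmod_le_ReIm _)) // !raddfB /= [e]splitr.
by rewrite ltrD.
Qed.

End ComplexModulus.

Section SemiInner.
Variable R : realType.
Local Notation Re := (@complex.Re R).

(** Null vectors are allowed, because the form of a state usually has some; no quotient is formed,
    as the completion identifies them with 0. *)
Record semi_inner (V : lmodType R[i]) := SemiInner {
  sform :> V -> V -> R[i];
  sform_l : forall w, linear_for *%R (fun v => sform v w);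
  sform_herm : forall v w, sform v w = (sform w v)^*;
  sform_ge0 : forall v, 0 <= sform v v
}.

Variables (V : lmodType R[i]) (q : semi_inner V).
Implicit Types (u v w : V) (c : R[i]).

Lemma sformDl u v w : q (u + v) w = q u w + q v w.
Proof. by have := sform_l q w 1 u v; rewrite scale1r mul1r. Qed.
Lemma sform0l w : q 0 w = 0.
Proof. by apply: (addrI (q 0 w)); rewrite -sformDl !addr0. Qed.
Lemma sformZl c v w : q (c *: v) w = c * q v w.
Proof. by have := sform_l q w c v 0; rewrite !addr0 sform0l addr0. Qed.
Lemma sformNl v w : q (- v) w = - q v w.
Proof. by rewrite -scaleN1r sformZl mulN1r. Qed.
Lemma sformBl u v w : q (u - v) w = q u w - q v w.
Proof. by rewrite sformDl sformNl. Qed.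
Lemma sformDr w u v : q w (u + v) = q w u + q w v.
Proof. by rewrite sform_herm sformDl rmorphD /= -!(sform_herm q). Qed.
Lemma sformZr c w v : q w (c *: v) = c^* * q w v.
Proof. by rewrite sform_herm sformZl rmorphM /= -(sform_herm q). Qed.
Lemma sform0r w : q w 0 = 0.
Proof. by rewrite sform_herm sform0l rmorph0. Qed.
Lemma sformNr w v : q w (- v) = - q w v.
Proof. by rewrite sform_herm sformNl rmorphN /= -(sform_herm q). Qed.
Lemma sformBr w u v : q w (u - v) = q w u - q w v.
Proof. by rewrite sformDr sformNr. Qed.
Lemma sform_suml (I : Type) (s : seq I) (F : I -> V) w :
  q (\sum_(i <- s) F i) w = \sum_(i <- s) q (F i) w.
Proof. by elim/big_rec2: _ => [|i x y _ <-]; rewrite ?sform0l ?sformDl. Qed.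
Lemma sform_sumr (I : Type) (s : seq I) (F : I -> V) w :
  q w (\sum_(i <- s) F i) = \sum_(i <- s) q w (F i).
Proof. by elim/big_rec2: _ => [|i x y _ <-]; rewrite ?sform0r ?sformDr. Qed.

Definition snorm v : R := Num.sqrt (Re (q v v)).

Lemma snorm_ge0 v : 0 <= snorm v. Proof. exact: sqrtr_ge0. Qed.

Lemma snorm_sqr v : snorm v ^+ 2 = Re (q v v).
Proof. by rewrite sqr_sqrtr // cge0_ReE // sform_ge0. Qed.

Lemma sform_snorm v : q v v = (snorm v ^+ 2)%:C%C.
Proof. by rewrite snorm_sqr -cge0_Re // sform_ge0. Qed.

Lemma Re_sform_le u v : Re (q u v) <= snorm u * snorm v.
Proof.
have := snorm_ge0 u; have := snorm_ge0 v.
have quv (a b : R) : 0 <= a ^+ 2 * snorm u ^+ 2 - 2 * a * b * Re (q u v) + b ^+ 2 * snorm v ^+ 2.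
  have := cge0_ReE (sform_ge0 q (a%:C%C *: u - b%:C%C *: v)).
  rewrite sformBl !sformBr !sformZl !sformZr (sform_herm q v u) !conjCE.
  rewrite !conjc_real (sform_snorm u) (sform_snorm v).
  rewrite !ReB !ReZ -!conjCE ReJ /=; congr (_ <= _); ring.
set x := snorm u; set y := snorm v => y0 x0.
(* For xy > 0, take a = y and b = x in [quv] and cancel 2xy. If xy = 0 and the real part r were
   positive, scaling the vector of seminorm 0 by (N^2 + 1) / (2r), with N the other seminorm, would
   turn the right side of [quv] into -1. *)
have [xy0|xy0] := ltP 0 (x * y).
  rewrite -(ler_pM2l xy0); move: (quv y x); rewrite -/x -/y; set r := Re _; nra.
have {xy0} xy0 : x * y = 0 by apply/le_anti; rewrite xy0 mulr_ge0.
rewrite xy0; move/eqP: xy0; rewrite mulf_eq0 leNgt => xy0; apply/negP => q0.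
have [x00|y00] := orP xy0; move: quv; rewrite -/x -/y ?(eqP x00) ?(eqP y00) => quv.
- have := quv ((y ^+ 2 + 1) / (2 * Re (q u v))) 1.
  have := divfK (lt0r_neq0 (mulr_gt0 (ltr0Sn R 1) q0)) (y ^+ 2 + 1).
  move: (_ / _) => t; nra.
- have := quv 1 ((x ^+ 2 + 1) / (2 * Re (q u v))).
  have := divfK (lt0r_neq0 (mulr_gt0 (ltr0Sn R 1) q0)) (x ^+ 2 + 1).
  move: (_ / _) => t; nra.
Qed.

(** Multiplying u by the conjugate of q u v turns the real part into the square of the modulus, and
    one factor of the modulus cancels. *)
Lemma sform_CS u v : cmod (q u v) <= snorm u * snorm v.
Proof.
have [->|c0] := eqVneq (cmod (q u v)) 0; first by rewrite mulr_ge0 ?snorm_ge0.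
have {}c0 : 0 < cmod (q u v) by rewrite lt_def c0 cmod_ge0.
have := Re_sform_le ((q u v)^* *: u) v.
rewrite sformZl mulrC conjM_cmod /= => h.
have snZ : snorm ((q u v)^* *: u) = cmod (q u v) * snorm u.
  apply/eqP; rewrite -(@eqrXn2 _ 2) ?mulr_ge0 ?snorm_ge0 ?cmod_ge0 //.
  rewrite snorm_sqr sformZl sformZr mulrA conjM_cmod cmodJ sform_snorm -rmorphM /=.
  by rewrite exprMn.
by rewrite -(ler_pM2l c0) mulrA -snZ -expr2.
Qed.

Lemma snormZ c v : snorm (c *: v) = cmod c * snorm v.
Proof.
apply/eqP; rewrite -(@eqrXn2 _ 2) ?mulr_ge0 ?snorm_ge0 ?cmod_ge0 //.
by rewrite snorm_sqr sformZl sformZr mulrA conjM_cmod sform_snorm -rmorphM /= exprMn.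
Qed.

Lemma snormD u v : snorm (u + v) <= snorm u + snorm v.
Proof.
rewrite -(@ler_pXn2r _ 2) ?nnegrE ?addr_ge0 ?snorm_ge0 //.
rewrite snorm_sqr sformDl !sformDr !ReD (sform_herm q v u) ReJ -!snorm_sqr.
have := Re_sform_le u v; rewrite sqrrD; lra.
Qed.

Lemma snormN v : snorm (- v) = snorm v.
Proof. by rewrite -scaleN1r snormZ cmodN cmodR normr1 mul1r. Qed.

Lemma snormB u v : snorm (u - v) = snorm (v - u).
Proof. by rewrite -snormN opprB. Qed.

Lemma snorm0 : snorm 0 = 0.
Proof. by rewrite /snorm sform0l sqrtr0. Qed.

End SemiInner.

(** * Completion of a pre-Hilbert space *)

Record pre_hilbert (R : realType) := PreHilbert {
  ph_space :> lmodType R[i];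
  ph_form : semi_inner ph_space;
  ph_neq0 : exists v, snorm ph_form v != 0
}.

Section Completion.
Variables (R : realType) (P : pre_hilbert R).
Local Notation Re := (@complex.Re R).
Local Notation V := (ph_space P).
Local Notation q := (ph_form P).
Implicit Types (v w z : V) (c : R[i]) (u : nat -> V).

(** Convergence of the functionals q (u n) to f in the dual norm, uniform over z of seminorm at most
    1. *)
Definition approximable_by (f : V -> R[i]^o) u : Prop :=
  forall e : R, 0 < e -> exists N, forall n, (N <= n)%N ->
    forall z, cmod (f z - q (u n) z) <= e * snorm q z.

Definition completion_pred : {pred (V -> R[i]^o)} :=
  fun f => `[< exists u, approximable_by f u >].

(* The vector completing q(u_n, .) is represented by the antilinear functional
   z |-> <f, z> rather than by a class of Cauchy sequences, so that equality is
   extensional equality and bounded operators act by precomposition with their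
   adjoint. *)
Record completion := Completion {
  completion_val :> V -> R[i]^o;
  completion_valP : completion_val \in completion_pred
}.
HB.instance Definition _ := [isSub for completion_val].
HB.instance Definition _ := [Choice of completion by <:].

Lemma approximable_cst v : approximable_by (q v) (fun=> v).
Proof.
by move=> e e0; exists 0%N => n _ z; rewrite subrr cmod0 mulr_ge0 ?snorm_ge0 // ltW.
Qed.

Lemma approximable_lin c f g u u' : approximable_by f u -> approximable_by g u' ->
  approximable_by (c *: f + g) (fun n => c *: u n + u' n).
Proof.
move=> fu gu e e0; have c0 := cmod_ge0 c.
have c1 : 0 < cmod c + 1 by rewrite ltr_wpDl.
have e20 : 0 < e / 2 / (cmod c + 1) by rewrite !divr_gt0.
have [N hN] := fu _ e20; have [M hM] := gu (e / 2) ltac:(by rewrite divr_gt0).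
exists (maxn N M) => n; rewrite geq_max => /andP[/hN h1 /hM h2] z.
rewrite sformDl sformZl.
have -> : (c *: f + g) z - (c * q (u n) z + q (u' n) z) =
  c * (f z - q (u n) z) + (g z - q (u' n) z).
  have E (a b x y : R[i]) : c * a + b - (c * x + y) = c * (a - x) + (b - y) by ring.
  exact: E.
rewrite (le_trans (cmodD _ _)) // cmodM [e in leRHS]splitr mulrDl lerD //.
rewrite (le_trans (ler_wpM2l c0 (h1 z))) // mulrA ler_wpM2r ?snorm_ge0 //.
by rewrite mulrCA ger_pMr ?divr_gt0 // ler_pdivrMr // mul1r lerDl.
Qed.

Fact completion_submod : GRing.submod_closed completion_pred.
Proof.
split=> [|c f g]; first apply/asboolP.
  exists (fun=> 0) => e e0; exists 0%N => n _ z.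
  by rewrite sform0l subrr cmod0 mulr_ge0 ?snorm_ge0 // ltW.
move=> /asboolP[u fu] /asboolP[u' gu]; apply/asboolP.
by exists (fun n => c *: u n + u' n); exact: approximable_lin.
Qed.
HB.instance Definition _ :=
  GRing.isSubmodClosed.Build R[i] (V -> R[i]^o) completion_pred completion_submod.
HB.instance Definition _ := [SubChoice_isSubLmodule of completion by <:].

Implicit Types f g h : completion.

Lemma completion_ext f g : (forall z, f z = g z) -> f = g.
Proof. by move=> fg; apply: val_inj; apply: funext. Qed.

Lemma completion_approx f : exists u, approximable_by f u.
Proof. by case: f => f /= /asboolP. Qed.

(** Both functionals are close to f; testing them on the difference z of the two vectors bounds
    |z|^2 by e |z|. *)
Lemma approx_close f u u' : approximable_by f u -> approximable_by f u' ->
  forall e : R, 0 < e -> exists N, forall m n, (N <= m)%N -> (N <= n)%N ->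
    snorm q (u m - u' n) <= e.
Proof.
move=> fu fu' e e0; have e20 : 0 < e / 2 by rewrite divr_gt0.
have [N hN] := fu _ e20; have [M hM] := fu' _ e20.
exists (maxn N M) => m n; rewrite !geq_max => /andP[Nm _] /andP[_ Mn].
set z := u m - u' n; have h1 := hN _ Nm z; have h2 := hM _ Mn z.
have [->|z0] := eqVneq (snorm q z) 0; first exact: ltW.
have {}z0 : 0 < snorm q z by rewrite lt_def z0 snorm_ge0.
rewrite -(ler_pM2r z0) -expr2 snorm_sqr (le_trans (Re_le_cmod _)) //.
rewrite {1}/z sformBl.
have -> : q (u m) z - q (u' n) z = (f z - q (u' n) z) - (f z - q (u m) z) by ring.
by rewrite (le_trans (cmodD _ _)) // cmodN; lra.
Qed.

Lemma approx_bounded f u : approximable_by f u ->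
  exists2 K : R, 0 < K & exists N, forall n, (N <= n)%N -> snorm q (u n) <= K.
Proof.
move=> fu; have [N hN] := approx_close fu fu ltr01.
exists (1 + snorm q (u N)); first by rewrite ltr_wpDr ?snorm_ge0.
exists N => n Nn; have := hN _ _ Nn (leqnn N).
have -> : u n = (u n - u N) + u N by rewrite subrK.
by rewrite addrK => h; rewrite (le_trans (snormD _ _ _)) // lerD2r.
Qed.

Lemma approx_form_close f g (u u' v v' : nat -> V) :
  approximable_by f u -> approximable_by f u' ->
  approximable_by g v -> approximable_by g v' ->
  forall e : R, 0 < e -> exists N, forall m n, (N <= m)%N -> (N <= n)%N ->
    cmod (q (u m) (v m) - q (u' n) (v' n)) < e.
Proof.
move=> fu fu' gv gv' e e0.
have [K K0 [N1 hK]] := approx_bounded fu'; have [L L0 [N2 hL]] := approx_bounded gv.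
have KL0 : 0 < K + L by rewrite addr_gt0.
have e'0 : 0 < e / (2 * (K + L)) by rewrite divr_gt0 // mulr_gt0.
have [N3 h3] := approx_close fu fu' e'0; have [N4 h4] := approx_close gv gv' e'0.
exists (maxn (maxn N1 N2) (maxn N3 N4)) => m n.
rewrite !geq_max => /andP[/andP[m1 m2] /andP[m3 m4]] /andP[/andP[n1 n2] /andP[n3 n4]].
have -> : q (u m) (v m) - q (u' n) (v' n) =
  q (u m - u' n) (v m) + q (u' n) (v m - v' n).
  by rewrite sformBl sformBr; ring.
rewrite (le_lt_trans (cmodD _ _)) //.
have a1 : cmod (q (u m - u' n) (v m)) <= e / (2 * (K + L)) * L.
  by rewrite (le_trans (sform_CS _ _ _)) // ler_pM ?snorm_ge0 ?h3 ?hL.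
have a2 : cmod (q (u' n) (v m - v' n)) <= K * (e / (2 * (K + L))).
  by rewrite (le_trans (sform_CS _ _ _)) // ler_pM ?snorm_ge0 ?h4 ?hK.
rewrite (le_lt_trans (lerD a1 a2)) //.
have -> : e / (2 * (K + L)) * L + K * (e / (2 * (K + L))) = e / 2.
  by field; rewrite gt_eqF.
by rewrite ltr_pdivrMr // ltr_pMr // ltr1n.
Qed.

(** Independence of the approximating sequences is built in, so each law of the inner product can be
    proved along whichever sequences are convenient. *)
Lemma completion_inner_ex f g : exists l : R[i], forall u (v : nat -> V),
  approximable_by f u -> approximable_by g v -> clim (fun n => q (u n) (v n)) l.
Proof.
have [u fu] := completion_approx f; have [v gv] := completion_approx g.
have [l hl] := ccauchy_cvg (approx_form_close fu fu gv gv).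
exists l => u' v' fu' gv' e e0; have e20 : 0 < e / 2 by rewrite divr_gt0.
have [N hN] := hl _ e20; have [M hM] := approx_form_close fu' fu gv' gv e20.
exists (maxn N M) => n; rewrite geq_max => /andP[Nn Mn].
have -> : q (u' n) (v' n) - l =
  (q (u' n) (v' n) - q (u n) (v n)) + (q (u n) (v n) - l) by ring.
rewrite (le_lt_trans (cmodD _ _)) // [e]splitr ltrD //; last exact: hN.
exact: hM.
Qed.

Definition completion_inner f g : R[i] := projT1 (cid (completion_inner_ex f g)).

Lemma completion_innerP f g (u v : nat -> V) : approximable_by f u -> approximable_by g v ->
  clim (fun n => q (u n) (v n)) (completion_inner f g).
Proof. by rewrite /completion_inner; case: cid => l /= h; exact: h. Qed.

Fact completion_inner_l g : linear_for *%R (fun f => completion_inner f g).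
Proof.
move=> c f f'; have [u fu] := completion_approx f.
have [u' fu'] := completion_approx f'; have [v gv] := completion_approx g.
have := completion_innerP (approximable_lin c fu fu' : approximable_by (c *: f + f') _) gv.
move/clim_unique; apply.
have := climD (climZ c (completion_innerP fu gv)) (completion_innerP fu' gv).
by congr clim; apply/funext => n; rewrite sformDl sformZl.
Qed.

Fact completion_inner_herm f g : completion_inner f g = (completion_inner g f)^*.
Proof.
have [u fu] := completion_approx f; have [v gv] := completion_approx g.
apply: clim_unique (completion_innerP fu gv) _.
have := climJ (completion_innerP gv fu).
by congr clim; apply/funext => n; rewrite -sform_herm.
Qed.

Fact completion_inner_ge0 f : 0 <= completion_inner f f.
Proof.
have [u fu] := completion_approx f.
by apply: clim_ge0 (completion_innerP fu fu) => n; exact: sform_ge0.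
Qed.

Definition completion_form : semi_inner completion :=
  SemiInner completion_inner_l completion_inner_herm completion_inner_ge0.
Local Notation Q := completion_form.

Fact completion_of_subproof v : (q v : V -> R[i]^o) \in completion_pred.
Proof. by apply/asboolP; exists (fun=> v); exact: approximable_cst. Qed.
Definition completion_of v : completion := Completion (completion_of_subproof v).
Local Notation j := completion_of.

Lemma completion_form_of f v : Q f (j v) = f v.
Proof.
have [u fu] := completion_approx f.
have := completion_innerP fu (approximable_cst v : approximable_by (j v) _).
move/clim_unique; apply=> e e0; have s0 := snorm_ge0 q v.
have e'0 : 0 < e / (snorm q v + 1) by rewrite divr_gt0 // ltr_wpDl.
have [N hN] := fu _ e'0; exists N => n /hN /(_ v) h.
rewrite cmodB (le_lt_trans h) // mulrAC ltr_pdivrMr ?ltr_wpDl //.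
by rewrite ltr_pM2l // ltrDl.
Qed.

Lemma completion_form_ofof v w : Q (j v) (j w) = q v w.
Proof. exact: completion_form_of. Qed.

Lemma snorm_completion_of v : snorm Q (j v) = snorm q v.
Proof. by rewrite /snorm completion_form_ofof. Qed.

Lemma completion_ofD c v w : j (c *: v + w) = c *: j v + j w.
Proof. by apply: completion_ext => z; exact: sform_l. Qed.
Lemma completion_ofB v w : j (v - w) = j v - j w.
Proof. by apply: completion_ext => z; exact: sformBl. Qed.

Lemma completion_snorm_eq0 f : snorm Q f = 0 -> f = 0.
Proof.
move=> f0; apply: completion_ext => z; apply: cmod0_eq0; apply/eqP.
by rewrite eq_le cmod_ge0 -completion_form_of (le_trans (sform_CS _ _ _)) // f0 mul0r.
Qed.

Lemma approx_snorm f u : approximable_by f u -> forall e : R, 0 < e ->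
  exists N, forall n, (N <= n)%N -> `|snorm q (u n) - snorm Q f| <= e.
Proof.
move=> fu e e0; have e20 : 0 < e ^+ 2 by rewrite exprn_gt0.
have [N hN] := completion_innerP fu fu e20; exists N => n /hN.
have := snorm_ge0 q (u n); have := snorm_ge0 Q f.
rewrite sform_snorm (sform_snorm Q f : completion_inner f f = _) -rmorphB cmodR.
move: (snorm _ _) (snorm _ _) => x y x0 y0; rewrite ler_norml ltr_norml.
by move=> /andP[h1 h2]; apply/andP; split; nra.
Qed.

(** Testing f on a vector v that approximates f itself gives |v|^2 <= (K + e/2) |v|, and |v| is
    close to the norm of f. *)
Lemma completion_snorm_le f (K : R) : 0 <= K ->
  (forall z, cmod (f z) <= K * snorm q z) -> snorm Q f <= K.
Proof.
move=> K0 fK; apply/ler_addgt0Pr => e e0.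
have [u fu] := completion_approx f; have e20 : 0 < e / 2 by rewrite divr_gt0.
have [N hN] := fu _ e20; have [M hM] := approx_snorm fu e20.
have := hN _ (leq_maxl N M) (u (maxn N M)); have := hM _ (leq_maxr N M).
set v := u (maxn N M) => h1 h2.
have h : snorm q v <= K + e / 2.
  have [->|v0] := eqVneq (snorm q v) 0; first by rewrite addr_ge0 // ltW.
  have {}v0 : 0 < snorm q v by rewrite lt_def v0 snorm_ge0.
  rewrite -(ler_pM2r v0) -expr2 snorm_sqr (le_trans (Re_le_cmod _)) //.
  have -> : q v v = f v - (f v - q v v) by ring.
  by rewrite (le_trans (cmodD _ _)) // cmodN mulrDl lerD.
by move: h1; rewrite ler_norml => /andP[h1 _]; lra.
Qed.

Lemma completion_dense f (e : R) : 0 < e -> exists v, snorm Q (f - j v) <= e.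
Proof.
move=> e0; have [u fu] := completion_approx f; have [N hN] := fu _ e0.
by exists (u N); apply: completion_snorm_le (ltW e0) _ => z; exact: hN.
Qed.

Lemma completion_limit (u : nat -> V) :
  (forall e : R, 0 < e -> exists N, forall m n, (N <= m)%N -> (N <= n)%N ->
     snorm q (u m - u n) <= e) ->
  exists f : completion, approximable_by f u.
Proof.
move=> uc.
have ex z : exists l, clim (fun n => q (u n) z) l.
  apply: ccauchy_cvg => e e0; have s0 := snorm_ge0 q z.
  have e'0 : 0 < e / (snorm q z + 1) by rewrite divr_gt0 // ltr_wpDl.
  have [N hN] := uc _ e'0; exists N => m n Nm Nn.
  rewrite -sformBl (le_lt_trans (sform_CS _ _ _)) //.
  rewrite (le_lt_trans (ler_wpM2r s0 (hN _ _ Nm Nn))) //.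
  by rewrite mulrAC ltr_pdivrMr ?ltr_wpDl // ltr_pM2l // ltrDl.
pose f z : R[i]^o := projT1 (cid (ex z)).
have fP z : clim (fun n => q (u n) z) (f z) by rewrite /f; case: cid.
have fu : approximable_by f u.
  move=> e /uc[N hN]; exists N => n Nn z; apply/ler_addgt0Pr => d d0.
  have [M hM] := fP z _ d0.
  have h1 := hN _ _ (leq_maxl N M) Nn; have h2 := hM _ (leq_maxr N M).
  set m := maxn N M in h1 h2.
  have -> : f z - q (u n) z = q (u m - u n) z - (q (u m) z - f z).
    by rewrite sformBl; ring.
  rewrite (le_trans (cmodD _ _)) // cmodN lerD //; last exact: ltW.
  by rewrite (le_trans (sform_CS _ _ _)) // ler_wpM2r ?snorm_ge0.
have fin : f \in completion_pred by apply/asboolP; exists u.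
by exists (Completion fin).
Qed.

Definition completion_norm f : R[i] := (snorm Q f)%:C%C.

Fact completion_normD f g : completion_norm (f + g) <= completion_norm f + completion_norm g.
Proof. by rewrite -rmorphD lecR snormD. Qed.
Fact completion_normZ c f : completion_norm (c *: f) = `|c| * completion_norm f.
Proof. by rewrite /completion_norm snormZ rmorphM /= -normcE. Qed.
Fact completion_norm0_eq0 f : completion_norm f = 0 -> f = 0.
Proof. by move=> /complexI /completion_snorm_eq0. Qed.

HB.instance Definition _ := Lmodule_isNormed.Build R[i] completion
  completion_normD completion_normZ completion_norm0_eq0.

Lemma completion_normE f : `|f| = (snorm Q f)%:C%C. Proof. by []. Qed.

Fact completion_complete (F : set_system completion) :
  ProperFilter F -> cauchy F -> cvg F.
Proof.
move=> FF /cauchyP Fc.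
(* Of the radius 2/(n+1), one half is the Cauchy ball of the filter and the other the error of
   replacing its centre by a vector of V. Two such sets always meet, so the chosen vectors form a
   Cauchy sequence. *)
have ex (n : nat) : exists v : V, F [set f | snorm Q (f - j v) <= 2 / n.+1%:R].
  have n0 : 0 < (n.+1%:R^-1 : R)%:C%C by rewrite ltcR invr_gt0.
  have [f hf] := Fc _ n0; have [v hv] := @completion_dense f n.+1%:R^-1 ltac:(by rewrite invr_gt0).
  exists v; apply: filterS hf => g; rewrite -ball_normE /= completion_normE ltcR => gf.
  have -> : g - j v = (f - j v) - (f - g) by rewrite opprB [RHS]addrC addrA subrK.
  by rewrite (le_trans (snormD _ _ _)) // snormN mulr2n mulrDl mul1r lerD // ltW.
pose u n := projT1 (cid (ex n)).
have uP n : F [set f | snorm Q (f - j (u n)) <= 2 / n.+1%:R] by rewrite /u; case: cid.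
have small (e : R) : 0 < e -> exists N, forall n, (N <= n)%N -> 2 / n.+1%:R <= e :> R.
  move=> e0; have e20 : 0 < e / 2 by rewrite divr_gt0.
  have [N _ hN] := near_infty_natSinv_lt (PosNum e20); exists N => n /hN /= h.
  by rewrite mulrC -ler_pdivlMr // ltW.
have [f fu] : exists f : completion, approximable_by f u.
  apply: completion_limit => e e0; have [N hN] := small (e / 2) ltac:(by rewrite divr_gt0).
  exists N => m n /hN hm /hN hn.
  have [g [/= g1 g2]] := filter_ex (filterI (uP m) (uP n)).
  rewrite -snorm_completion_of completion_ofB.
  have -> : j (u m) - j (u n) = (g - j (u n)) - (g - j (u m)).
    by rewrite opprB [RHS]addrC addrA subrK.
  rewrite (le_trans (snormD _ _ _)) // snormN [e]splitr lerD //.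
    exact: le_trans g2 hn.
  exact: le_trans g1 hm.
apply/cvg_ex; exists f; apply/cvgrPdist_le => e e0.
have eR : e = (Re e)%:C%C by rewrite RRe_real // gtr0_real.
have {}e0 : 0 < Re e by rewrite -ltcR -eR.
have e20 : 0 < Re e / 2 by rewrite divr_gt0.
have [N hN] := small _ e20; have [M hM] := fu _ e20.
pose n := maxn N M; apply: filterS (uP n) => g /= gn.
rewrite completion_normE eR lecR.
have -> : f - g = (f - j (u n)) - (g - j (u n)) by rewrite opprB addrA subrK.
rewrite (le_trans (snormD _ _ _)) // snormN [Re e]splitr lerD //.
  by apply: completion_snorm_le (ltW e20) _ => z; apply: hM; exact: leq_maxr.
by rewrite (le_trans gn) // hN // leq_maxl.
Qed.

HB.instance Definition _ := Uniform_isComplete.Build completion completion_complete.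

Fact completion_inner_additivel g : zmod_morphism (fun f => completion_inner f g).
Proof. by move=> f f'; exact: (sformBl Q). Qed.
Fact completion_inner_additiver f : zmod_morphism (completion_inner f).
Proof. by move=> g g'; exact: (sformBr Q). Qed.
Fact completion_inner_scalel g : scalable_for *%R (fun f => completion_inner f g).
Proof. by move=> c f; exact: (sformZl Q). Qed.
Fact completion_inner_scaler f :
  scalable_for ((@conjC R[i]) \; *%R) (completion_inner f).
Proof. by move=> c g; exact: (sformZr Q). Qed.
Fact completion_inner_hermitian f g :
  completion_inner f g = (-1) ^+ false * (completion_inner g f)^*.
Proof. by rewrite expr0 mul1r; exact: (sform_herm Q). Qed.
Fact completion_inner_gt0 f : f != 0 -> 0 < completion_inner f f.
Proof.
move=> f0; rewrite lt_def completion_inner_ge0 andbT; apply: contra f0 => /eqP h.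
by apply/eqP/completion_snorm_eq0; rewrite /snorm /= h sqrtr0.
Qed.

HB.instance Definition _ := @isBilinear.Build R[i] completion completion R[i]
  *%R ((@conjC R[i]) \; *%R) completion_inner
  completion_inner_additivel completion_inner_additiver
  completion_inner_scalel completion_inner_scaler.
HB.instance Definition _ := @isHermitianSesquilinear.Build R[i] completion
  false (@conjC R[i]) completion_inner completion_inner_hermitian.
HB.instance Definition _ := @isDotProduct.Build R[i] completion completion_inner
  completion_inner_gt0.

Fact completion_innerE f : (completion_inner : {dot completion for @conjC R[i]}) f f = `|f| ^+ 2.
Proof. by rewrite completion_normE -rmorphXn /= -(sform_snorm Q). Qed.

Fact completion_neq0 : exists f : completion, f != 0.
Proof.
have [v v0] := ph_neq0 P; exists (j v); apply: contra v0 => /eqP h.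
by rewrite -snorm_completion_of h snorm0.
Qed.

HB.instance Definition _ := isHilbert.Build R completion completion_innerE completion_neq0.

Lemma inner_completion f g : inner f g = Q f g. Proof. by []. Qed.
Lemma hnorm_completion f : hnorm f = snorm Q f. Proof. by []. Qed.

End Completion.

(** * Operators and GNS representations *)

Section StarAlgebraTheory.
Variables (R : realType) (D : starAlgType R).
Implicit Types x y : D.
Lemma starN x : star (- x) = - star x.
Proof. by rewrite -scaleN1r starZ rmorphN1 scaleN1r. Qed.
Lemma starB x y : star (x - y) = star x - star y.
Proof. by rewrite starD starN. Qed.
Lemma starA1 : star (1 : D) = 1.
Proof. by rewrite -[LHS]mulr1 -[X in _ * X]starK -starM mulr1 starK. Qed.
Lemma starA0 : star (0 : D) = 0.
Proof. by apply: (addrI (star 0)); rewrite -starD !addr0. Qed.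
Lemma star_sum (I : Type) (r : seq I) (F : I -> D) :
  star (\sum_(i <- r) F i) = \sum_(i <- r) star (F i).
Proof. by elim/big_rec2: _ => [|i x y _ <-]; rewrite ?starA0 ?starD. Qed.
End StarAlgebraTheory.

Lemma ImZ (R : realType) (t : R) (c : R[i]) :
  complex.Im (t%:C%C * c) = t * complex.Im c.
Proof. by case: c => a b /=; rewrite mul0r addr0. Qed.

Section PositiveSesquilinear.
Variables (R : realType) (V : lmodType R[i]) (s : V -> V -> R[i]).
Hypothesis s_l : forall w, linear_for *%R (fun v => s v w).
Hypothesis s_r : forall v c w w', s v (c *: w + w') = c^* * s v w + s v w'.
Hypothesis s_ge0 : forall v, 0 <= s v v.

(** Polarisation: s is real at c v + w for every c. Taking c = 1 makes the imaginary parts of s v w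
    and s w v opposite, and c = i makes the real parts equal. *)
Lemma sesquilinear_herm v w : s v w = (s w v)^*.
Proof.
have h (c : R[i]) : complex.Im (c * s v w) + complex.Im (c^* * s w v) = 0.
  have := (cge0P _).1 (s_ge0 (c *: v + w)); rewrite s_l !s_r => -[_].
  have [_ h1] := (cge0P _).1 (s_ge0 v); have [_ h2] := (cge0P _).1 (s_ge0 w).
  rewrite mulrDr mulrA conjM_cmod !raddfD /= => <-.
  by rewrite ImZ h1 h2 mulr0 addr0 add0r.
have := h 1; have := h 'i%C; rewrite rmorph1 !mul1r conjCE.
case: (s v w) (s w v) => a b [c d] /=; rewrite !mul0r !mul1r ?add0r ?addr0 ?oppr0 ?mulN1r.
by move=> h1 h2; apply/eqP; rewrite eq_complex /=; apply/andP; split; apply/eqP; lra.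
Qed.

Definition semi_inner_of : semi_inner V := SemiInner s_l sesquilinear_herm s_ge0.
End PositiveSesquilinear.

Section HilbertForm.
Variables (R : realType) (H : hilbertType R).

Fact inner_l (w : H) : linear_for *%R (fun v : H => inner v w).
Proof. by move=> c u v; rewrite innerDl innerZl. Qed.
Fact inner_ge0 (v : H) : 0 <= inner v v.
Proof. by rewrite inner_hnorm lecR sqr_ge0. Qed.

Definition hilbert_form : semi_inner H := SemiInner inner_l (@innerC R H) inner_ge0.

Lemma snorm_hilbert v : snorm hilbert_form v = hnorm v.
Proof. by rewrite /snorm /= inner_hnorm /= sqrtr_sqr ger0_norm ?hnorm_ge0. Qed.

Lemma hnormD (u v : H) : hnorm (u + v) <= hnorm u + hnorm v.
Proof. by rewrite -!snorm_hilbert snormD. Qed.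
Lemma hnormB (u v : H) : hnorm (u - v) = hnorm (v - u).
Proof. by rewrite -!snorm_hilbert snormB. Qed.
Lemma hnormZC c (v : H) : hnorm (c *: v) = cmod c * hnorm v.
Proof. by rewrite -!snorm_hilbert snormZ. Qed.
Lemma hnorm0 : hnorm (0 : H) = 0.
Proof. by rewrite -snorm_hilbert snorm0. Qed.
Lemma hnorm_eq0 (v : H) : hnorm v = 0 -> v = 0.
Proof. by move=> v0; apply/eqP; rewrite -normr_eq0 normE v0. Qed.
Lemma inner_CS (u v : H) : cmod (inner u v) <= hnorm u * hnorm v.
Proof. by rewrite -!snorm_hilbert; exact: sform_CS hilbert_form u v. Qed.

Lemma inner_star (T : 'B H) u v : inner (T u) v = inner u ((star T : 'B H) v).
Proof. exact: adjointE. Qed.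
Lemma inner_starl (T : 'B H) u v : inner ((star T : 'B H) u) v = inner u (T v).
Proof. by rewrite inner_star starK. Qed.

Lemma star_bound (T : 'B H) (K : R) : 0 <= K ->
  (forall v, hnorm (T v) <= K * hnorm v) ->
  forall v, hnorm ((star T : 'B H) v) <= K * hnorm v.
Proof.
move=> K0 TK v; set w := (star T : 'B H) v.
have [->|w0] := eqVneq (hnorm w) 0; first by rewrite mulr_ge0 ?hnorm_ge0.
have {}w0 : 0 < hnorm w by rewrite lt_def w0 hnorm_ge0.
rewrite -(ler_pM2l w0) -expr2 -rinner_hnorm /rinner -[X in inner _ X]/w {2}/w -inner_star.
by rewrite (le_trans (rinner_le _ _)) // mulrCA mulrA ler_wpM2r ?hnorm_ge0.
Qed.

Lemma opnorm_has_sup (T : 'B H) :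
  has_sup [set hnorm (T v) | v in [set v | hnorm v <= 1]].
Proof.
have [K K0 TK] := bop_bounded T; split.
  by exists (hnorm (T 0)), 0 => //=; rewrite hnorm0.
exists K => _ [v /= v1 <-]; rewrite (le_trans (TK v)) //.
by rewrite -[leRHS]mulr1 ler_wpM2l.
Qed.

Lemma opnorm_ge0 (T : 'B H) : 0 <= opnorm T.
Proof.
apply: (le_trans (hnorm_ge0 (T 0))); apply: (ub_le_sup (opnorm_has_sup T).2).
by exists 0 => //=; rewrite hnorm0.
Qed.

Lemma opnorm_bound (T : 'B H) v : hnorm (T v) <= opnorm T * hnorm v.
Proof.
have [v0|v0] := eqVneq (hnorm v) 0.
  by rewrite (hnorm_eq0 v0) linear0 hnorm0 mulr0.
have {}v0 : 0 < hnorm v by rewrite lt_def v0 hnorm_ge0.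
rewrite -ler_pdivrMr // mulrC.
have -> : (hnorm v)^-1 * hnorm (T v) = hnorm (T ((hnorm v)^-1%:C%C *: v)).
  by rewrite linearZ /= hnormZ ger0_norm // invr_ge0 ltW.
apply: (ub_le_sup (opnorm_has_sup T).2); exists ((hnorm v)^-1%:C%C *: v) => //=.
by rewrite hnormZ ger0_norm ?invr_ge0 ?(ltW v0) // mulVf // gt_eqF.
Qed.

Lemma opnorm_le (T : 'B H) (K : R) : 0 <= K ->
  (forall v, hnorm (T v) <= K * hnorm v) -> opnorm T <= K.
Proof.
move=> K0 TK; apply: ge_sup; first exact: (opnorm_has_sup T).1.
move=> _ [v /= v1 <-]; rewrite (le_trans (TK v)) //; have := hnorm_ge0 v; nra.
Qed.

End HilbertForm.

Section CompletionOperators.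
Variables (R : realType) (P : pre_hilbert R).
Local Notation V := (ph_space P).
Local Notation q := (ph_form P).
Local Notation j := (@completion_of R P).

(** The bound on t' works twice: precomposition with t' keeps a functional approximable, now by the
    vectors t (u n), and it is bounded by K on the completion. *)
Lemma completion_op (t t' : V -> V) (K : R) : 0 <= K ->
  (forall v w, q (t v) w = q v (t' w)) ->
  (forall z, snorm q (t' z) <= K * snorm q z) ->
  exists T : 'B (completion P), forall f z, T f z = f (t' z).
Proof.
move=> K0 tt' tK.
have ex (f : completion P) : exists g : completion P, forall z, g z = f (t' z).
  have [u fu] := completion_approx f.
  have gin : (fun z => f (t' z)) \in @completion_pred R P.
    apply/asboolP; exists (fun n => t (u n)) => e e0.
    have e'0 : 0 < e / (K + 1) by rewrite divr_gt0 // ltr_wpDl.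
    have [N hN] := fu _ e'0; exists N => n /hN h z.
    rewrite tt' (le_trans (h _)) // (le_trans (ler_wpM2l (ltW e'0) (tK z))) //.
    rewrite mulrA ler_wpM2r ?snorm_ge0 // mulrAC ler_pdivrMr ?ltr_wpDl //.
    by rewrite ler_pM2l // lerDl.
  by exists (Completion gin).
pose T f := projT1 (cid (ex f)).
have TE f z : T f z = f (t' z) by rewrite /T; case: cid.
have TL : linear T.
  by move=> c f g; apply: completion_ext => z; rewrite TE;
    change (c * f (t' z) + g (t' z) = c * T f z + T g z); rewrite !TE.
pose T' : {linear completion P -> completion P} :=
  HB.pack T (GRing.isLinear.Build R[i] _ _ *:%R T TL).
have TK (f : completion P) : hnorm (T' f) <= K * hnorm f.
  rewrite !hnorm_completion; apply: completion_snorm_le => [|z].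
    by rewrite mulr_ge0 ?snorm_ge0.
  rewrite /= TE -completion_form_of (le_trans (sform_CS _ _ _)) //.
  by rewrite snorm_completion_of [K * _]mulrC -mulrA ler_wpM2l ?snorm_ge0 ?tK.
by exists (Bop T' (bounded_continuous TK)).
Qed.

Lemma completion_op_of (t t' : V -> V) (T : 'B (completion P)) :
  (forall v w, q (t v) w = q v (t' w)) ->
  (forall f z, T f z = f (t' z)) -> forall v, T (j v) = j (t v).
Proof. by move=> tt' TE v; apply: completion_ext => z; rewrite TE /= tt'. Qed.

(** Density enters through adjoints instead of limits: the value of [star S] f at z is the inner
    product of f with S (j z), so [star S] and [star T] agree as functionals. *)
Lemma completion_op_eq (S T : 'B (completion P)) :
  (forall v, S (j v) = T (j v)) -> S = T.
Proof.
move=> ST; have STs : (star S : 'B (completion P)) = star T.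
  apply: bop_ext => f; apply: completion_ext => z.
  by rewrite -!completion_form_of -!inner_completion !inner_starl ST.
by rewrite -[S]starK STs starK.
Qed.

(** The common source of GNS representations, where t is left multiplication, and of the doubled
    representation. *)
Lemma completion_rep (D : starAlgType R) (t : D -> V -> V) :
  (forall x v w, q (t x v) w = q v (t (star x) w)) ->
  (forall x, exists2 K : R, 0 <= K & forall v, snorm q (t x v) <= K * snorm q v) ->
  (forall x y v, t (x * y) v = t x (t y v)) ->
  (forall v, t 1 v = v) ->
  (forall c x y v, t (c *: x + y) v = c *: t x v + t y v) ->
  exists pi : {lrmorphism D -> 'B (completion P)},
    star_preserving pi /\ forall x v, pi x (j v) = j (t x v).
Proof.
move=> tS tK tM t1 tL.
have ex x : exists T : 'B (completion P), forall f z, T f z = f (t (star x) z).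
  have [K K0 hK] := tK (star x).
  by apply: (@completion_op (t x) _ K) => // v w; rewrite tS.
pose pi x := projT1 (cid (ex x)).
have piE x f z : pi x f z = f (t (star x) z) by rewrite /pi; case: cid => T /= h; exact: h.
have pij x v : pi x (j v) = j (t x v).
  by apply: (@completion_op_of _ (t (star x))) => [w z|f z]; rewrite ?tS ?starK ?piE.
have piL : linear pi.
  move=> c x y; apply: completion_op_eq => v.
  by rewrite /= !pij tL completion_ofD.
have piM : GRing.monoid_morphism pi.
  split; first by apply: completion_op_eq => v; rewrite pij t1.
  by move=> x y; apply: completion_op_eq => v; rewrite pij tM /= !pij.
have piS x : pi (star x) = star (pi x).
  apply: bop_ext => g; apply: completion_ext => z; rewrite piE starK.
  rewrite -[RHS]completion_form_of -inner_completion inner_starl pij.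
  by rewrite inner_completion completion_form_of.
by exists (HB.pack pi (GRing.isLinear.Build R[i] D _ *:%R pi piL)
  (GRing.isMonoidMorphism.Build D _ pi piM) : {lrmorphism D -> 'B (completion P)}).
Qed.

End CompletionOperators.

Section GNS.
Variables (R : realType) (D : starAlgType R) (phi : {scalar D}).
Hypothesis phi_ge0 : forall x : D, 0 <= phi (star x * x).

Fact pos_form_l (w : D) : linear_for *%R (fun v : D => phi (star w * v)).
Proof. by move=> c u v; rewrite mulrDr -scalerAr linearP. Qed.
Fact pos_form_r (v : D) c (w w' : D) :
  phi (star (c *: w + w') * v) = c^* * phi (star w * v) + phi (star w' * v).
Proof. by rewrite starD starZ mulrDl -scalerAl linearP. Qed.

Definition pos_form : semi_inner D := semi_inner_of pos_form_l pos_form_r phi_ge0.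

Lemma pos_formE u v : pos_form u v = phi (star v * u). Proof. by []. Qed.

(** D is a bare star algebra, so boundedness of left multiplication has to be supplied; for Fermi
    tensor products [fermi_bounded] does this. The cyclic vector is the image of 1, and the orbit of
    it is the image of D, hence dense. *)
Lemma GNS_exists : phi 1 = 1 ->
  (forall x, exists2 K : R, 0 <= K &
    forall y, snorm pos_form (x * y) <= K * snorm pos_form y) ->
  exists (H : hilbertType R) (pi : {lrmorphism D -> 'B H}) (xi : H),
    is_GNS phi pi xi /\ forall y, hnorm (pi y xi) = snorm pos_form y.
Proof.
move=> phi1 phiK.
have nz : exists v, snorm pos_form v != 0.
  by exists 1; rewrite /snorm pos_formE mulr1 starA1 phi1 sqrtr1 oner_neq0.
pose P := PreHilbert nz.
have [|||||pi [piS pij]] := @completion_rep R P D (fun x y => x * y).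
- by move=> x v w; rewrite !pos_formE starM starK mulrA.
- exact: phiK.
- by move=> x y v; rewrite mulrA.
- by move=> v; rewrite mul1r.
- by move=> c x y v; rewrite mulrDl scalerAl.
have pi1 x : pi x (@completion_of R P 1) = @completion_of R P x by rewrite pij mulr1.
exists (completion P), pi, (@completion_of R P 1); split; last first.
  by move=> y; rewrite pi1 hnorm_completion snorm_completion_of.
split=> [//|x|].
  by rewrite pi1 inner_completion completion_form_ofof pos_formE starA1 mul1r.
move=> O [f Of] Oo; have := open_nbhs_nbhs (conj Oo Of).
move=> /nbhs_ballP [e /= e0 he].
have eR : e = (complex.Re e)%:C%C by rewrite RRe_real // gtr0_real.
have {}e0 : 0 < complex.Re e / 2 by rewrite divr_gt0 // -ltcR -eR.
have [v hv] := completion_dense f e0.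
exists (@completion_of R P v); split; last by exists v.
apply: he; rewrite -ball_normE /= completion_normE eR ltcR.
by rewrite (le_lt_trans hv) // ltr_pdivrMr // ltr_pMr ?ltr1n //; lra.
Qed.

End GNS.

(** * C*-algebras and von Neumann algebras *)

Section CStarAlgebras.
Variables (R : realType) (D : cstarAlgType R).
Implicit Types (a b s x y : D).

Lemma cnorm0 : cnorm (0 : D) = 0.
Proof. by rewrite -(scale0r 0) cnormZ normr0 mul0r. Qed.
Lemma cnormN x : cnorm (- x) = cnorm x.
Proof. by rewrite -scaleN1r cnormZ normrN1 mul1r. Qed.
Lemma cnorm_ge0 x : 0 <= cnorm x.
Proof. by have := cnormD x (- x); rewrite subrr cnorm0 cnormN; lra. Qed.
Lemma cnormZr (t : R) x : cnorm (t%:C%C *: x) = `|t| * cnorm x.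
Proof. by rewrite cnormZ -/(cmod _) cmodR. Qed.

Lemma cnorm_star_le x : cnorm x <= cnorm (star x).
Proof.
have [->|x0] := eqVneq (cnorm x) 0; first exact: cnorm_ge0.
have {}x0 : 0 < cnorm x by rewrite lt_def x0 cnorm_ge0.
by rewrite -(ler_pM2r x0) -expr2 -cnorm_star cnormM.
Qed.
Lemma cnorm_starE x : cnorm (star x) = cnorm x.
Proof.
by apply/le_anti; rewrite cnorm_star_le -{2}[x]starK cnorm_star_le.
Qed.

Lemma cnorm_small x : (forall e : R, 0 < e -> cnorm x <= e) -> x = 0.
Proof.
move=> h; apply: cnorm0_eq0; apply/le_anti; rewrite cnorm_ge0 andbT.
by apply/ler_addgt0Pr => e e0; rewrite add0r h.
Qed.

(* h = 1 - u where u is the fixed point of the contraction u |-> (s + u^2)/2 of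
   the ball of radius |s|. *)
Lemma cstar_sqrt s : star s = s -> cnorm s < 1 ->
  exists h, star h = h /\ h * h = 1 - s.
Proof.
move=> ss; set q := cnorm s => q1; have q0 : 0 <= q := cnorm_ge0 s.
pose F (u : D) : D := (2^-1)%:C%C *: (s + u * u).
pose u n := iter n F 0.
have uS n : u n.+1 = F (u n) by [].
have half x : cnorm ((2^-1)%:C%C *: x) = cnorm x / 2.
  by rewrite cnormZr ger0_norm ?invr_ge0 // mulrC.
have FB x y : F x - F y = (2^-1)%:C%C *: (x * (x - y) + (x - y) * y).
  rewrite /F -scalerBr; congr (_ *: _).
  by rewrite mulrBr mulrBl addrA subrK opprD addrACA subrr add0r.
have FK x y : cnorm (F x - F y) <= (cnorm x + cnorm y) / 2 * cnorm (x - y).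
  rewrite FB half mulrAC ler_wpM2r ?invr_ge0 //.
  rewrite (le_trans (cnormD _ _)) // [leRHS]mulrDl.
  by rewrite lerD // (le_trans (cnormM _ _)) // mulrC.
have uq n : cnorm (u n) <= q.
  elim: n => [|n IH]; first by rewrite /u /= cnorm0.
  rewrite uS half ler_pdivrMr // (le_trans (cnormD _ _)) //.
  rewrite mulrDr mulr1 lerD // (le_trans (cnormM _ _)) //.
  have := cnorm_ge0 (u n); nra.
have us n : star (u n) = u n.
  elim: n => [|n IH]; first by apply: cnorm0_eq0; rewrite cnorm_starE cnorm0.
  by rewrite uS /F starZ starD starM IH ss conjCE conjc_real.
have ud n k : cnorm (u (n + k)%N - u n) <= q ^+ n.
  elim: n => [|n IH].
    by rewrite add0n /u /= subr0 expr0 (le_trans (uq k)) // ltW.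
  rewrite addSn !uS exprS (le_trans (FK _ _)) // ler_pM ?cnorm_ge0 //.
    by rewrite divr_ge0 // addr_ge0 // cnorm_ge0.
  by have := uq n; have := uq (n + k)%N; lra.
have qn (e : R) : 0 < e -> exists N, q ^+ N < e.
  move=> e0; have /cvgrPdist_lt := @cvg_expr R q ltac:(by rewrite ger0_norm).
  move=> /(_ e e0) [N _ /(_ N (leqnn N))]; rewrite /= sub0r normrN.
  by rewrite ger0_norm ?exprn_ge0 //; exists N.
have [e e0|l hl] := @cnorm_complete R D u.
  have [N hN] := qn _ (divr_gt0 e0 (ltr0Sn R 1)); exists N => m n Nm Nn.
  have -> : u m - u n = (u m - u N) - (u n - u N) by rewrite opprB addrA subrK.
  have := ud N (m - N)%N; have := ud N (n - N)%N; rewrite !subnKC // => h1 h2.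
  rewrite (le_lt_trans (cnormD _ _)) // cnormN; lra.
have near (e : R) : 0 < e -> exists n, cnorm (u n - l) < e /\ cnorm (u n.+1 - l) < e.
  by move=> /hl[N hN]; exists N; split; apply: hN.
have ls : star l = l.
  apply/eqP; rewrite -subr_eq0; apply/eqP/cnorm_small => e e0.
  have [n [h _]] := near _ (divr_gt0 e0 (ltr0Sn R 1)).
  have -> : star l - l = (u n - l) - star (u n - l).
    have -> : star (u n - l) = u n - star l.
      by rewrite starB us.
    by rewrite opprB [RHS]addrC addrA subrK.
  rewrite (le_trans (cnormD _ _)) // cnormN cnorm_starE; lra.
have lF : l = F l.
  apply/eqP; rewrite -subr_eq0; apply/eqP/cnorm_small => e e0.
  have l0 := cnorm_ge0 l.
  have e'0 : 0 < e / (2 + cnorm l) by rewrite divr_gt0 // ltr_wpDr.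
  have [n [h1 h2]] := near _ e'0.
  have -> : l - F l = (F (u n) - F l) - (u n.+1 - l).
    by rewrite uS opprB [RHS]addrC addrA subrK.
  rewrite (le_trans (cnormD _ _)) // cnormN.
  have h3 := FK (u n) l.
  have h4 : (cnorm (u n) + cnorm l) / 2 * cnorm (u n - l) <= (1 + cnorm l) * (e / (2 + cnorm l)).
    rewrite ler_pM ?cnorm_ge0 ?(ltW h1) ?divr_ge0 ?addr_ge0 ?cnorm_ge0 //.
    have := uq n; lra.
  have : (2 + cnorm l) * (e / (2 + cnorm l)) = e by rewrite mulrC divfK // gt_eqF // ltr_wpDr.
  lra.
exists (1 - l); split.
  by rewrite starB starA1 ls.
have ll : l * l = l + l - s.
  rewrite {3 4}lF /F -scalerDl -rmorphD /=.
  have -> : 2^-1 + 2^-1 = 1 :> R by rewrite [RHS]splitr mul1r.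
  by rewrite scale1r addrAC subrr add0r.
rewrite mulrBl mul1r mulrBr mulr1 ll opprB.
have -> : l + l - s - l = l - s by rewrite addrAC addrK.
by rewrite addrA subrK.
Qed.

(** With K = |a| + 1 the element s = K^-2 [star a * a] has norm strictly below 1, and h is K times a
    square root of 1 - s. The conclusion mentions no norm, so it can be carried into a tensor
    product. *)
Lemma cstar_bound a : exists2 K : R, 0 <= K &
  exists h, (K ^+ 2)%:C%C *: 1 - star a * a = star h * h.
Proof.
have a0 := cnorm_ge0 a; pose K := cnorm a + 1.
have K0 : 0 < K by rewrite ltr_wpDl.
pose s := ((K ^+ 2)^-1)%:C%C *: (star a * a).
have ss : star s = s by rewrite /s starZ starM starK conjCE conjc_real.
have [|h [hs hh]] := @cstar_sqrt s ss.
  rewrite cnormZr cnorm_star ger0_norm ?invr_ge0 ?exprn_ge0 ?(ltW K0) //.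
  by rewrite mulrC ltr_pdivrMr ?exprn_gt0 // mul1r ltr_pXn2r ?nnegrE ?(ltW K0) // ltrDl.
exists K; first exact: ltW.
exists (K%:C%C *: h); rewrite starZ hs conjCE conjc_real -scalerAl -scalerAr hh scalerA.
rewrite -rmorphM /= -expr2 scalerBr /s scalerA -rmorphM /= divff ?scale1r //.
by rewrite expf_neq0 // gt_eqF.
Qed.

End CStarAlgebras.

Lemma hilbert_cauchy (R : realType) (H : hilbertType R) (u : nat -> H) :
  (forall e : R, 0 < e -> exists N, forall m n, (N <= m)%N -> (N <= n)%N ->
    hnorm (u m - u n) < e) ->
  exists l, forall e : R, 0 < e -> exists N, forall n, (N <= n)%N -> hnorm (u n - l) < e.
Proof.
move=> uc; have : cvg (u @ \oo).
  apply: cauchy_cvg; apply/cauchyP => e e0.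
  have eR : e = (complex.Re e)%:C%C by rewrite RRe_real // gtr0_real.
  have {}e0 : 0 < complex.Re e by rewrite -ltcR -eR.
  have [N hN] := uc _ e0.
  exists (u N); exists N => // n /= Nn.
  by rewrite -ball_normE /= normE eR ltcR hN.
move=> /cvgrPdist_lt h; exists (lim (u @ \oo)) => e e0.
have [|N _ hN] := h e%:C%C; first by rewrite ltcR.
by exists N => n /hN /=; rewrite normE ltcR hnormB.
Qed.

(** * Norm, completeness and positive elements of a von Neumann algebra *)

Section VonNeumannCStar.
Variables (R : realType) (H : hilbertType R) (M : gradedVonNeumann H).
Implicit Types r s : vn_sort M.

Definition vn_norm r : R := opnorm (vn_val r).

Lemma vn_norm_bound r v : hnorm (vn_val r v) <= vn_norm r * hnorm v.
Proof. exact: opnorm_bound. Qed.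

Lemma vn_norm_le r (K : R) : 0 <= K ->
  (forall v, hnorm (vn_val r v) <= K * hnorm v) -> vn_norm r <= K.
Proof. exact: opnorm_le. Qed.

Lemma vn_norm_ge0 r : 0 <= vn_norm r. Proof. exact: opnorm_ge0. Qed.

Fact vn_norm0_eq0 r : vn_norm r = 0 -> r = 0.
Proof.
move=> r0; apply: val_inj; apply: bop_ext => v; apply: hnorm_eq0.
by apply/le_anti; rewrite hnorm_ge0 andbT (le_trans (vn_norm_bound r v)) // r0 mul0r.
Qed.

Fact vn_normD r s : vn_norm (r + s) <= vn_norm r + vn_norm s.
Proof.
apply: vn_norm_le => [|v]; first by rewrite addr_ge0 ?vn_norm_ge0.
by rewrite /= (le_trans (hnormD _ _)) // mulrDl lerD ?vn_norm_bound.
Qed.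

Fact vn_normZ_le (c : R[i]) r : vn_norm (c *: r) <= cmod c * vn_norm r.
Proof.
apply: vn_norm_le => [|v]; first by rewrite mulr_ge0 ?cmod_ge0 ?vn_norm_ge0.
by rewrite /= hnormZC -mulrA ler_wpM2l ?cmod_ge0 ?vn_norm_bound.
Qed.

Fact vn_normZ (c : R[i]) r : vn_norm (c *: r) = complex.Re `|c| * vn_norm r.
Proof.
rewrite -/(cmod c); apply/le_anti; rewrite vn_normZ_le /=.
have [->|c0] := eqVneq c 0; first by rewrite cmod0 mul0r vn_norm_ge0.
have c1 : cmod c != 0 by apply: contra c0 => /eqP /cmod0_eq0 ->.
have := vn_normZ_le c^-1 (c *: r); rewrite scalerA mulVf // scale1r.
move=> /(ler_wpM2l (cmod_ge0 c)); rewrite mulrA -cmodM divff // cmodR.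
by rewrite normr1 mul1r.
Qed.

Fact vn_normM r s : vn_norm (r * s) <= vn_norm r * vn_norm s.
Proof.
apply: vn_norm_le => [|v]; first by rewrite mulr_ge0 ?vn_norm_ge0.
rewrite /= (le_trans (vn_norm_bound _ _)) // -mulrA.
by rewrite ler_wpM2l ?vn_norm_ge0 ?vn_norm_bound.
Qed.

Fact vn_norm_star r : vn_norm (star r * r) = vn_norm r ^+ 2.
Proof.
have r0 := vn_norm_ge0 r; have rr0 := vn_norm_ge0 (star r * r).
apply/le_anti/andP; split.
  rewrite (le_trans (vn_normM _ _)) // expr2 ler_wpM2r //.
  by apply: vn_norm_le => // v; apply: star_bound => // w; exact: vn_norm_bound.
rewrite -[leRHS]sqr_sqrtr // ler_pXn2r ?nnegrE ?sqrtr_ge0 //.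
apply: vn_norm_le => [|v]; first exact: sqrtr_ge0.
rewrite -(@ler_pXn2r _ 2) ?nnegrE ?mulr_ge0 ?hnorm_ge0 ?sqrtr_ge0 //.
rewrite exprMn sqr_sqrtr // -rinner_hnorm /rinner inner_star.
rewrite -/(rinner _ _) (le_trans (rinner_le _ _)) // mulrC expr2 mulrA.
by rewrite ler_wpM2r ?hnorm_ge0 //; exact: (vn_norm_bound (star r * r) v).
Qed.

Fact vn_norm_complete (u : nat -> vn_sort M) :
  (forall e : R, 0 < e ->
     exists N, forall m n, (N <= m)%N -> (N <= n)%N -> vn_norm (u m - u n) < e) ->
  exists l : vn_sort M, forall e : R, 0 < e ->
    exists N, forall n, (N <= n)%N -> vn_norm (u n - l) < e.
Proof.
move=> uc.
have ex v : exists l, forall e : R, 0 < e -> exists N, forall n, (N <= n)%N ->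
    hnorm (vn_val (u n) v - l) < e.
  apply: hilbert_cauchy => e e0; have v0 := hnorm_ge0 v.
  have e'0 : 0 < e / (hnorm v + 1) by rewrite divr_gt0 // ltr_wpDl.
  have [N hN] := uc _ e'0; exists N => m n Nm Nn.
  rewrite (le_lt_trans (vn_norm_bound (u m - u n) v)) //.
  rewrite (le_lt_trans (ler_wpM2r v0 (ltW (hN _ _ Nm Nn)))) //.
  by rewrite mulrAC ltr_pdivrMr ?ltr_wpDl // ltr_pM2l // ltrDl.
pose L v := projT1 (cid (ex v)).
have LP v (e : R) : 0 < e -> exists N, forall n, (N <= n)%N -> hnorm (vn_val (u n) v - L v) < e.
  by rewrite /L; case: cid => l h; exact: h.
have uL (e : R) : 0 < e -> exists N, forall n, (N <= n)%N ->
    forall v, hnorm (vn_val (u n) v - L v) <= e * hnorm v.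
  move=> /uc[N hN]; exists N => n Nn v; apply/ler_addgt0Pr => d d0.
  have [N' hN'] := LP v _ d0.
  have h1 := hN _ _ Nn (leq_maxl N N'); have h2 := hN' _ (leq_maxr N N').
  set m := maxn N N' in h1 h2.
  have -> : vn_val (u n) v - L v = vn_val (u n - u m) v + (vn_val (u m) v - L v).
    by rewrite /= addrA subrK.
  rewrite (le_trans (hnormD _ _)) // lerD //; last exact: ltW.
  rewrite (le_trans (vn_norm_bound (u n - u m) v)) //.
  by rewrite ler_wpM2r ?hnorm_ge0 // ltW.
have smallH (x : H) (K : R) : 0 <= K ->
    (forall e : R, 0 < e -> hnorm x <= K * e) -> x = 0.
  move=> K0 h; apply: hnorm_eq0; apply/le_anti; rewrite hnorm_ge0 andbT.
  apply/ler_addgt0Pr => e e0; rewrite add0r.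
  have e'0 : 0 < e / (K + 1) by rewrite divr_gt0 // ltr_wpDl.
  rewrite (le_trans (h _ e'0)) // mulrCA ger_pMr // ler_pdivrMr ?ltr_wpDl //.
  by rewrite mul1r lerDl.
have LL : linear L.
  move=> c v w; apply/eqP; rewrite -subr_eq0; apply/eqP.
  apply: (smallH _ (hnorm (c *: v + w) + cmod c * hnorm v + hnorm w)).
    by rewrite !addr_ge0 ?mulr_ge0 ?hnorm_ge0 ?cmod_ge0.
  move=> e /uL[N /(_ N (leqnn N)) h].
  have -> : L (c *: v + w) - (c *: L v + L w) =
    - (vn_val (u N) (c *: v + w) - L (c *: v + w)) +
    (c *: (vn_val (u N) v - L v) + (vn_val (u N) w - L w)).
    have E (a x y p q : H) : a - (p + q) = - (x + y - a) + ((x - p) + (y - q)).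
      by rewrite addrACA -opprD opprB addrA subrK.
    by rewrite linearP scalerBr -E.
  rewrite (le_trans (hnormD _ _)) // hnormN.
  have h1 := h (c *: v + w); have h2 := h v; have h3 := h w.
  have h4 := hnormD (c *: (vn_val (u N) v - L v)) (vn_val (u N) w - L w).
  rewrite hnormZC in h4; have := ler_wpM2l (cmod_ge0 c) h2; lra.
have [N1 hN1] := uL 1 ltr01.
pose L' : {linear H -> H} := HB.pack L (GRing.isLinear.Build R[i] H H *:%R L LL).
have LK v : hnorm (L' v) <= (vn_norm (u N1) + 1) * hnorm v.
  have -> : L' v = vn_val (u N1) v - (vn_val (u N1) v - L v) by rewrite subKr.
  rewrite (le_trans (hnormD _ _)) // hnormN mulrDl lerD ?vn_norm_bound //.
  by rewrite hN1.
pose T := Bop L' (bounded_continuous LK).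
(* The algebra is its own bicommutant, and commuting with a fixed S passes to the pointwise
   limit. *)
have Tin : T \in vn_pred M.
  apply/asboolP; rewrite -vn_bicommutant => S hS; apply: bop_ext => v.
  apply/eqP; rewrite -subr_eq0; apply/eqP.
  apply: (smallH _ (hnorm (S v) + opnorm S * hnorm v)).
    by rewrite !addr_ge0 ?mulr_ge0 ?hnorm_ge0 ?opnorm_ge0.
  move=> e /uL[N /(_ N (leqnn N)) h].
  have uS : S (vn_val (u N) v) = vn_val (u N) (S v).
    have : vn_set M (vn_val (u N)) by case: (u N) => t /= /asboolP.
    by move=> /hS E; have := congr1 (fun X : 'B H => X v) E.
  have -> : (T * S : 'B H) v - (S * T : 'B H) v =
     - (vn_val (u N) (S v) - L (S v)) + S (vn_val (u N) v - L v).
    have -> : S (vn_val (u N) v - L v) = vn_val (u N) (S v) - S (L v).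
      by rewrite linearB uS.
    by rewrite opprB addrA subrK.
  rewrite (le_trans (hnormD _ _)) // hnormN.
  have h1 := h (S v); have h2 := h v.
  have h3 := opnorm_bound S (vn_val (u N) v - L v).
  have := ler_wpM2l (opnorm_ge0 S) h2; lra.
exists (VnElement Tin) => e e0.
have [N hN] := uL (e / 2) ltac:(by rewrite divr_gt0); exists N => n /hN h.
rewrite (@le_lt_trans _ _ (e / 2)) //; last by rewrite ltr_pdivrMr // ltr_pMr ?ltr1n.
by apply: vn_norm_le => [|v]; [rewrite divr_ge0 // ltW | exact: h].
Qed.

HB.instance Definition _ := isCStarAlgebra.Build R (vn_sort M)
  vn_norm0_eq0 vn_normD vn_normZ vn_normM vn_norm_star vn_norm_complete.

(** Since 0 <= S <= K, the element s = 1 - (S + e)/(K + e) lies between 0 and k = 1 - e/(K + e). The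
    shift by e makes k < 1, so 1 - s has a square root in the algebra, and h is that root times the
    square root of K + e. *)
Lemma vn_positive (S : vn_sort M) : (forall v, 0 <= inner (vn_val S v) v) ->
  forall e : R, 0 < e -> exists h : vn_sort M, S + e%:C%C *: 1 = star h * h.
Proof.
move=> S0 e e0; set K := vn_norm S; have K0 : 0 <= K := vn_norm_ge0 S.
pose L := K + e; have L0 : 0 < L by rewrite ltr_wpDl.
have AE v : inner (vn_val S v) v = (rinner (vn_val S v) v)%:C%C by exact: cge0_Re.
have A0 v : 0 <= rinner (vn_val S v) v by exact: cge0_ReE.
have AK v : rinner (vn_val S v) v <= K * hnorm v ^+ 2.
  by rewrite (le_trans (rinner_le _ _)) // expr2 mulrA ler_wpM2r ?hnorm_ge0 ?vn_norm_bound.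
have SS : star S = S.
  apply: val_inj; apply: adjointP => x y; rewrite [RHS]innerC.
  apply: (@sesquilinear_herm R H (fun u v => inner (vn_val S u) v)) => // [w c u v|v c w w'].
    by rewrite linearP innerDl innerZl.
  by rewrite innerDr innerZr.
pose s : vn_sort M := 1 - (L^-1)%:C%C *: (S + e%:C%C *: 1).
have sE v : inner (vn_val s v) v =
    (hnorm v ^+ 2 - L^-1 * (rinner (vn_val S v) v + e * hnorm v ^+ 2))%:C%C.
  rewrite /= innerBl innerZl innerDl innerZl inner_hnorm AE.
  by rewrite !(rmorphB, rmorphM, rmorphD, rmorphXn).
have LL : L^-1 * L = 1 by rewrite mulVf // gt_eqF.
have Li0 : 0 < L^-1 by rewrite invr_gt0.
pose k := 1 - L^-1 * e.
have k1 : k < 1 by rewrite /k gtrBl mulr_gt0.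
have k0 : 0 <= k.
  by rewrite /k subr_ge0 -LL ler_pM2l // lerDr.
have s0 v : 0 <= inner (vn_val s v) v.
  rewrite sE lecR subr_ge0 -[leRHS]mul1r -LL -mulrA ler_pM2l // /L mulrDl.
  by rewrite lerD2r AK.
have sk v : complex.Re (inner (vn_val s v) v) <= k * hnorm v ^+ 2.
  rewrite sE /= /k mulrBl mul1r lerD2l lerN2 -mulrA ler_pM2l // lerDr.
  exact: A0.
have fl w : linear_for *%R (fun v => inner (vn_val s v) w).
  by move=> c u v; rewrite linearP innerDl innerZl.
have fr v c w w' : inner (vn_val s v) (c *: w + w') =
    c^* * inner (vn_val s v) w + inner (vn_val s v) w' by rewrite innerDr innerZr.
pose q := semi_inner_of fl fr s0.
have qn v : snorm q v ^+ 2 <= k * hnorm v ^+ 2 by rewrite snorm_sqr; exact: sk.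
have sn : cnorm s <= k.
  apply: vn_norm_le => // v.
  (* |s v|^2 is the value at (v, s v) of the form defined by s. Cauchy-Schwarz for this form, with
     [qn] for both factors, bounds it by k |v| |s v|. *)
  have h : hnorm (vn_val s v) ^+ 2 <= snorm q v * snorm q (vn_val s v).
    by rewrite -rinner_hnorm; exact: Re_sform_le q v (vn_val s v).
  move: h (qn v) (qn (vn_val s v)) (snorm_ge0 q v) (snorm_ge0 q (vn_val s v)).
  move: (hnorm_ge0 v) (hnorm_ge0 (vn_val s v)).
  move: (snorm q v) (snorm q (vn_val s v)) (hnorm v) (hnorm (vn_val s v)).
  move=> x y a b a0 b0 h h1 h2 x0 y0.
  have [->|bn0] := eqVneq b 0; first by rewrite mulr_ge0.
  have {}bn0 : 0 < b by rewrite lt_def bn0.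
  rewrite -(@ler_pXn2r _ 2) ?nnegrE ?mulr_ge0 //.
  rewrite -(@ler_pM2l _ (b ^+ 2)) ?exprn_gt0 //.
  have h3 : (b ^+ 2) ^+ 2 <= (x * y) ^+ 2 by rewrite ler_pXn2r ?nnegrE ?exprn_ge0 ?mulr_ge0.
  rewrite -expr2 (le_trans h3) // exprMn.
  have -> : b ^+ 2 * (k * a) ^+ 2 = (k * a ^+ 2) * (k * b ^+ 2) by ring.
  by rewrite ler_pM ?sqr_ge0.
have ss : star s = s.
  by rewrite /s starB starA1 starZ starD SS starZ starA1 !conjCE !conjc_real.
have [h [hs hh]] := cstar_sqrt ss (le_lt_trans sn k1).
exists ((Num.sqrt L)%:C%C *: h); rewrite starZ hs conjCE conjc_real.
rewrite -scalerAl -scalerAr scalerA hh -rmorphM /= -expr2 sqr_sqrtr ?(ltW L0) //.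
by rewrite /s subKr scalerA -rmorphM /= mulrC LL scale1r.
Qed.

End VonNeumannCStar.

(** * Product states and the norms on a Fermi tensor product *)

(** The norm of the vector of y in a GNS space of phi, available without choosing a GNS triple. *)
Definition fnorm (R : realType) (D : starAlgType R) (phi : D -> R[i]) (y : D) : R :=
  Num.sqrt (complex.Re (phi (star y * y))).

Definition is_positive (R : realType) (D : starAlgType R) (phi : D -> R[i]) : Prop :=
  forall x, 0 <= phi (star x * x).

Section PositiveFunctionals.
Variables (R : realType) (D : starAlgType R) (phi : {scalar D}).
Hypothesis phi0 : is_positive phi.
Implicit Types x y : D.

Lemma fnormE y : fnorm phi y = snorm (pos_form phi0) y. Proof. by []. Qed.
Lemma fnorm_ge0 y : 0 <= fnorm phi y. Proof. exact: sqrtr_ge0. Qed.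
Lemma fnormD x y : fnorm phi (x + y) <= fnorm phi x + fnorm phi y.
Proof. by rewrite !fnormE snormD. Qed.
Lemma fnormN x : fnorm phi (- x) = fnorm phi x.
Proof. by rewrite !fnormE snormN. Qed.
Lemma fnorm_sqr y : fnorm phi y ^+ 2 = complex.Re (phi (star y * y)).
Proof. by rewrite fnormE snorm_sqr. Qed.
Lemma fnorm_sqrC y : phi (star y * y) = (fnorm phi y ^+ 2)%:C%C.
Proof. by rewrite fnormE -sform_snorm. Qed.
Lemma fnorm_CS x y : complex.Re (phi (star y * x)) <= fnorm phi x * fnorm phi y.
Proof. by rewrite !fnormE; exact: (Re_sform_le (pos_form phi0) x y). Qed.
End PositiveFunctionals.

Lemma GNS_fnorm (R : realType) (D : starAlgType R) (phi : D -> R[i])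
    (H : hilbertType R) (pi : {lrmorphism D -> 'B H}) (xi : H) y :
  is_GNS phi pi xi -> hnorm (pi y xi) = fnorm phi y.
Proof.
move=> [piS phiE _]; rewrite /fnorm phiE rmorphM /= piS inner_starl inner_hnorm /=.
by rewrite sqrtr_sqr ger0_norm ?hnorm_ge0.
Qed.

Section TensorProductRules.
Variables (R : realType) (D1 D2 : gradedStarAlgType R).
Local Notation T := (fermi_tensor D1 D2).
Implicit Types (a s t : D1) (b : D2) (x y : T).
Let tb := tens_bilin D1 D2.

Lemma homogeneous_ind (D : gradedStarAlgType R) (P : D -> Prop) :
  (forall i (x : D), homogeneous i x -> P x) ->
  (forall x y : D, P x -> P y -> P (x + y)) -> forall x : D, P x.
Proof.
by move=> Ph PD x; rewrite (hpart_sum x); apply: PD; apply: Ph; exact: hpart_homogeneous.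
Qed.

Lemma fermi1E : (1 : T) = tens 1 1. Proof. by []. Qed.

Lemma tensDl a a' b : (tens (a + a') b : T) = tens a b + tens a' b.
Proof. exact: (bilinDl tb). Qed.
Lemma tensDr a b b' : (tens a (b + b') : T) = tens a b + tens a b'.
Proof. exact: (bilinDr tb). Qed.
Lemma tensZl c a b : (tens (c *: a) b : T) = c *: (tens a b : T).
Proof. exact: (bilinZl tb). Qed.
Lemma tensZr c a b : (tens a (c *: b) : T) = c *: (tens a b : T).
Proof. exact: (bilinZr tb). Qed.

Lemma tensBl a a' b : (tens (a - a') b : T) = tens a b - tens a' b.
Proof. by rewrite tensDl -scaleN1r tensZl scaleN1r. Qed.
Lemma tensBr a b b' : (tens a (b - b') : T) = tens a b - tens a b'.
Proof. by rewrite tensDr -scaleN1r tensZr scaleN1r. Qed.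

Lemma tensM_evenl (a1 b1 : D1) (a2 b2 : D2) : homogeneous false a2 ->
  (tens a1 a2 : T) * tens b1 b2 = tens (a1 * b1) (a2 * b2).
Proof.
move=> h2; elim/homogeneous_ind: b1 => [i b1 h1|b1 b1' IH IH'].
  by rewrite (tensM_homogeneous _ _ h2 h1) /= expr0 scale1r.
by rewrite mulrDr !tensDl mulrDr IH IH'.
Qed.

Lemma tensM_evenr (a1 b1 : D1) (a2 b2 : D2) : homogeneous false b1 ->
  (tens a1 a2 : T) * tens b1 b2 = tens (a1 * b1) (a2 * b2).
Proof.
move=> h1; elim/homogeneous_ind: a2 => [i a2 h2|a2 a2' IH IH'].
  by rewrite (tensM_homogeneous _ _ h2 h1) andbF expr0 scale1r.
by rewrite mulrDl !tensDr mulrDl IH IH'.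
Qed.

Lemma tens_factor a b : (tens a b : T) = (tens a 1 : T) * (tens 1 b : T).
Proof. by rewrite tensM_evenl ?mulr1 ?mul1r //; exact: homogeneous1. Qed.

Lemma star_tens_evenl a b : homogeneous false a ->
  star (tens a b : T) = tens (star a) (star b).
Proof.
move=> h1; elim/homogeneous_ind: b => [i b h2|b b' IH IH'].
  by rewrite (star_tens_homogeneous h1 h2) /= expr0 scale1r.
by rewrite tensDr !starD IH IH' tensDr.
Qed.

Lemma star_tens_evenr a b : homogeneous false b ->
  star (tens a b : T) = tens (star a) (star b).
Proof.
move=> h2; elim/homogeneous_ind: a => [i a h1|a a' IH IH'].
  by rewrite (star_tens_homogeneous h1 h2) andbF expr0 scale1r.
by rewrite tensDl !starD IH IH' tensDl.
Qed.

Lemma star_tens1 a : star (tens a 1 : T) = tens (star a) 1.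
Proof. by rewrite star_tens_evenr ?starA1 //; exact: homogeneous1. Qed.
Lemma star_1tens b : star (tens 1 b : T) = tens 1 (star b).
Proof. by rewrite star_tens_evenl ?starA1 //; exact: homogeneous1. Qed.
Lemma tens1M a a' : (tens a 1 : T) * tens a' 1 = tens (a * a') 1.
Proof. by rewrite tensM_evenl ?mulr1 //; exact: homogeneous1. Qed.
Lemma tensM1 b b' : (tens 1 b : T) * tens 1 b' = tens 1 (b * b').
Proof. by rewrite tensM_evenr ?mulr1 //; exact: homogeneous1. Qed.

End TensorProductRules.

(** * Uniform bounds for positive functionals and representations *)

Section UniformBound.
Variables (R : realType) (D1 D2 : gradedCstarAlgType R).
Local Notation T := (fermi_tensor D1 D2).

(** The order of quantifiers matters: one K for all phi is what makes the sets defining the norms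
    bounded. *)
Let bounded (x : T) := exists2 K : R, 0 <= K &
  forall phi : {scalar T}, is_positive phi -> forall y, fnorm phi (x * y) <= K * fnorm phi y.

Let boundedM x y : bounded x -> bounded y -> bounded (x * y).
Proof.
move=> [K K0 hK] [L L0 hL]; exists (K * L); first exact: mulr_ge0.
move=> phi phi0 z; rewrite -!mulrA (le_trans (hK _ phi0 _)) //.
by rewrite ler_wpM2l // hL.
Qed.

(** Placed between [star y] and y and evaluated by phi, the identity reads K^2 |y|^2 - |x y|^2 = |h
    y|^2. *)
Let bounded_of (x h : T) (K : R) : 0 <= K ->
  (K ^+ 2)%:C%C *: 1 - star x * x = star h * h -> bounded x.
Proof.
move=> K0 xh; exists K => // phi phi0 y.
rewrite -(@ler_pXn2r _ 2) ?nnegrE ?mulr_ge0 ?fnorm_ge0 // exprMn.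
have := cge0_ReE (phi0 (h * y)).
rewrite starM mulrA -(mulrA (star y)) -xh mulrBr mulrBl -scalerAr -scalerAl mulr1.
rewrite linearB linearZ /= ReB ReZ -(fnorm_sqr phi0).
have -> : star y * (star x * x) * y = star (x * y) * (x * y).
  by rewrite starM !mulrA.
by rewrite -(fnorm_sqr phi0) subr_ge0.
Qed.

(* In a C*-algebra K^2 - star a * a is some star h * h, so K is independent of
   phi and y. *)
Lemma fermi_bounded (x : T) : exists2 K : R, 0 <= K &
  forall phi : {scalar T}, is_positive phi -> forall y, fnorm phi (x * y) <= K * fnorm phi y.
Proof.
rewrite -/(bounded x); elim/tensor_ind: x => [a b|x y [K K0 hK] [L L0 hL]].
  rewrite tens_factor; apply: boundedM.
    have [K K0 [h hh]] := cstar_bound a; apply: (@bounded_of _ (tens h 1) K K0).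
    by rewrite !star_tens1 !tens1M -hh tensBl tensZl.
  have [K K0 [h hh]] := cstar_bound b; apply: (@bounded_of _ (tens 1 h) K K0).
  by rewrite !star_1tens !tensM1 -hh tensBr tensZr.
exists (K + L); first exact: addr_ge0.
move=> phi phi0 z; rewrite mulrDl (le_trans (fnormD phi0 _ _)) // mulrDl.
by rewrite lerD ?hK ?hL.
Qed.

Lemma fermi_GNS (phi : {scalar T}) : is_state phi ->
  exists (H : hilbertType R) (pi : {lrmorphism T -> 'B H}) (xi : H), is_GNS phi pi xi.
Proof.
move=> [phi0 phi1].
have [|H [pi [xi [h _]]]] := @GNS_exists R T phi phi0 phi1; last by exists H, pi, xi.
by move=> x; have [K K0 hK] := fermi_bounded x; exists K => // y; exact: (hK phi phi0).
Qed.

End UniformBound.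

Section VectorFunctional.
Variables (R : realType) (D : starAlgType R) (H : hilbertType R).
Variables (pi : {lrmorphism D -> 'B H}) (xi : H).
Hypothesis piS : star_preserving pi.

Fact vector_functional_linear : linear_for *%R (fun x : D => inner (pi x xi) xi).
Proof. by move=> c x y; rewrite linearP /= innerDl innerZl. Qed.
Definition vector_functional : {scalar D} :=
  HB.pack (fun x : D => inner (pi x xi) xi)
    (GRing.isLinear.Build R[i] D R[i] *%R _ vector_functional_linear).

Lemma vector_functional_inner x y :
  vector_functional (star y * x) = inner (pi x xi) (pi y xi).
Proof. by rewrite /= rmorphM /= piS inner_starl. Qed.

Lemma vector_functional_ge0 : is_positive vector_functional.
Proof. by move=> x; rewrite vector_functional_inner; exact: inner_ge0. Qed.

Lemma vector_functional_fnorm y : fnorm vector_functional y = hnorm (pi y xi).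
Proof.
by rewrite /fnorm vector_functional_inner inner_hnorm /= sqrtr_sqr ger0_norm ?hnorm_ge0.
Qed.
End VectorFunctional.

(** For the vector functional of v and y = 1, the uniform bound becomes |pi(x) v| <= K |v|, with the
    same K for every representation. *)
Lemma fermi_rep_bounded (R : realType) (D1 D2 : gradedCstarAlgType R)
    (x : fermi_tensor D1 D2) : exists2 K : R, 0 <= K &
  forall (H : hilbertType R) (pi : {lrmorphism fermi_tensor D1 D2 -> 'B H}),
    star_preserving pi -> opnorm (pi x) <= K.
Proof.
have [K K0 hK] := fermi_bounded x; exists K => // H pi piS.
apply: opnorm_le => // v.
have := hK _ (vector_functional_ge0 v piS) 1.
by rewrite !vector_functional_fnorm // mulr1 rmorph1.
Qed.

(** * Positivity of product functionals *)

Section SchurProduct.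
Variables (R : realType) (V W : lmodType R[i]) (p : semi_inner V) (q : semi_inner W).

(* Gram-Schmidt: subtract from every second component its projection on w. *)
Lemma schur_product_ge0 (s : seq (V * W)) :
  0 <= \sum_(x <- s) \sum_(y <- s) p x.1 y.1 * q x.2 y.2.
Proof.
have [n] := ubnP (size s); elim: n s => // n IH [|[v w] s] /= ss.
  by rewrite big_nil.
pose A := \sum_(y <- s) p v y.1 * q w y.2.
pose B := \sum_(x <- s) p x.1 v * q x.2 w.
pose C := \sum_(x <- s) \sum_(y <- s) p x.1 y.1 * q x.2 y.2.
have -> : \sum_(x <- (v, w) :: s) \sum_(y <- (v, w) :: s) p x.1 y.1 * q x.2 y.2 =
    p v v * q w w + A + (B + C).
  rewrite big_cons big_cons /=; congr (_ + _).
  by rewrite -big_split; apply: eq_bigr => x _; rewrite big_cons.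
have [w0|w0] := eqVneq (snorm q w) 0.
  have qw y : q w y = 0.
    by apply: cmod0_eq0; apply/le_anti; rewrite cmod_ge0 (le_trans (sform_CS _ _ _)) // w0 mul0r.
  have -> : A = 0 by apply: big1_seq => y _; rewrite qw mulr0.
  have qw' y : q y w = 0 by rewrite sform_herm qw rmorph0.
  have -> : B = 0 by apply: big1_seq => y _; rewrite qw' mulr0.
  by rewrite qw mulr0 !add0r; apply: IH.
have qw0 : q w w != 0.
  by rewrite sform_snorm; apply: contra w0 => /eqP /complexI /eqP; rewrite sqrf_eq0.
pose c (y : W) := q y w / q w w.
pose v' := v + \sum_(x <- s) c x.2 *: x.1.
pose s' := [seq (x.1, x.2 - c x.2 *: w) | x <- s].
have qyw y : q y w = c y * q w w by rewrite /c divfK.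
have qwy y : q w y = (c y)^* * q w w.
  by rewrite sform_herm qyw rmorphM /= -sform_herm.
have -> : p v v * q w w + A + (B + C) = p v' v' * q w w +
    \sum_(x <- s') \sum_(y <- s') p x.1 y.1 * q x.2 y.2.
  have -> : p v' v' = p v v + \sum_(y <- s) (c y.2)^* * p v y.1 +
     (\sum_(x <- s) c x.2 * p x.1 v +
      \sum_(x <- s) \sum_(y <- s) c x.2 * (c y.2)^* * p x.1 y.1).
    rewrite /v' sformDl !sformDr !sform_suml !sform_sumr; congr (_ + _ + (_ + _)).
    - by apply: eq_bigr => y _; rewrite sformZr.
    - by apply: eq_bigr => y _; rewrite sformZl.
    - apply: eq_bigr => x _; rewrite sform_sumr; apply: eq_bigr => y _.
      by rewrite sformZl sformZr mulrA.
  rewrite !mulrDl -!addrA; congr (_ + _); congr (_ + _).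
    by rewrite mulr_suml; apply: eq_bigr => y _; rewrite qwy; ring.
  congr (_ + _).
    by rewrite mulr_suml; apply: eq_bigr => y _; rewrite qyw; ring.
  rewrite mulr_suml big_map -big_split; apply: eq_bigr => x _ /=.
  rewrite mulr_suml big_map -big_split; apply: eq_bigr => y _ /=.
  rewrite sformBl !sformBr !sformZl !sformZr (qyw x.2) (qwy y.2); ring.
rewrite addr_ge0 ?mulr_ge0 ?sform_ge0 //.
by apply: IH; rewrite size_map.
Qed.

End SchurProduct.

Section ProductFunctional.
Variables (R : realType) (D1 D2 : gradedStarAlgType R).
Local Notation T := (fermi_tensor D1 D2).
Variables (w1 : {scalar D1}) (w2 : {scalar D2}).

Lemma even_odd0 (D : gradedStarAlgType R) (w : {scalar D}) x :
  is_even w -> homogeneous true x -> w x = 0.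
Proof.
move=> we hx; have := we x; rewrite hx expr1 scaleN1r linearN => /eqP.
by rewrite -subr_eq0 -opprD oppr_eq0 -mulr2n mulrn_eq0 /= => /eqP.
Qed.

Fact prod_functional_linear : linear_for *%R (prod_functional w1 w2 : T -> R[i]).
Proof.
move=> c x y; apply: (@tensor_lift_linear _ _ _ R[i]^o (fun a b => w1 a * w2 b)).
split=> [b d a a'|a d b b'] /=; rewrite linearP /=.
- by rewrite mulrDl -mulrA.
- by rewrite mulrDr mulrCA.
Qed.
Definition prod_scalar : {scalar T} := HB.pack (prod_functional w1 w2 : T -> R[i])
  (GRing.isLinear.Build R[i] T R[i] *%R _ prod_functional_linear).

Lemma prod_scalar_tens a b : prod_scalar (tens a b) = w1 a * w2 b.
Proof. exact: prod_functional_tens. Qed.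

Hypothesis w1e : is_even w1.
Hypothesis w2e : is_even w2.

(** Evenness of w1 leaves only the case where s and t have the same grade; then the sign of the star
    and the sign of the product cancel. The form of a product functional is therefore the ordinary
    tensor product of the two forms, to which [schur_product_ge0] applies. *)
Lemma prod_scalar_inner s t a b :
  prod_scalar (star (tens s a : T) * tens t b) = w1 (star s * t) * w2 (star a * b).
Proof.
elim/homogeneous_ind: s => [i s hs|s s' IH IH']; last first.
  by rewrite tensDl !starD !mulrDl !linearD IH IH' mulrDl.
elim/homogeneous_ind: t => [j t ht|t t' IH IH']; last first.
  by rewrite tensDl !mulrDr !linearD IH IH' mulrDl.
elim/homogeneous_ind: a => [k a ha|a a' IH IH']; last first.
  by rewrite tensDr !starD !mulrDl !linearD IH IH' mulrDr.
elim/homogeneous_ind: b => [l b hb|b b' IH IH']; last first.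
  by rewrite tensDr !mulrDr !linearD IH IH' mulrDr.
rewrite (star_tens_homogeneous hs ha) -scalerAl.
rewrite (tensM_homogeneous _ _ (homogeneous_star ha) ht) scalerA linearZ /=.
rewrite prod_functional_tens.
have := homogeneousM (homogeneous_star hs) ht.
have := homogeneousM (homogeneous_star ha) hb.
case: (i =P j) => [->|ij]; last first.
  have -> : i (+) j = true by case: i j ij {hs ht} => [] [].
  by move=> _ /(even_odd0 w1e) ->; rewrite !mul0r mulr0.
case: (k =P l) => [->|kl]; last first.
  have -> : k (+) l = true by case: k l kl {ha hb} => [] [].
  by move=> /(even_odd0 w2e) ->; rewrite !mulr0.
by move=> _ _; rewrite andbC -signr_addb addbb expr0 mul1r.
Qed.

Hypothesis w1p : is_positive w1.
Hypothesis w2p : is_positive w2.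

Lemma prod_scalar_ge0 : is_positive prod_scalar.
Proof.
move=> x; have := schur_product_ge0 (pos_form w1p) (pos_form w2p) (repr x).
congr (_ <= _).
have -> : star x * x = \sum_(p <- repr x) \sum_(r <- repr x)
    star (tens r.1 r.2 : T) * (tens p.1 p.2 : T).
  rewrite {2}[x]tensor_sum mulr_sumr; apply: eq_bigr => p _.
  by rewrite {1}[x]tensor_sum star_sum mulr_suml.
rewrite linear_sum; apply: eq_bigr => p _; rewrite linear_sum; apply: eq_bigr => r _.
by rewrite prod_scalar_inner.
Qed.

End ProductFunctional.

Lemma prod_scalar_state (R : realType) (D1 D2 : gradedStarAlgType R)
    (w1 : {scalar D1}) (w2 : {scalar D2}) :
  is_state w1 /\ is_even w1 -> is_state w2 /\ is_even w2 ->
  is_state (prod_scalar w1 w2).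
Proof.
move=> [[p1 n1] e1] [[p2 n2] e2]; split; first exact: prod_scalar_ge0.
by rewrite fermi1E prod_scalar_tens n1 n2 mulr1.
Qed.

(** * Bounds for the minimal and maximal norms *)

Section NormCharacterizations.
Variable R : realType.

(** The condition 0 <= c takes care of the empty set, whose [sup] is 0. *)
Lemma sup_le_bound (S : set R) (c : R) : 0 <= c -> (forall r, S r -> r <= c) -> sup S <= c.
Proof.
move=> c0 Sc; have [->|/set0P S0] := eqVneq S set0; first by rewrite sup0.
exact: ge_sup.
Qed.

Lemma sup_nonneg (S : set R) : (forall r, S r -> 0 <= r) -> 0 <= sup S.
Proof.
move=> S0; have [hS|hS] := pselect (has_sup S); last by rewrite sup_out.
have [r Sr] := hS.1; exact: le_trans (S0 _ Sr) (ub_le_sup hS.2 Sr).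
Qed.

Lemma min_norm_ge0 (D1 D2 : gradedStarAlgType R) (x : fermi_tensor D1 D2) : 0 <= min_norm x.
Proof.
by apply: sup_nonneg => _ [w1 [w2 [H [pi [xi [_ _ _ ->]]]]]]; exact: opnorm_ge0.
Qed.

Lemma max_norm_ge0 (D1 D2 : gradedStarAlgType R) (x : fermi_tensor D1 D2) : 0 <= max_norm x.
Proof. by apply: sup_nonneg => _ [H [pi [_ ->]]]; exact: opnorm_ge0. Qed.

Lemma opnorm_dense_le (H : hilbertType R) (T : 'B H) (S : set H) (c : R) :
  0 <= c -> dense S -> (forall v, S v -> hnorm (T v) <= c * hnorm v) -> opnorm T <= c.
Proof.
move=> c0 Sd hS; apply: opnorm_le => // v; apply/ler_addgt0Pr => e e0.
have k0 := opnorm_ge0 T.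
have d0 : 0 < e / (opnorm T + c + 1) by rewrite divr_gt0 // ltr_wpDl // addr_ge0.
have [u [ub Su]] : (ball v (e / (opnorm T + c + 1))%:C%C `&` S) !=set0.
  apply: Sd; first by exists v; apply: ballxx; rewrite ltcR.
  exact: ball_open.
move: ub; rewrite -ball_normE /= normE ltcR; set d := e / _ => vu.
have -> : T v = T (v - u) + T u by rewrite -linearD subrK.
rewrite (le_trans (hnormD _ _)) //.
have h1 := opnorm_bound T (v - u); have h2 := hS _ Su.
have h3 : hnorm u <= hnorm v + hnorm (v - u).
  have -> : u = v - (v - u) by rewrite subKr.
  by rewrite (le_trans (hnormD _ _)) // hnormN subKr.
have h4 : d * (opnorm T + c + 1) = e by rewrite /d divfK // gt_eqF // ltr_wpDl // addr_ge0.
have h5 := ler_wpM2l k0 (ltW vu); have h6 := ler_wpM2l c0 h3.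
have h7 := ler_wpM2l c0 (ltW vu); nra.
Qed.

(** The vectors pi(y) xi are dense, so an operator bound for pi(x) can be tested on them, where it
    is an inequality between values of [fnorm]. *)
Lemma min_norm_le (D1 D2 : gradedStarAlgType R) (x : fermi_tensor D1 D2) (c : R) :
  0 <= c ->
  (forall (w1 : {scalar D1}) (w2 : {scalar D2}),
     is_state w1 /\ is_even w1 -> is_state w2 /\ is_even w2 ->
     forall y, fnorm (prod_scalar w1 w2) (x * y) <= c * fnorm (prod_scalar w1 w2) y) ->
  min_norm x <= c.
Proof.
move=> c0 h; apply: sup_le_bound => // _ [w1 [w2 [H [pi [xi [s1 s2 g ->]]]]]].
have [_ _ gd] := g; apply: (opnorm_dense_le c0 gd) => _ [y _ <-].
rewrite (GNS_fnorm y g).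
have -> : pi x (pi y xi) = pi (x * y) xi by rewrite rmorphM.
by rewrite (GNS_fnorm _ g); exact: h.
Qed.

Variables D1 D2 : gradedCstarAlgType R.
Implicit Types x : fermi_tensor D1 D2.

Lemma max_norm_ub x (H : hilbertType R) (pi : {lrmorphism fermi_tensor D1 D2 -> 'B H}) :
  star_preserving pi -> opnorm (pi x) <= max_norm x.
Proof.
move=> piS; have [K K0 hK] := fermi_rep_bounded x.
apply: ub_le_sup; last by exists H, pi.
by exists K => _ [H' [pi' [pi'S ->]]]; exact: hK.
Qed.

Lemma min_norm_ub x (w1 : {scalar D1}) (w2 : {scalar D2}) y :
  is_state w1 /\ is_even w1 -> is_state w2 /\ is_even w2 ->
  fnorm (prod_scalar w1 w2) (x * y) <= min_norm x * fnorm (prod_scalar w1 w2) y.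
Proof.
move=> s1 s2; have [H [pi [xi g]]] := fermi_GNS (prod_scalar_state s1 s2).
rewrite -!(GNS_fnorm _ g) rmorphM /=.
rewrite (le_trans (opnorm_bound _ _)) // ler_wpM2r ?hnorm_ge0 //.
have [K K0 hK] := fermi_rep_bounded x.
apply: ub_le_sup; last by exists w1, w2, H, pi, xi.
by exists K => _ [? [? [H' [pi' [xi' [_ _ [pi'S _ _] ->]]]]]]; exact: hK.
Qed.

Lemma min_le_max x : min_norm x <= max_norm x.
Proof.
apply: sup_le_bound; first exact: max_norm_ge0.
by move=> _ [w1 [w2 [H [pi [xi [_ _ [piS _ _] ->]]]]]]; exact: max_norm_ub.
Qed.

End NormCharacterizations.

(** * Normal functionals and the normal norm *)

Section VonNeumannSlices.
Variables (R : realType) (H : hilbertType R) (M : gradedVonNeumann H).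
Implicit Types (r s : vn_sort M) (v : H).

Definition vn_vector (z : H) (r : vn_sort M) : R[i] := inner (vn_val r z) z.

Fact vn_vector_linear z : linear_for *%R (vn_vector z).
Proof. by move=> c r s; rewrite /vn_vector /= innerDl innerZl. Qed.
HB.instance Definition _ z :=
  GRing.isLinear.Build R[i] (vn_sort M) R[i] *%R (vn_vector z) (vn_vector_linear z).

Lemma vn_vector_inner z r s : vn_vector z (star s * r) = inner (vn_val r z) (vn_val s z).
Proof. by rewrite /vn_vector /= inner_starl. Qed.

Lemma vn_vector_ge0 z : is_positive (vn_vector z).
Proof. by move=> r; rewrite vn_vector_inner; exact: inner_ge0. Qed.

Lemma vn_vector_even (i : bool) z : vn_Gamma M z = (-1) ^+ i *: z -> is_even (vn_vector z).
Proof.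
move=> zi r; rewrite /vn_vector /= -{1}(vn_Gamma_selfadjoint M) inner_starl zi.
have -> : vn_val r ((-1) ^+ i *: z) = (-1) ^+ i *: vn_val r z by rewrite linearZ.
by rewrite innerZl innerZr mulrA rmorph_sign -signr_addb addbb mul1r.
Qed.

(** With g = Gamma v, both sides equal half of <r v, v> + <r g, g>: the left by moving Gamma across
    the inner product, the right by the parallelogram identity for the form of r. *)
Lemma vn_even_part_inner r v (z := fun i : bool => 2^-1 *: (v + (-1) ^+ i *: vn_Gamma M v)) :
  inner (vn_val (hpart false r) v) v = vn_vector (z false) r + vn_vector (z true) r.
Proof.
rewrite /vn_vector /z /hpart expr0 expr1 !scale1r !scaleN1r /=.
have -> : inner (2^-1 *: (vn_val r v + vn_Gamma M (vn_val r (vn_Gamma M v)))) v =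
   2^-1 * (inner (vn_val r v) v + inner (vn_val r (vn_Gamma M v)) (vn_Gamma M v)).
  by rewrite innerZl innerDl -{1}(vn_Gamma_selfadjoint M) inner_starl.
set g := vn_Gamma M v.
have -> : vn_val r (2^-1 *: (v + g)) = 2^-1 *: (vn_val r v + vn_val r g).
  by rewrite linearZ linearD.
have -> : vn_val r (2^-1 *: (v - g)) = 2^-1 *: (vn_val r v - vn_val r g).
  by rewrite linearZ linearB.
rewrite !innerZl !innerZr !(innerBl, innerDl) !(innerBr, innerDr).
have -> : (2^-1 : R[i])^* = 2^-1 by rewrite fmorphV /= rmorph_nat.
by field.
Qed.

Lemma vn_Gamma_halves v (i : bool) (z := 2^-1 *: (v + (-1) ^+ i *: vn_Gamma M v)) :
  vn_Gamma M z = (-1) ^+ i *: z.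
Proof.
rewrite /z linearZ linearD /= linearZ /= scalerA mulrC -scalerA; congr (_ *: _).
have -> : vn_Gamma M (vn_Gamma M v) = v.
  by rewrite -[LHS]/((vn_Gamma M * vn_Gamma M : 'B H) v) vn_Gamma_unitary.
by rewrite scalerDr scalerA -signr_addb addbb scale1r addrC.
Qed.

(** No continuity of w is assumed, so operator positivity is converted by [vn_positive] into w (r +
    e) = w ([star h * h]) >= 0, and then e tends to 0. *)
Lemma vn_state_ge0 (w : {scalar vn_sort M}) r : is_positive w ->
  (forall v, 0 <= inner (vn_val r v) v) -> 0 <= w r.
Proof.
move=> w0 r0; have w1 : 0 <= w 1 by have := w0 1; rewrite starA1 mulr1.
have h (e : R) : 0 < e -> 0 <= w r + e%:C%C * w 1.
  by move=> /(vn_positive r0)[k hk]; rewrite -[_ * w 1]linearZ -linearD /= hk; exact: w0.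
have [a b] := (cge0P _).1 w1.
apply/cge0P; split; last first.
  have [_] := (cge0P _).1 (h 1 ltr01).
  have -> : complex.Im (w r + 1%:C%C * w 1) = complex.Im (w r) + 1 * complex.Im (w 1).
    by rewrite -ImZ raddfD.
  by rewrite b mulr0 addr0.
apply/ler_addgt0Pr => e e0.
have d0 : 0 < e / (complex.Re (w 1) + 1) by rewrite divr_gt0 // ltr_wpDl.
have := cge0_ReE (h _ d0); rewrite ReD ReZ => hh; rewrite (le_trans hh) // lerD2l.
by rewrite mulrAC ler_pdivrMr ?ltr_wpDl // ler_pM2l // lerDl.
Qed.

Variable A : gradedStarAlgType R.
Local Notation T := (fermi_tensor (vn_sort M) A).
Implicit Types (x y : T) (w : {scalar A}).

(** The slice map id (x) w. An inequality for the products of w with all v becomes positivity of one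
    element of the algebra. *)
Definition slice w x : vn_sort M := tensor_lift (fun r a => w a *: r) x.

Lemma slice_bilin w : bilin (fun (r : vn_sort M) a => w a *: r).
Proof.
split=> [a c r s|r c a b] /=; first by rewrite scalerDr !scalerA mulrC.
by rewrite linearP scalerDl scalerA.
Qed.

Lemma sliceE (v : {scalar vn_sort M}) w x : prod_scalar v w x = v (slice w x).
Proof.
elim/tensor_ind: x => [r a|x y IH IH'].
  by rewrite prod_scalar_tens /slice (tensor_lift_tens (slice_bilin w)) linearZ mulrC.
have := tensor_lift_linear (slice_bilin w) 1 x y; rewrite !scale1r /slice => ->.
by rewrite !linearD IH IH'.
Qed.

(** An even v kills the odd part of the slice, and the quadratic form of the even part at u is the
    sum of the vector functionals of the two homogeneous halves of u. The hypothesis makes both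
    terms nonnegative. *)
Lemma slice_positive w x :
  (forall (i : bool) z, vn_Gamma M z = (-1) ^+ i *: z ->
     0 <= prod_scalar (vn_vector z) w x) ->
  forall v : {scalar vn_sort M}, is_positive v -> is_even v -> 0 <= prod_scalar v w x.
Proof.
move=> h v v0 ve; rewrite sliceE (hpart_sum (slice w x)) linearD.
have -> : v (hpart true (slice w x)) = 0.
  by apply: even_odd0 => //; exact: hpart_homogeneous.
rewrite addr0.
apply: vn_state_ge0 => // u; rewrite vn_even_part_inner.
have hz (i : bool) : 0 <= vn_vector (2^-1 *: (u + (-1) ^+ i *: vn_Gamma M u)) (slice w x).
  by rewrite -sliceE; apply: (h i); exact: vn_Gamma_halves.
by rewrite addr_ge0.
Qed.

(** Squared, the seminorm inequality says that c^2 [star y * y] - [star (x * y) * (x * y)] has a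
    nonnegative value, a condition linear in v to which [slice_positive] applies. Both comparisons
    with the minimal norm over a von Neumann algebra start here. *)
Lemma vn_min_norm_le x (c : R) : 0 <= c ->
  (forall w (i : bool) z, is_state w /\ is_even w -> vn_Gamma M z = (-1) ^+ i *: z ->
     forall y, fnorm (prod_scalar (vn_vector z) w) (x * y) <=
               c * fnorm (prod_scalar (vn_vector z) w) y) ->
  min_norm x <= c.
Proof.
move=> c0 h; apply: min_norm_le => // v w [[v0 _] ve] [[w0 w1] we] y.
have key (u : {scalar vn_sort M}) : is_positive u -> is_even u ->
    prod_scalar u w ((c ^+ 2)%:C%C *: (star y * y) - star (x * y) * (x * y)) =
    (c ^+ 2 * fnorm (prod_scalar u w) y ^+ 2 - fnorm (prod_scalar u w) (x * y) ^+ 2)%:C%C.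
  move=> u0 ue; have p0 := prod_scalar_ge0 ue we u0 w0.
  have E1 := fnorm_sqrC p0 y; have E2 := fnorm_sqrC p0 (x * y).
  by rewrite linearB linearZ E1 E2 [RHS]rmorphB [X in _ = X - _]rmorphM /=.
have p0 := prod_scalar_ge0 ve we v0 w0.
rewrite -(@ler_pXn2r _ 2) ?nnegrE ?mulr_ge0 ?fnorm_ge0 // exprMn -subr_ge0 -lecR.
rewrite -key //; apply: slice_positive => // i z zi.
have z0 := vn_vector_ge0 z; have ze := vn_vector_even zi.
rewrite key // lecR subr_ge0 -exprMn ler_pXn2r ?nnegrE ?mulr_ge0 ?fnorm_ge0 //.
by apply: (h w i).
Qed.

End VonNeumannSlices.

Section Predual.
Variables (R : realType) (H : hilbertType R) (M : gradedVonNeumann H).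
Implicit Types (f g : vn_sort M -> R[i]).

Lemma predualD f g : predual f -> predual g -> predual (fun r => f r + g r).
Proof.
move=> [fl fc] [gl gc]; split; first by move=> c r s; rewrite fl gl; ring.
by move=> F r FF Fr; exact: (@cvgD _ R[i]^o _ F FF f g _ _ (fc F r FF Fr) (gc F r FF Fr)).
Qed.

Lemma predualZ (c : R[i]) f : predual f -> predual (fun r => c * f r).
Proof.
move=> [fl fc]; split; first by move=> d r s; rewrite fl; ring.
move=> F r FF Fr.
have h := @cvgZl_tmp R[i] R[i]^o _ F FF c f (f r) (fc F r FF Fr).
exact: h.
Qed.

Lemma series_single (V : zmodType) (g : nat -> V) n :
  (forall k, g k.+1 = 0) -> (0 < n)%N -> series g n = g 0%N.
Proof.
move=> g0 n0; rewrite /series /= big_ltn // big_nat_cond big1 ?addr0 //.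
by move=> [|k] //=; rewrite g0.
Qed.

(* These are the ultraweak functionals of the sequences (u, 0, 0, ...) and
   (v, 0, 0, ...). *)
Lemma predual_inner (u v : H) : predual (fun r : vn_sort M => inner (vn_val r u) v).
Proof.
split; first by move=> c r s; rewrite /= innerDl innerZl.
pose single (x : H) (n : nat) : H := if n is 0%N then x else 0.
have sq x : square_summable (single x).
  apply: (@is_cvg_near_cst _ _ (hnorm x ^+ 2)); exists 1%N => // n /= n1.
  by rewrite series_single //= => k; rewrite hnorm0 expr0n.
have E : ultraweak_functional (single u) (single v) =
    (fun r : vn_sort M => inner (vn_val r u) v : R[i]^o).
  apply/funext => r; apply: (lim_near_cst (@norm_hausdorff _ _)).
  exists 1%N => // n /= n1; rewrite series_single //= => k.
  exact: (sform0r (hilbert_form H)).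
by move=> F r FF /(_ (single u) (single v) (sq u) (sq v)); rewrite E.
Qed.

End Predual.

Section ScaledFunctional.
Variables (R : realType) (D : starAlgType R) (phi : {scalar D}).

Fact conj_functional_linear (y : D) :
  linear_for *%R (fun z : D => phi (star y * z * y)).
Proof. by move=> c u v; rewrite mulrDr mulrDl -scalerAr -scalerAl linearP. Qed.
(** For positive phi, the vector functional of the vector of y in the GNS space of phi. *)
Definition conj_functional y : {scalar D} :=
  HB.pack (fun z : D => phi (star y * z * y))
    (GRing.isLinear.Build R[i] D R[i] *%R _ (conj_functional_linear y)).

Fact scaled_functional_linear (c : R[i]) : linear_for *%R (fun z : D => c * phi z).
Proof. by move=> d u v; rewrite linearP; ring. Qed.
Definition scaled_functional c : {scalar D} :=
  HB.pack (fun z : D => c * phi z)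
    (GRing.isLinear.Build R[i] D R[i] *%R _ (scaled_functional_linear c)).

Lemma conj_functionalE y x z :
  conj_functional y (star x * z) = phi (star (x * y) * (z * y)).
Proof. by rewrite /= starM !mulrA. Qed.

Lemma conj_functional_fnorm y z : fnorm (conj_functional y) z = fnorm phi (z * y).
Proof. by rewrite /fnorm conj_functionalE. Qed.

Lemma conj_functional_ge0 y : is_positive phi -> is_positive (conj_functional y).
Proof. by move=> p0 x; rewrite conj_functionalE. Qed.

Lemma scaled_functional_fnorm (t : R) z : 0 <= t ->
  fnorm (scaled_functional (t ^+ 2)%:C%C) z = t * fnorm phi z.
Proof.
move=> t0; rewrite /fnorm /= ReZ sqrtrM ?sqr_ge0 // sqrtr_sqr ger0_norm //.
Qed.
End ScaledFunctional.

(** * Comparison of the normal norm with the minimal and maximal norms *)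

Section NormalNorm.
Variables (R : realType) (H : hilbertType R) (M : gradedVonNeumann H).
Variable A : gradedCstarAlgType R.
Local Notation T := (fermi_tensor (vn_sort M) A).
Implicit Types (x y : T).

Definition is_normal (phi : T -> R[i]) : Prop :=
  forall b : A, predual (fun r : vn_sort M => phi (tens r b)).

Lemma nor_norm_ge0 x : 0 <= nor_norm x.
Proof. by apply: sup_nonneg => _ [phi _ ->]; exact: sqrtr_ge0. Qed.

(** The normal norm is defined by phi (x * star x), so it controls the GNS vector of [star x] and
    not that of x. *)
Lemma fnorm_starE (phi : {scalar T}) x :
  fnorm phi (star x) = Num.sqrt (complex.Re (phi (x * star x))).
Proof. by rewrite /fnorm starK. Qed.

Lemma state_fnorm1 (phi : {scalar T}) : is_state phi -> fnorm phi 1 = 1.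
Proof. by move=> [_ h]; rewrite /fnorm starA1 mulr1 h sqrtr1. Qed.

Lemma nor_norm_le x (c : R) : 0 <= c ->
  (forall phi : {scalar T}, is_state phi -> is_normal phi -> fnorm phi (star x) <= c) ->
  nor_norm x <= c.
Proof.
move=> c0 h; apply: sup_le_bound => // _ [phi [s n] ->].
by rewrite -fnorm_starE h.
Qed.

Lemma nor_norm_ub x (phi : {scalar T}) : is_state phi -> is_normal phi ->
  fnorm phi (star x) <= nor_norm x.
Proof.
move=> ps pn; have [K K0 hK] := fermi_bounded (star x).
rewrite fnorm_starE; apply: ub_le_sup; last by exists phi.
exists K => _ [psi [s _] ->]; rewrite -fnorm_starE.
by have := hK psi s.1 1; rewrite mulr1 (state_fnorm1 s) mulr1.
Qed.

Lemma nor_norm_positive_ub x (psi : {scalar T}) : is_positive psi -> is_normal psi ->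
  fnorm psi (star x) <= nor_norm x * fnorm psi 1.
Proof.
move=> p0 pn; have m0 := fnorm_ge0 psi 1; have x0 := nor_norm_ge0 x.
(* If psi 1 = 0 there is nothing to normalise, and the uniform bound makes the left side vanish. *)
have [mE|mN] := eqVneq (fnorm psi 1) 0.
  have [K K0 hK] := fermi_bounded (star x).
  by have := hK psi p0 1; rewrite mulr1 mE !mulr0.
set m := fnorm psi 1 in m0 mN *; have {}m0 : 0 < m by rewrite lt_def mN.
have i0 : 0 <= m^-1 by rewrite invr_ge0 ltW.
(* psi 1 = m^2, because [fnorm] is a square root; hence the factor m^-2. *)
pose phi := scaled_functional psi (m^-1 ^+ 2)%:C%C.
have fs : is_state phi.
  split=> [z|]; first by rewrite /= mulr_ge0 // lecR sqr_ge0.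
  have := fnorm_sqrC p0 1; rewrite starA1 mulr1 /= => ->.
  by rewrite -rmorphM -exprMn mulVf // expr1n.
have fn : is_normal phi by move=> b; exact: (predualZ _ (pn b)).
have := nor_norm_ub x fs fn; rewrite scaled_functional_fnorm //.
by rewrite mulrC ler_pdivrMr.
Qed.

(** Separate y1 and y2 make the expression additive in each, which allows induction on both. On
    elementary tensors with b and s2 homogeneous it is a constant times r |-> <r s2 z, s1 z>, which
    is normal. *)
Lemma prod_vector_normal (w : {scalar A}) (z : H) (y1 y2 : T) (b : A) :
  is_even (vn_vector (M := M) z) -> is_even w ->
  predual (fun r : vn_sort M =>
    prod_scalar (vn_vector z) w (star y1 * ((tens r b : T) * y2))).
Proof.
move=> ze we.
pose f (u1 : T) (c : A) (u2 : T) (r : vn_sort M) :=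
  prod_scalar (vn_vector z) w (star u1 * ((tens r c : T) * u2)).
rewrite -/(f y1 b y2); elim/tensor_ind: y1 => [s1 a1|u u' IH IH']; last first.
  have -> : f (u + u') b y2 = (fun r => f u b y2 r + f u' b y2 r).
    by apply/funext => r; rewrite /f starD mulrDl linearD.
  exact: (predualD IH IH').
elim/tensor_ind: y2 => [s2 a2|u u' IH IH']; last first.
  have -> : f (tens s1 a1) b (u + u') =
      (fun r => f (tens s1 a1) b u r + f (tens s1 a1) b u' r).
    by apply/funext => r; rewrite /f !mulrDr linearD.
  exact: (predualD IH IH').
elim/homogeneous_ind: b => [i b hb|b b' IH IH']; last first.
  have -> : f (tens s1 a1) (b + b') (tens s2 a2) =
      (fun r => f (tens s1 a1) b (tens s2 a2) r + f (tens s1 a1) b' (tens s2 a2) r).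
    by apply/funext => r; rewrite /f tensDr mulrDl !mulrDr linearD.
  exact: (predualD IH IH').
elim/homogeneous_ind: s2 => [j s2 hs|s2 s2' IH IH']; last first.
  have -> : f (tens s1 a1) b (tens (s2 + s2') a2) =
      (fun r => f (tens s1 a1) b (tens s2 a2) r + f (tens s1 a1) b (tens s2' a2) r).
    by apply/funext => r; rewrite /f tensDl !mulrDr linearD.
  exact: (predualD IH IH').
have -> : f (tens s1 a1) b (tens s2 a2) = (fun r => (-1) ^+ (i && j) *
    w (star a1 * (b * a2)) * inner (vn_val r (vn_val s2 z)) (vn_val s1 z)).
  apply/funext => r; rewrite /f (tensM_homogeneous _ _ hb hs) -scalerAr linearZ.
  rewrite (prod_scalar_inner ze we).
  change ((-1) ^+ (i && j) *
    (vn_vector z (star s1 * (r * s2)) * w (star a1 * (b * a2))) =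
    (-1) ^+ (i && j) * w (star a1 * (b * a2)) *
    inner (vn_val r (vn_val s2 z)) (vn_val s1 z)).
  by rewrite vn_vector_inner mulrAC mulrA.
exact: (predualZ ((-1) ^+ (i && j) * w (star a1 * (b * a2)))
  (predual_inner M (vn_val s2 z) (vn_val s1 z))).
Qed.

(* The normal norm bounds star x * u; since |x y|^2 = <star x * (x y), y>, it
   bounds x * y as well. *)
Lemma min_le_nor x : min_norm x <= nor_norm x.
Proof.
apply: vn_min_norm_le => [|w i z [[w0 _] we] zi y]; first exact: nor_norm_ge0.
have ze := vn_vector_even zi; have p0 := prod_scalar_ge0 ze we (vn_vector_ge0 z) w0.
set phi := prod_scalar _ _ in p0 *; set c := nor_norm x; have c0 : 0 <= c := nor_norm_ge0 x.
have h u : fnorm phi (star x * u) <= c * fnorm phi u.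
  have un : is_normal (conj_functional phi u).
    move=> b; have := prod_vector_normal u u b ze we; congr predual.
    by apply/funext => r; rewrite /= mulrA.
  have := nor_norm_positive_ub x (conj_functional_ge0 u p0) un.
  by rewrite !conj_functional_fnorm mul1r.
have [->|n0] := eqVneq (fnorm phi (x * y)) 0; first by rewrite mulr_ge0 ?fnorm_ge0.
have {}n0 : 0 < fnorm phi (x * y) by rewrite lt_def n0 fnorm_ge0.
rewrite -(ler_pM2l n0) -expr2 (fnorm_sqr p0).
have -> : star (x * y) * (x * y) = star y * (star x * (x * y)) by rewrite starM -mulrA.
rewrite (le_trans (fnorm_CS p0 _ _)) // mulrCA mulrA ler_wpM2r ?fnorm_ge0 //.
Qed.

Lemma nor_le_max x : nor_norm x <= max_norm x.
Proof.
apply: nor_norm_le => [|phi ps _]; first exact: max_norm_ge0.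
have [K [pi [xi g]]] := fermi_GNS ps; have [piS _ _] := g.
rewrite -(GNS_fnorm _ g) piS (le_trans (star_bound (opnorm_ge0 _) (opnorm_bound _) _)) //.
have -> : hnorm xi = 1.
  by rewrite -(state_fnorm1 ps) -(GNS_fnorm _ g) rmorph1.
by rewrite mulr1; exact: max_norm_ub.
Qed.

End NormalNorm.

(** * The double commutant theorem for one vector *)

Section Projection.
Variables (R : realType) (H : hilbertType R) (S : set H).
Hypothesis S0 : S 0.
Hypothesis S_lin : forall c x y, S x -> S y -> S (c *: x + y).
Implicit Types (h p s x y : H).

Definition in_closure x := forall e : R, 0 < e -> exists2 s, S s & hnorm (x - s) <= e.
(** Orthogonality is asked against S, which need not be closed; continuity extends it to the
    closure. *)
Definition is_projection h p :=
  in_closure p /\ forall s, S s -> inner (h - p) s = 0.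

Lemma parallelogram x y :
  hnorm (x - y) ^+ 2 = 2 * hnorm x ^+ 2 + 2 * hnorm y ^+ 2 - hnorm (x + y) ^+ 2.
Proof. by rewrite -!rinner_hnorm !rinnerE (rinnerC y x); ring. Qed.

Lemma in_closure_lin c x y : in_closure x -> in_closure y -> in_closure (c *: x + y).
Proof.
move=> hx hy e e0; have c0 := cmod_ge0 c.
have e1 : 0 < e / (cmod c + 1) by rewrite divr_gt0 // ltr_wpDl.
have [s Ss hs] := hx _ e1; have [t St ht] := hy _ e1.
exists (c *: s + t); first exact: S_lin.
have -> : c *: x + y - (c *: s + t) = c *: (x - s) + (y - t).
  by rewrite opprD addrACA -scalerBr.
rewrite (le_trans (hnormD _ _)) // hnormZC.
have E : (cmod c + 1) * (e / (cmod c + 1)) = e by rewrite mulrC divfK // gt_eqF // ltr_wpDl.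
have := ler_wpM2l c0 hs; lra.
Qed.

Lemma in_closure_orth h p : is_projection h p -> forall x, in_closure x -> inner (h - p) x = 0.
Proof.
move=> [_ ho] x hx; apply: cmod0_eq0; apply/le_anti; rewrite cmod_ge0 andbT.
apply/ler_addgt0Pr => e e0; rewrite add0r; have g0 := hnorm_ge0 (h - p).
have e1 : 0 < e / (hnorm (h - p) + 1) by rewrite divr_gt0 // ltr_wpDl.
have [s Ss hs] := hx _ e1.
have -> : inner (h - p) x = inner (h - p) (x - s) by rewrite innerBr (ho _ Ss) subr0.
rewrite (le_trans (inner_CS _ _)) // (le_trans (ler_wpM2l g0 hs)) //.
by rewrite mulrCA ger_pMr // ler_pdivrMr ?ltr_wpDl // mul1r lerDl.
Qed.

Lemma projection_unique h p p' : is_projection h p -> is_projection h p' -> p = p'.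
Proof.
move=> hp hp'; have pp : in_closure (p - p').
  by have := in_closure_lin (-1) hp'.1 hp.1; rewrite scaleN1r addrC.
have h1 := in_closure_orth hp pp; have h2 := in_closure_orth hp' pp.
apply/eqP; rewrite -subr_eq0; apply/eqP/hnorm_eq0/eqP.
rewrite -sqrf_eq0 -rinner_hnorm /rinner.
have {1}-> : p - p' = (h - p') - (h - p) by rewrite opprB [RHS]addrC addrA subrK.
by rewrite innerBl h1 h2 subrr.
Qed.

Lemma projection_exists h : exists p, is_projection h p.
Proof.
pose E := [set hnorm (h - s) ^+ 2 | s in S].
have Einf : has_inf E.
  split; first by exists (hnorm (h - 0) ^+ 2), 0.
  by exists 0 => _ [s _ <-]; exact: sqr_ge0.
pose d := inf E.
have dE s : S s -> d <= hnorm (h - s) ^+ 2.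
  by move=> Ss; apply: ge_inf; [exact: Einf.2 | exists s].
have ex (n : nat) : exists s, S s /\ hnorm (h - s) ^+ 2 < d + n.+1%:R^-1.
  have n0 : 0 < n.+1%:R^-1 :> R by rewrite invr_gt0.
  by have [_ [s Ss <-] hs] := inf_adherent n0 Einf; exists s.
pose u n := projT1 (cid (ex n)).
have uS n : S (u n) by rewrite /u; case: cid => s [].
have ud n : hnorm (h - u n) ^+ 2 < d + n.+1%:R^-1 by rewrite /u; case: cid => s [].
have small (e : R) : 0 < e -> exists N, forall n, (N <= n)%N -> n.+1%:R^-1 < e :> R.
  move=> e0; have [N _ hN] := near_infty_natSinv_lt (PosNum e0).
  by exists N => n /hN.
have [e e0|p hp] := @hilbert_cauchy R H u.
  (* The midpoint of u m and u n lies in S, so the parallelogram identity bounds |u m - u n|^2 by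
     twice the sum of the two excesses over d; e^2/4 for each excess gives e^2. *)
  have e40 : 0 < e ^+ 2 / 4 by rewrite divr_gt0 // exprn_gt0.
  have [N hN] := small _ e40; exists N => m n /hN hm /hN hn.
  rewrite -(@ltr_pXn2r _ 2) ?nnegrE ?hnorm_ge0 ?(ltW e0) //.
  have Sm : S ((2^-1) *: (u m + u n)).
    rewrite -[_ *: _]addr0; apply: S_lin => //.
    by have := S_lin 1 (uS m) (uS n); rewrite scale1r.
  move: hm hn (dE _ Sm) (ud m) (ud n).
  move: (m.+1%:R^-1 : R) (n.+1%:R^-1 : R) => a b hm hn.
  have -> : u m - u n = (h - u n) - (h - u m) by rewrite opprB [RHS]addrC addrA subrK.
  rewrite (parallelogram (h - u n) (h - u m)).
  have -> : (h - u n) + (h - u m) = 2%:R *: (h - 2^-1 *: (u m + u n)).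
    rewrite scalerBr scalerA divff // scale1r scaler_nat mulr2n.
    by rewrite addrACA -opprD (addrC (u n)).
  set x := h - _ *: _; have -> : hnorm (2%:R *: x) = 2 * hnorm x.
    have -> : (2%:R : R[i]) = (2%:R : R)%:C%C by rewrite rmorph_nat.
    by rewrite hnormZ ger0_norm.
  rewrite exprMn; lra.
have pc : in_closure p.
  move=> e /hp[N /(_ N (leqnn N)) hN]; exists (u N); first exact: uS.
  by rewrite hnormB ltW.
exists p; split=> //.
have pd : hnorm (h - p) ^+ 2 <= d.
  apply/ler_addgt0Pr => e e0; have g0 := hnorm_ge0 (h - p).
  have k0 : 0 < 2 * (hnorm (h - p) + 1) by rewrite mulr_gt0 // ltr_wpDl.
  have e1 : 0 < Num.min (e / 2 / (2 * (hnorm (h - p) + 1))) 1.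
    by rewrite lt_min ltr01 andbT !divr_gt0.
  have [N hN] := hp _ e1; have [N' hN'] := small (e / 2) ltac:(by rewrite divr_gt0).
  have := hN _ (leq_maxl N N'); have := hN' _ (leq_maxr N N'); set n := maxn N N'.
  have := ud n; move: (n.+1%:R^-1 : R) => r hr h1; rewrite lt_min => /andP[h2 h3].
  move: hr.
  have h4 := hnormD (h - u n) (u n - p); rewrite addrA subrK in h4.
  have h5 : hnorm (u n - p) * (2 * (hnorm (h - p) + 1)) <= e / 2.
    by rewrite -ler_pdivlMr // ltW.
  have h6 := hnorm_ge0 (h - u n); have h7 := hnorm_ge0 (u n - p).
  move: (hnorm _) (hnorm (h - u n)) (hnorm (u n - p)) g0 k0 h2 h3 h4 h5 h6 h7 => a b c.
  move=> g0 k0 h2 h3 h4 h5 h6 h7 h8.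
  (* If a <= c, then a^2 <= a c is already small; otherwise 0 < a - c <= b may be squared. *)
  have [ac|ac] := leP a c; first by nra.
  have h9 : 0 <= (b - (a - c)) * (b + (a - c)) by apply: mulr_ge0; lra.
  nra.
(* p is only a limit of points of S, so the variations p + t s used below lie in the closure and
   minimality has to be extended to it. *)
have dl x : in_closure x -> d <= hnorm (h - x) ^+ 2.
  move=> hx; apply/ler_addgt0Pr => e e0; have g0 := hnorm_ge0 (h - x).
  have k0 : 0 < 2 * hnorm (h - x) + 1 by rewrite ltr_wpDl // mulr_ge0.
  have e1 : 0 < Num.min (e / (2 * hnorm (h - x) + 1)) 1.
    by rewrite lt_min ltr01 andbT divr_gt0.
  have [s Ss] := hx _ e1; rewrite le_min => /andP[h1 h2].
  have h4 := hnormD (h - x) (x - s); rewrite addrA subrK in h4.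
  rewrite (le_trans (dE _ Ss)) //.
  have h5 : hnorm (x - s) * (2 * hnorm (h - x) + 1) <= e by rewrite -ler_pdivlMr.
  have := hnorm_ge0 (h - s); have := hnorm_ge0 (x - s); nra.
have re s : S s -> rinner (h - p) s = 0.
  move=> Ss; set g := rinner _ _; set b := hnorm s ^+ 2.
  have b0 : 0 <= b by exact: sqr_ge0.
  have key (t : R) : 0 <= t ^+ 2 * b - 2 * t * g.
    have hx : in_closure (p + t%:C%C *: s).
      rewrite addrC; apply: in_closure_lin => // e e0.
      by exists s => //; rewrite subrr hnorm0 ltW.
    have := le_trans pd (dl _ hx); rewrite opprD addrA -!rinner_hnorm !rinnerE.
    have -> : g = rinner h s - rinner p s by rewrite /g rinnerBl.
    have -> : rinner s s = b by rewrite rinner_hnorm.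
    rewrite (rinnerC s h) (rinnerC s p) {dl pd hx}; set x1 := rinner h h.
    move: (rinner h s) (rinner p s) (rinner p h) (rinner h p) (rinner p p).
    by move=> x2 x3 x4 x5 x6 hh; nra.
  (* The minimiser of the quadratic in t would be g / b; b + 1 avoids division by zero for s = 0 and
     still gives a negative multiple of g^2. *)
  have := key (g / (b + 1)).
  have -> : (g / (b + 1)) ^+ 2 * b - 2 * (g / (b + 1)) * g =
    - (g ^+ 2 * ((b + 2) / (b + 1) ^+ 2)) by field; rewrite gt_eqF // ltr_wpDl.
  rewrite oppr_ge0 pmulr_lle0; last by rewrite divr_gt0 ?exprn_gt0 //; lra.
  by move=> hg; apply/eqP; rewrite -sqrf_eq0 eq_le hg sqr_ge0.
move=> s Ss; apply/eqP; rewrite eq_complex /= -/(rinner _ _) re // eqxx /=.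
have Si : S ('i%C *: s) by rewrite -[_ *: _]addr0; apply: S_lin.
have := re _ Si; rewrite rinnerC rinneri innerC conjCE.
by case: (inner _ _) => a b /= /eqP; rewrite opprK.
Qed.

Definition projection h : H := projT1 (cid (projection_exists h)).

Lemma projectionP h : is_projection h (projection h).
Proof. by rewrite /projection; case: cid. Qed.

Fact projection_linear : linear projection.
Proof.
move=> c x y; apply: projection_unique (projectionP _) _.
have [cx ox] := projectionP x; have [cy oy] := projectionP y.
split; first exact: in_closure_lin.
move=> s Ss; rewrite opprD addrACA -scalerBr innerDl innerZl ox // oy //.
by rewrite mulr0 addr0.
Qed.

Lemma projection_bound h : hnorm (projection h) <= 1 * hnorm h.
Proof.
have hp := projectionP h; have := in_closure_orth hp hp.1.
move=> /(congr1 (@complex.Re R)) /=; rewrite innerBl ReB => /eqP; rewrite subr_eq0 => /eqP E.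
rewrite mul1r; have g0 := hnorm_ge0 (projection h).
have [->|n0] := eqVneq (hnorm (projection h)) 0; first exact: hnorm_ge0.
have {}n0 : 0 < hnorm (projection h) by rewrite lt_def n0.
by rewrite -(ler_pM2r n0) -expr2 -rinner_hnorm /rinner -E rinner_le.
Qed.

Definition projection_op : 'B H :=
  let L := GRing.isLinear.Build R[i] H H *:%R projection projection_linear in
  let P : {linear H -> H} := HB.pack projection L in
  @Bop R H P (@bounded_continuous R H P 1 projection_bound).

End Projection.

(* The projection on the closure of D v commutes with D, hence with the
   bicommutant of D. *)
Lemma bicommutant_vector_dense (R : realType) (H : hilbertType R) (D : starAlgType R)
    (f : D -> 'B H) (T : 'B H) (v : H) :
  linear f -> GRing.monoid_morphism f -> (forall x, f (star x) = star (f x)) ->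
  commutant (commutant (range f)) T ->
  forall e : R, 0 < e -> exists x, hnorm (T v - f x v) <= e.
Proof.
move=> fL [f1 fM] fS hT e e0.
pose S := [set f x v | x in [set: D]].
have f0 : f 0 = 0.
  by have := fL (-1) 0 0; rewrite scaler0 addr0 scaleN1r addNr.
have S0 : S 0 by exists 0 => //; rewrite f0.
have SL c x y : S x -> S y -> S (c *: x + y).
  by move=> [a _ <-] [b _ <-]; exists (c *: a + b) => //; rewrite fL.
pose P := projection_op S0 SL.
have PC : commutant (range f) P.
  move=> _ [x _ <-]; apply: bop_ext => h /=.
  apply: (projection_unique SL (projectionP S0 SL _)).
  have [ch oh] := projectionP S0 SL h; split.
    move=> d d0; have [K K0 hK] := bop_bounded (f x).
    have d1 : 0 < d / (K + 1) by rewrite divr_gt0 // ltr_wpDl.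
    have [_ [y _ <-] hy] := ch _ d1; exists (f (x * y) v); first by exists (x * y).
    rewrite fM /= -linearB (le_trans (hK _)) // (le_trans (ler_wpM2l K0 hy)) //.
    by rewrite mulrCA ger_pMr // ler_pdivrMr ?ltr_wpDl // mul1r lerDl.
  move=> _ [y _ <-]; rewrite -linearB inner_star -fS.
  have -> : f (star x) (f y v) = f (star x * y) v by rewrite fM.
  by apply: oh; exists (star x * y).
have Pv : projection S0 SL v = v.
  apply: (projection_unique SL (projectionP S0 SL v)); split.
    by move=> d d0; exists v; [exists 1 => //; rewrite f1 | rewrite subrr hnorm0 ltW].
  by move=> s _; rewrite subrr; exact: (sform0l (hilbert_form H)).
have TP : T v = projection S0 SL (T v).
  have := congr1 (fun X : 'B H => X v) (hT _ PC) => /=.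
  by rewrite Pv.
have [cT _] := projectionP S0 SL (T v).
by have [_ [x _ <-]] := cT _ e0; rewrite -TP; exists x.
Qed.

(** * Doubling a representation *)

Definition graded_hom (R : realType) (D E : gradedStarAlgType R) (f : D -> E) : Prop :=
  [/\ linear f, GRing.monoid_morphism f, forall x, f (star x) = star (f x)
    & forall x, f (grading x) = grading (f x)].

Section GradedHom.
Variables (R : realType) (D E : gradedStarAlgType R) (f : D -> E).
Hypothesis hf : graded_hom f.

Lemma graded_homD x y : f (x + y) = f x + f y.
Proof. by case: hf => fL _ _ _; have := fL 1 x y; rewrite !scale1r. Qed.
Lemma graded_hom0 : f 0 = 0.
Proof. by apply: (addrI (f 0)); rewrite -graded_homD !addr0. Qed.
Lemma graded_homZ c x : f (c *: x) = c *: f x.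
Proof. by case: hf => fL _ _ _; have := fL c x 0; rewrite graded_hom0 !addr0. Qed.
Lemma graded_homM x y : f (x * y) = f x * f y.
Proof. by case: hf => _ [_ ->]. Qed.
Lemma graded_hom1 : f 1 = 1.
Proof. by case: hf => _ []. Qed.
Lemma graded_homS x : f (star x) = star (f x).
Proof. by case: hf. Qed.
Lemma graded_hom_homogeneous i x : homogeneous i x -> homogeneous i (f x).
Proof. by case: hf => _ _ _ fG; rewrite /homogeneous -fG => ->; exact: graded_homZ. Qed.
End GradedHom.

Lemma graded_hom_id (R : realType) (D : gradedStarAlgType R) : graded_hom (@id D).
Proof. by []. Qed.

Lemma graded_hom_grading (R : realType) (D : gradedStarAlgType R) :
  graded_hom (grading : D -> D).
Proof. by split=> //; [exact: gradingL | exact: gradingM | exact: gradingS]. Qed.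

Section FermiMap.
Variables (R : realType) (D1 D2 E1 E2 : gradedStarAlgType R).
Variables (f : D1 -> E1) (g : D2 -> E2).
Hypotheses (hf : graded_hom f) (hg : graded_hom g).
Local Notation T := (fermi_tensor D1 D2).
Local Notation U := (fermi_tensor E1 E2).
Implicit Types x y : T.

Definition fermi_map x : U := tensor_lift (fun a b => tens (f a) (g b) : U) x.

Fact fermi_map_bilin : bilin (fun a b => tens (f a) (g b) : U).
Proof.
split=> [b c a a'|a c b b'] /=.
- by rewrite graded_homD ?graded_homZ // tensDl tensZl.
- by rewrite graded_homD ?graded_homZ // tensDr tensZr.
Qed.

Lemma fermi_map_tens a b : fermi_map (tens a b) = tens (f a) (g b).
Proof. exact: (tensor_lift_tens fermi_map_bilin). Qed.

Lemma fermi_mapP c x y : fermi_map (c *: x + y) = c *: fermi_map x + fermi_map y.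
Proof. exact: (tensor_lift_linear fermi_map_bilin). Qed.

Lemma fermi_mapD x y : fermi_map (x + y) = fermi_map x + fermi_map y.
Proof. by have := fermi_mapP 1 x y; rewrite !scale1r. Qed.
Lemma fermi_map0 : fermi_map 0 = 0.
Proof. by apply: (addrI (fermi_map 0)); rewrite -fermi_mapD !addr0. Qed.
Lemma fermi_mapZ c x : fermi_map (c *: x) = c *: fermi_map x.
Proof. by have := fermi_mapP c x 0; rewrite fermi_map0 !addr0. Qed.

Lemma fermi_map1 : fermi_map 1 = 1.
Proof. by rewrite fermi1E fermi_map_tens !graded_hom1. Qed.

Lemma fermi_mapM x y : fermi_map (x * y) = fermi_map x * fermi_map y.
Proof.
elim/fermi_ind: x => [i j a b ha hb|x x' IH IH']; last first.
  by rewrite mulrDl !fermi_mapD IH IH' mulrDl.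
elim/fermi_ind: y => [k l c d hc hd|y y' IH IH']; last first.
  by rewrite mulrDr !fermi_mapD IH IH' mulrDr.
rewrite (tensM_homogeneous _ _ hb hc) fermi_mapZ !fermi_map_tens !graded_homM //.
rewrite (tensM_homogeneous _ _ (graded_hom_homogeneous hg hb) (graded_hom_homogeneous hf hc)).
by [].
Qed.

Lemma fermi_mapS x : fermi_map (star x) = star (fermi_map x).
Proof.
elim/fermi_ind: x => [i j a b ha hb|x x' IH IH']; last first.
  by rewrite starD !fermi_mapD IH IH' starD.
rewrite (star_tens_homogeneous ha hb) fermi_mapZ !fermi_map_tens !graded_homS //.
rewrite (star_tens_homogeneous (graded_hom_homogeneous hf ha) (graded_hom_homogeneous hg hb)).
by [].
Qed.

End FermiMap.

Section Doubling.
Variables (R : realType) (K : hilbertType R) (D : starAlgType R).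
Variables (pi : {lrmorphism D -> 'B K}) (theta : D -> D).
Hypothesis piS : star_preserving pi.
Hypotheses (theta_lin : linear theta) (theta1 : theta 1 = 1).
Hypothesis thetaM : forall x y, theta (x * y) = theta x * theta y.
Hypothesis thetaS : forall x, theta (star x) = star (theta x).
Hypothesis thetaK : involutive theta.

Local Notation V := (K * K)%type.
Definition double_inner (u v : V) : R[i] := inner u.1 v.1 + inner u.2 v.2.

Fact double_inner_l w : linear_for *%R (fun v : V => double_inner v w).
Proof. by move=> c u v; rewrite /double_inner !innerDl !innerZl; ring. Qed.
Fact double_inner_herm u v : double_inner u v = (double_inner v u)^*.
Proof. by rewrite /double_inner rmorphD /= -!innerC. Qed.
Fact double_inner_ge0 v : 0 <= double_inner v v.
Proof. by rewrite addr_ge0 ?inner_ge0. Qed.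

Definition double_form : semi_inner V :=
  SemiInner double_inner_l double_inner_herm double_inner_ge0.

Lemma double_snorm_sqr v : snorm double_form v ^+ 2 = hnorm v.1 ^+ 2 + hnorm v.2 ^+ 2.
Proof. by rewrite snorm_sqr /= /double_inner !inner_hnorm. Qed.

Lemma double_snorm_le v (c : R) (k : R) : 0 <= c ->
  hnorm v.1 <= c -> hnorm v.2 <= k -> snorm double_form v <= c + k.
Proof.
move=> c0 h1 h2; have k0 := le_trans (hnorm_ge0 _) h2.
rewrite -(@ler_pXn2r _ 2) ?nnegrE ?snorm_ge0 ?addr_ge0 // double_snorm_sqr.
have := hnorm_ge0 v.1; have := hnorm_ge0 v.2; nra.
Qed.

Lemma hnorm_le_double v : hnorm v.1 <= snorm double_form v /\ hnorm v.2 <= snorm double_form v.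
Proof.
have h := double_snorm_sqr v; have s0 := snorm_ge0 double_form v.
by split; rewrite -(@ler_pXn2r _ 2) ?nnegrE ?hnorm_ge0 // h; rewrite (lerDl, lerDr) sqr_ge0.
Qed.

Lemma double_snorm0 (k : K) : snorm double_form (k, 0) = hnorm k.
Proof.
apply/eqP; rewrite -(@eqrXn2 _ 2) ?snorm_ge0 ?hnorm_ge0 // double_snorm_sqr /=.
by rewrite hnorm0 expr0n addr0.
Qed.

(* K * K is completed only to be normed by its inner product: the norm of the
   product of two normed modules is the maximum. *)
Lemma graded_double : exists (H : hilbertType R) (pi' : {lrmorphism D -> 'B H}) (G : 'B H),
  [/\ star_preserving pi', star G = G /\ G * G = 1,
      forall x, G * pi' x * G = pi' (theta x)
    & forall x, opnorm (pi x) <= opnorm (pi' x)].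
Proof.
have nz : exists v, snorm double_form v != 0.
  have [k k0] := @hilbert_neq0 _ K; exists (k, 0); rewrite double_snorm0.
  by apply: contra k0 => /eqP /hnorm_eq0 ->.
pose P := PreHilbert nz; pose j := @completion_of R P.
(* The direct sum of pi and pi o theta. As theta is an involution, conjugation by the swap of the
   summands implements it; the first summand retains the norm of pi(x). *)
pose t (x : D) (v : V) : V := (pi x v.1, pi (theta x) v.2).
have [|||||pi' [pi'S pij]] := @completion_rep R P D t.
- move=> x v w; rewrite /= /double_inner /= thetaS !piS.
  by rewrite !inner_star.
- move=> x; exists (opnorm (pi x) + opnorm (pi (theta x))).
    by rewrite addr_ge0 ?opnorm_ge0.
  move=> v; have [h1 h2] := hnorm_le_double v.
  rewrite mulrDl double_snorm_le ?mulr_ge0 ?opnorm_ge0 ?snorm_ge0 //=.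
    by rewrite (le_trans (opnorm_bound _ _)) // ler_wpM2l ?opnorm_ge0.
  by rewrite (le_trans (opnorm_bound _ _)) // ler_wpM2l ?opnorm_ge0.
- by move=> x y v; rewrite /t thetaM !rmorphM.
- by case=> a b; rewrite /t theta1 !rmorph1.
- by move=> c x y v; rewrite /t theta_lin !linearP.
pose sw (v : V) : V := (v.2, v.1).
have swE v w : double_form (sw v) w = double_form v (sw w).
  by rewrite /= /double_inner /= addrC.
have [|||G GE] := @completion_op R P sw sw 1 => //.
  move=> z; rewrite mul1r le_eqVlt; apply/orP; left; apply/eqP.
  apply/eqP; rewrite -(@eqrXn2 _ 2) ?snorm_ge0 //.
  rewrite [snorm (ph_form P) _ ^+ 2]double_snorm_sqr.
  by rewrite [snorm (ph_form P) z ^+ 2]double_snorm_sqr addrC.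
have Gj v : G (j v) = j (sw v) by exact: (@completion_op_of R P sw sw G swE GE v).
exists (completion P), pi', G; split => //.
- split; last first.
    by apply: completion_op_eq => -[a b]; rewrite /= -!/(j _) !Gj.
  apply: completion_op_eq => v; apply: completion_ext => z.
  rewrite -[LHS]completion_form_of -[LHS]inner_completion inner_starl -!/(j _) !Gj.
  by rewrite inner_completion completion_form_ofof; exact: esym (swE v z).
- move=> x; apply: completion_op_eq => v; rewrite /= -!/(j _) !Gj !pij /= -!/(j _) Gj.
  by rewrite /t /sw /= thetaK.
- move=> x; apply: opnorm_le => [|k]; first exact: opnorm_ge0.
  have := opnorm_bound (pi' x) (j (k, 0)).
  rewrite pij !hnorm_completion !snorm_completion_of [snorm _ (k, 0)]double_snorm0.
  apply: le_trans; rewrite -[leLHS]double_snorm0.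
  by rewrite /t /= linear0.
Qed.

End Doubling.

(** * The graded von Neumann algebra generated by a set *)

Section GeneratedVonNeumann.
Variables (R : realType) (H : hilbertType R) (X : set 'B H) (G : 'B H).
Hypothesis X_star : forall T, X T -> X (star T).
Hypothesis G_star : star G = G.
Hypothesis G_unitary : G * G = 1.
Hypothesis X_G : forall T, X T -> X (G * T * G).

Lemma commutant_star (Y : set 'B H) : (forall T, Y T -> Y (star T)) ->
  forall T, commutant Y T -> commutant Y (star T).
Proof.
move=> Ys T hT S YS; have := congr1 star (hT _ (Ys _ YS)).
by rewrite !starM !starK => ->.
Qed.

Lemma commutant_conj (Y : set 'B H) : (forall T, Y T -> Y (G * T * G)) ->
  forall T, commutant Y T -> commutant Y (G * T * G).
Proof.
have GG (T : 'B H) : G * (G * T) = T by rewrite mulrA G_unitary mul1r.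
move=> YG T hT S YS; have := congr1 (fun Z => G * Z * G) (hT _ (YG _ YS)).
by rewrite /= -!mulrA !GG G_unitary !mulr1.
Qed.

Lemma subset_bicommutant (Y : set 'B H) : Y `<=` commutant (commutant Y).
Proof. by move=> T YT S hS; rewrite hS. Qed.

Lemma tricommutant (Y : set 'B H) : commutant (commutant (commutant Y)) = commutant Y.
Proof.
apply/seteqP; split; last exact: subset_bicommutant.
by move=> T hT S YS; apply: hT; exact: subset_bicommutant.
Qed.

Let N := commutant (commutant X).
Fact generated_star T : N T -> N (star T).
Proof. by apply: commutant_star; apply: commutant_star. Qed.
Fact generated_bicommutant : commutant (commutant N) = N.
Proof. exact: tricommutant. Qed.
Fact generated_Gamma : [set G * T * G | T in N] = N.
Proof.
have NG T : N T -> N (G * T * G) by apply: commutant_conj; apply: commutant_conj.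
apply/seteqP; split=> [_ [T NT <-]|T NT]; first exact: NG.
exists (G * T * G); first exact: NG.
by rewrite -!mulrA G_unitary mulr1 mulrA G_unitary mul1r.
Qed.

Definition generated_vn : gradedVonNeumann H := GradedVonNeumann
  generated_star generated_bicommutant G_star G_unitary generated_Gamma.

End GeneratedVonNeumann.

(** * Extension of a representation to M (x) A *)

(** Functionals of homogeneous vectors are not normalised and may vanish, so the bound for states is
    rescaled. *)
Lemma min_norm_positive_ub (R : realType) (D1 D2 : gradedCstarAlgType R)
    (x : fermi_tensor D1 D2) (w1 : {scalar D1}) (w2 : {scalar D2}) y :
  is_positive w1 -> is_even w1 -> is_state w2 /\ is_even w2 ->
  fnorm (prod_scalar w1 w2) (x * y) <= min_norm x * fnorm (prod_scalar w1 w2) y.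
Proof.
move=> p1 e1 [[p2 n2] e2]; have p0 := prod_scalar_ge0 e1 e2 p1 p2.
have w11 : w1 1 = (fnorm w1 1 ^+ 2)%:C%C by rewrite -(fnorm_sqrC p1) starA1 mulr1.
have m0 := fnorm_ge0 w1 1.
(* If w1 1 = 0, the product functional vanishes at 1, and the uniform bound makes its seminorm
   vanish everywhere. *)
have [mE|mN] := eqVneq (fnorm w1 1) 0.
  have z0 u : fnorm (prod_scalar w1 w2) u = 0.
    have [K K0 hK] := fermi_bounded u.
    have := hK _ p0 1; rewrite mulr1 => h; apply/le_anti; rewrite fnorm_ge0 andbT.
    rewrite (le_trans h) // /fnorm starA1 mulr1 fermi1E prod_scalar_tens w11 mE.
    by rewrite expr0n mul0r sqrtr0 mulr0.
  by rewrite !z0 mulr0.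
have {mN}m0 : 0 < fnorm w1 1 by rewrite lt_def mN.
have i0 : 0 < (fnorm w1 1)^-1 by rewrite invr_gt0.
set m := (fnorm w1 1)^-1 in i0.
pose w := scaled_functional w1 (m ^+ 2)%:C%C.
have ws : is_state w /\ is_even w.
  split; last by move=> u; rewrite /= e1.
  split=> [u|]; first by rewrite /= mulr_ge0 // lecR sqr_ge0.
  by rewrite /= w11 -rmorphM -exprMn /m mulVf ?expr1n // gt_eqF.
have wE u : fnorm (prod_scalar w w2) u = m * fnorm (prod_scalar w1 w2) u.
  rewrite -(scaled_functional_fnorm _ _ (ltW i0)) /fnorm; congr (Num.sqrt (complex.Re _)).
  elim/tensor_ind: (star u * u) => [a b|a b IH IH']; last by rewrite !linearD IH IH'.
  by rewrite prod_scalar_tens [RHS]/= prod_functional_tens mulrA.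
have := min_norm_ub x y ws (conj (conj p2 n2) e2).
by rewrite !wE mulrCA ler_pM2l.
Qed.

Section NormalExtension.
Variables (R : realType) (B A : gradedCstarAlgType R) (H : hilbertType R).
Local Notation T := (fermi_tensor B A).
Variables (pi : {lrmorphism T -> 'B H}) (G : 'B H).
Hypothesis piS : star_preserving pi.
Hypotheses (GS : star G = G) (GG : G * G = 1).
Hypothesis Gpi : forall x : T, G * pi x * G = pi (fermi_map grading grading x).

Let X : set 'B H := range (fun b : B => pi (tens b 1)).

Fact left_image_star S : X S -> X (star S).
Proof. by move=> [b _ <-]; exists (star b) => //; rewrite -piS star_tens1. Qed.

Let Gb (b : B) : G * pi (tens b 1) * G = pi (tens (grading b) 1).
Proof.
rewrite Gpi fermi_map_tens; try exact: graded_hom_grading.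
by rewrite (graded_hom1 (graded_hom_grading A)).
Qed.

Fact left_image_Gamma S : X S -> X (G * S * G).
Proof. by move=> [b _ <-]; rewrite Gb; exists (grading b). Qed.

Definition left_vn : gradedVonNeumann H :=
  generated_vn left_image_star GS GG left_image_Gamma.
Local Notation M := left_vn.
Local Notation U := (fermi_tensor (vn_sort M) A).

Fact left_rep_subproof (b : B) : pi (tens b 1) \in vn_pred M.
Proof. by apply/asboolP; apply: subset_bicommutant; exists b. Qed.
Definition left_rep (b : B) : vn_sort M := VnElement (left_rep_subproof b).
Local Notation rho := left_rep.

Lemma left_rep_hom : graded_hom rho.
Proof.
split.
- by move=> c a b; apply: val_inj; rewrite /= tensDl tensZl linearP.
- split; first by apply: val_inj; rewrite /= -fermi1E rmorph1.
  by move=> a b; apply: val_inj; rewrite /= -tens1M rmorphM.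
- by move=> b; apply: val_inj; rewrite /= -star_tens1 piS.
- by move=> b; apply: val_inj; rewrite /= Gb.
Qed.

Let vnP (r : vn_sort M) S : commutant X S -> vn_val r * S = S * vn_val r.
Proof. by move=> hS; case: r => r /= /asboolP h; exact: h. Qed.

Let GGl (S : 'B H) : G * (G * S) = S. Proof. by rewrite mulrA GG mul1r. Qed.

(* For odd a, it is G * pi (tens 1 a) that commutes with the image of B. *)
Lemma right_image_commutes i j (a : A) (r : vn_sort M) :
  homogeneous i a -> homogeneous j r ->
  pi (tens 1 a) * vn_val r = (-1) ^+ (i && j) *: (vn_val r * pi (tens 1 a)).
Proof.
move=> ha hr; have Gr : G * vn_val r * G = (-1) ^+ j *: vn_val r.
  have E : grading r = (-1) ^+ j *: r := hr.
  exact: (congr1 (fun s : vn_sort M => vn_val s) E).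
have ab k (b : B) : homogeneous k b ->
    pi (tens 1 a) * pi (tens b 1) = (-1) ^+ (i && k) *: (pi (tens b 1) * pi (tens 1 a)).
  move=> hb; rewrite -!rmorphM -tens_factor (tensM_homogeneous _ _ ha hb) mul1r mulr1.
  exact: (linearZ_LR pi).
case: i ha ab => ha ab; last first.
  rewrite expr0 scale1r; apply/esym/vnP => _ [b _ <-].
  elim/homogeneous_ind: b => [k b hb|b b' IH IH'].
    by rewrite (ab k) // expr0 scale1r.
  by rewrite tensDl linearD mulrDr mulrDl IH IH'.
have GpC : commutant X (G * pi (tens 1 a)).
  move=> _ [b _ <-]; elim/homogeneous_ind: b => [k b hb|b b' IH IH'].
    rewrite -mulrA (ab k) //= -scalerAr.
    have bG : pi (tens b 1) * G = (-1) ^+ k *: (G * pi (tens b 1)).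
      have E : grading b = (-1) ^+ k *: b := hb.
      by rewrite -[LHS]GGl (mulrA G _ G) Gb E tensZl linearZ /= -scalerAr.
    by rewrite [RHS]mulrA bG -scalerAl mulrA.
  by rewrite tensDl linearD mulrDr mulrDl IH IH'.
have := congr1 (fun S => G * S) (vnP r GpC); rewrite /= -!mulrA GGl => <-.
by rewrite !mulrA Gr scalerAl.
Qed.

Definition normal_ext_fun (x : U) : 'B H :=
  tensor_lift (fun r a => vn_val r * pi (tens 1 a)) x.

Fact normal_ext_bilin : bilin (fun (r : vn_sort M) (a : A) => vn_val r * pi (tens 1 a)).
Proof.
split=> [a c r s|r c a b] /=; first by rewrite mulrDl -scalerAl.
by rewrite tensDr tensZr linearP mulrDr -scalerAr.
Qed.

Lemma normal_ext_tens (r : vn_sort M) a :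
  normal_ext_fun (tens r a) = vn_val r * pi (tens 1 a).
Proof. exact: (tensor_lift_tens normal_ext_bilin). Qed.

Fact normal_ext_linear : linear normal_ext_fun.
Proof. exact: (tensor_lift_linear normal_ext_bilin). Qed.

Let extD x y : normal_ext_fun (x + y) = normal_ext_fun x + normal_ext_fun y.
Proof. by have := normal_ext_linear 1 x y; rewrite !scale1r. Qed.
Let extZ c x : normal_ext_fun (c *: x) = c *: normal_ext_fun x.
Proof.
have e0 : normal_ext_fun 0 = 0.
  by apply: (addrI (normal_ext_fun 0)); rewrite -extD !addr0.
by have := normal_ext_linear c x 0; rewrite e0 !addr0.
Qed.

(** The sign rule of the Fermi product is exactly the commutation rule of [right_image_commutes]. *)
Fact normal_ext_monoid : GRing.monoid_morphism normal_ext_fun.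
Proof.
split; first by rewrite fermi1E normal_ext_tens mul1r -fermi1E rmorph1.
move=> x y; elim/fermi_ind: x => [i j r a hr ha|x x' IH IH']; last first.
  by rewrite mulrDl !extD IH IH' mulrDl.
elim/fermi_ind: y => [k l s b hs hb|y y' IH IH']; last first.
  by rewrite mulrDr !extD IH IH' mulrDr.
rewrite (tensM_homogeneous _ _ ha hs) extZ !normal_ext_tens -tensM1 rmorphM /=.
rewrite -!mulrA; rewrite (mulrA (pi (tens 1 a)) (vn_val s)).
by rewrite (right_image_commutes ha hs) -scalerAl -scalerAr -mulrA.
Qed.

Definition normal_ext : {lrmorphism U -> 'B H} := HB.pack normal_ext_fun
  (GRing.isLinear.Build R[i] U _ *:%R normal_ext_fun normal_ext_linear)
  (GRing.isMonoidMorphism.Build U _ normal_ext_fun normal_ext_monoid).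

Lemma normal_ext_star : star_preserving normal_ext.
Proof.
move=> x; change (normal_ext_fun (star x) = star (normal_ext_fun x)).
elim/fermi_ind: x => [i j r a hr ha|x x' IH IH']; last first.
  by rewrite starD !extD IH IH' starD.
rewrite (star_tens_homogeneous hr ha) extZ !normal_ext_tens starM -piS star_1tens.
rewrite (right_image_commutes (homogeneous_star ha) (homogeneous_star hr : homogeneous i (star r))).
by rewrite andbC.
Qed.

Lemma normal_ext_map (x : T) : normal_ext (fermi_map rho id x) = pi x.
Proof.
change (normal_ext_fun (fermi_map rho id x) = pi x).
have hr := left_rep_hom; have hi := graded_hom_id A.
elim/tensor_ind: x => [b a|x y IH IH'].
  by rewrite fermi_map_tens // normal_ext_tens /= -rmorphM -tens_factor.
by rewrite fermi_mapD // extD IH IH' linearD.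
Qed.

(** The vector functional at u is normal because it is r |-> <r pi(1 (x) a) u, u> on tensors. The
    normal norm then bounds the adjoint of [normal_ext z] at u, and an operator has the same bounds
    as its adjoint. *)
Lemma normal_ext_le (z : U) : opnorm (normal_ext z) <= nor_norm z.
Proof.
apply: opnorm_le => [|v]; first exact: nor_norm_ge0.
rewrite -[normal_ext z]starK; apply: star_bound => [|u]; first exact: nor_norm_ge0.
have un : is_normal (vector_functional normal_ext u).
  move=> a; have := predual_inner M (pi (tens 1 a) u) u; congr predual.
  by apply/funext => r; rewrite /= normal_ext_tens.
have := nor_norm_positive_ub z (vector_functional_ge0 u normal_ext_star) un.
by rewrite !(vector_functional_fnorm _ normal_ext_star) rmorph1 normal_ext_star.
Qed.

(** Pulling the functional of z back along [rho] gives an even positive functional on B, so the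
    bound holds on the image of B (x) A. That image is dense in the seminorm of phi, since
    approximation at the single vector z suffices; this is the gain from testing vector functionals
    instead of arbitrary even states. *)
Lemma min_norm_map_le (x : T) : min_norm (fermi_map rho id x) <= min_norm x.
Proof.
have hr := left_rep_hom; have hi := graded_hom_id A.
apply: vn_min_norm_le => [|w i z [[w0 w1] we] zi y]; first exact: min_norm_ge0.
have ze := vn_vector_even zi; have p0 := prod_scalar_ge0 ze we (vn_vector_ge0 z) w0.
set phi := prod_scalar _ _ in p0 *; set c := min_norm x.
have c0 : 0 <= c := min_norm_ge0 x.
have uL : linear_for *%R (fun b : B => vn_vector z (rho b)).
  by have [rL _ _ _] := hr; move=> d a b; rewrite rL linearP.
pose u : {scalar B} := HB.pack (fun b : B => vn_vector z (rho b))
  (GRing.isLinear.Build R[i] B R[i] *%R _ uL).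
have phiE (q : T) : phi (fermi_map rho id q) = prod_scalar u w q.
  elim/tensor_ind: q => [b a|q q' IH IH']; last by rewrite fermi_mapD // !linearD IH IH'.
  by rewrite fermi_map_tens // /phi !prod_scalar_tens.
have fE (q : T) : fnorm phi (fermi_map rho id q) = fnorm (prod_scalar u w) q.
  by rewrite /fnorm -fermi_mapS // -fermi_mapM // phiE.
have u0 : is_positive u by move=> b; rewrite /= graded_homM // graded_homS //; exact: vn_vector_ge0.
have ue : is_even u by move=> b; rewrite /= -(ze (rho b)); case: hr => _ _ _ ->.
have hc (q : T) : fnorm phi (fermi_map rho id x * fermi_map rho id q) <=
    c * fnorm phi (fermi_map rho id q).
  by rewrite -fermi_mapM // !fE; apply: min_norm_positive_ub.
(* On elementary tensors the seminorm factors as |(r - [rho b]) z| times the seminorm of a, and b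
   comes from the bicommutant. *)
have dens (v : U) (e : R) : 0 < e -> exists q : T, fnorm phi (v - fermi_map rho id q) <= e.
  elim/tensor_ind: v e => [r a|v v' IH IH'] e e0; last first.
    have [q hq] := IH (e / 2) ltac:(by rewrite divr_gt0).
    have [q' hq'] := IH' (e / 2) ltac:(by rewrite divr_gt0).
    exists (q + q'); rewrite fermi_mapD // opprD addrACA.
    by rewrite (le_trans (fnormD p0 _ _)) // [e]splitr lerD.
  have a0 := fnorm_ge0 w a.
  have e1 : 0 < e / (fnorm w a + 1) by rewrite divr_gt0 // ltr_wpDl.
  have rN : commutant (commutant (range (fun b : B => pi (tens b 1)))) (vn_val r).
    by case: (r) => s /= /asboolP.
  have [|||b hb] := @bicommutant_vector_dense R H B (fun b => pi (tens b 1))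
    (vn_val r) z _ _ _ rN _ e1.
  - by move=> d b b'; rewrite tensDl tensZl linearP.
  - by split=> [|b b']; rewrite ?rmorph1 // -tens1M rmorphM.
  - by move=> b; rewrite -star_tens1 piS.
  exists (tens b a); rewrite fermi_map_tens // -tensBl.
  have -> : fnorm phi (tens (r - rho b) a) = hnorm (vn_val r z - pi (tens b 1) z) * fnorm w a.
    rewrite /fnorm /phi (prod_scalar_inner ze we).
    change (Num.sqrt (complex.Re (vn_vector z (star (r - rho b) * (r - rho b)) *
      w (star a * a))) = hnorm (vn_val (r - rho b) z) * fnorm w a).
    rewrite vn_vector_inner inner_hnorm ReZ sqrtrM ?sqr_ge0 // sqrtr_sqr.
    by rewrite ger0_norm ?hnorm_ge0.
  rewrite (le_trans (ler_wpM2r a0 hb)) // mulrAC ler_pdivrMr ?ltr_wpDl //.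
  by rewrite ler_pM2l // lerDl.
(* K may be much larger than c, but it multiplies only the approximation error and disappears with
   e. *)
have [K K0 hK] := fermi_bounded (fermi_map rho id x).
apply/ler_addgt0Pr => e e0.
have e1 : 0 < e / (K + c + 1) by rewrite divr_gt0 // ltr_wpDl // addr_ge0.
have [q hq] := dens y _ e1; set y' := fermi_map rho id q in hq.
have h1 := hK phi p0 (y - y'); have h2 := hc q; rewrite -/y' in h2.
have h3 := fnormD p0 (fermi_map rho id x * (y - y')) (fermi_map rho id x * y').
rewrite -mulrDr subrK in h3.
have h4 : fnorm phi y' <= fnorm phi y + fnorm phi (y - y').
  by rewrite -{1}(subKr y y') (le_trans (fnormD p0 _ _)) // fnormN.
have h5 : (K + c + 1) * (e / (K + c + 1)) = e.
  by rewrite mulrC divfK // gt_eqF // ltr_wpDl // addr_ge0.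
have h6 := ler_wpM2l K0 hq; have h7 := ler_wpM2l c0 h4; have h8 := ler_wpM2l c0 hq.
lra.
Qed.

End NormalExtension.

(** * The equivalence *)

Lemma max_le_min (R : realType) (A : gradedCstarAlgType R) :
  (forall (H : hilbertType R) (M : gradedVonNeumann H) (x : fermi_tensor (vn_sort M) A),
     nor_norm x = min_norm x) ->
  forall (B : gradedCstarAlgType R) (x : fermi_tensor B A), max_norm x <= min_norm x.
Proof.
move=> h B x; apply: sup_le_bound; first exact: min_norm_ge0.
move=> _ [K [pi [piS ->]]].
have hB := graded_hom_grading B; have hA := graded_hom_grading A.
have [|||||H [pi' [G [pi'S [GS GG] Gpi pi_le]]]] := @graded_double R K _ pi
    (fermi_map (grading : B -> B) (grading : A -> A)) piS.
- by move=> c u v; exact: fermi_mapP.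
- exact: fermi_map1.
- exact: fermi_mapM.
- exact: fermi_mapS.
- move=> u; elim/tensor_ind: u => [b a|u v IH IH']; last by rewrite !fermi_mapD // IH IH'.
  by rewrite !fermi_map_tens // !gradingK.
rewrite (le_trans (pi_le x)) // -(normal_ext_map pi'S GS GG Gpi).
rewrite (le_trans (normal_ext_le _)) // h.
exact: min_norm_map_le.
Qed.

Theorem theorem5p5 (R : realType) (A : gradedCstarAlgType R) :
  (forall (B : gradedCstarAlgType R) (x : fermi_tensor B A),
     max_norm x = min_norm x)
  <->
  (forall (H : hilbertType R) (M : gradedVonNeumann H)
     (x : fermi_tensor (vn_sort M) A),
     nor_norm x = min_norm x).
Proof.
split=> [h H M x|h B x]; apply/le_anti.
  by rewrite min_le_nor andbT (le_trans (nor_le_max x)) // h.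
by rewrite min_le_max andbT max_le_min.
Qed.
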